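(* Let $f$ be a function satisfying the following conditions. (1) $f(-x)\neq -f(x)$, i.e. $f$ is not an odd function. (2) $f$ is regular (analytic) at the point $x=0$, and its Taylor series has the form $$f(x)=\sum_{k=0}^{\infty}\frac{g^{(k)}(0)}{k!}\,(-x)^k ,$$ where $(-1)^k g^{(k)}(x)$ is the $k$-th derivative of $f(x)$ (so $g^{(k)}(0)=(-1)^k f^{(k)}(0)$ for $k=0,1,2,\dots$). (3) $x^{1/2}f(x)\to 0$ as $x\to\infty$. (4) $g^{(s)}(0)$ is a regular (analytic, single-valued) function of $s$ defined on the half-plane $H(\delta)=\{s\in\mathbb{C}:\operatorname{Re}(s)\geq-\delta\}$ for some $3/4<\delta<1$, and it satisfies the growth condition $$|g^{(s)}(0)|<C\,a^{\operatorname{Re}(s)}$$ for some constants $C$ and $a>0$ and all $s\in H(\delta)$. Then, for $q>a>0$, the first-order Hankel transform $$\mathcal{H}_1[f(x)](q)=\int_0^{\infty}x f(x)J_1(qx)\,dx$$ can be presented by the absolutely and uniformly convergent series $$\begin{aligned}\mathcal{H}_1[f(x)](q)&=\frac{1}{q^2}\sum_{m=0}^{\infty}(-1)^{m}\frac{\Gamma(2m+2)}{\Gamma^2(m+1)}\,f^{(2m)}(0)\,(2q)^{-2m}\\&=\frac{2}{q^2}\sum_{k=0}^{\infty}\frac{\Gamma(k/2+3/2)}{\Gamma(1/2-k/2)\,\Gamma(k+1)}\,f^{(k)}(0)\left(\frac{q}{2}\right)^{-k}.\end{aligned}$$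
   Context: $J_\nu$ is the Bessel function of the first kind of order $\nu$, $\Gamma$ is the Gamma function, and $1/\Gamma(z)$ is taken to be $0$ when $z$ is a non-positive integer. The parameter $q$ is positive and is not assumed to be large. The notation $g^{(s)}(0)$ for complex $s$ denotes a function of the complex variable $s$ whose value at each integer $s=k\geq 0$ is $g^{(k)}(0)=(-1)^k f^{(k)}(0)$. The number $a$ in ''$q>a>0$'' is the constant $a$ of the growth condition. The integral over $[0,\infty)$ is an improper integral.
   Formalization: The Taylor series is required to represent f on all of [0,∞), not just near 0 (else exp(-x) cut off at x>1 is a counterexample); uniform convergence is on [q0,∞) for each q0>a, since on all q>a it fails for f=exp(-x), a=1. *)

(* Defs.v *)
From Stdlib Require Import Reals Factorial.
From Coquelicot Require Import Coquelicot.
Open Scope R_scope.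

(** * The Gamma function on the real line *)

(** Euler's integral, meaningful for [0 < x]. *)
Definition euler_Gamma (x : R) : R :=
  RInt_gen (fun t => Rpower t (x - 1) * exp (- t))
           (at_right 0) (Rbar_locally p_infty).

Fixpoint rising (x : R) (n : nat) : R :=
  match n with
  | O => 1
  | S m => rising x m * (x + INR m)
  end.

(** The reciprocal [1 / Gamma], continued to all of [R] by
    [1 / Gamma x = x (x + 1) ... (x + n - 1) / Gamma (x + n)], where [n] is the
    least natural number with [0 < x + n] ([up] is the least integer strictly
    above its argument).  At a non-positive integer the product contains the
    factor 0, so the value there is 0. *)
Definition rGamma (x : R) : R :=
  let n := Z.to_nat (up (- x)) in
  rising x n / euler_Gamma (x + INR n).

(** Only meaningful away from the non-positive integers. *)
Definition Gamma (x : R) : R := / rGamma x.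

(** * Bessel functions of the first kind (integer order), Hankel transform *)

Definition bessel_J (n : nat) (x : R) : R :=
  Series (fun m => (-1) ^ m / (INR (fact m) * INR (fact (m + n)))
                   * (x / 2) ^ (2 * m + n)).

(** [l] is the value at [q] of the order-[n] Hankel transform of [f], the
    integral being the limit of the integrals over [[0, b]] as [b -> +oo]. *)
Definition is_hankel (n : nat) (f : R -> C) (q : R) (l : C) : Prop :=
  is_RInt_gen (V := C_R_NormedModule)
    (fun x => (RtoC (x * bessel_J n (q * x)) * f x)%C)
    (at_point 0) (Rbar_locally p_infty) l.

(** * Derivatives and Taylor expansion of a complex-valued function on [R] *)

Definition C_Derive_n (f : R -> C) (k : nat) (x : R) : C :=
  (Derive_n (fun t => Re (f t)) k x, Derive_n (fun t => Im (f t)) k x).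

(** The functions [g^(k)], for natural numbers [k]. *)
Definition g_deriv (f : R -> C) (k : nat) (x : R) : C :=
  (RtoC ((-1) ^ k) * C_Derive_n f k x)%C.

Definition taylor_at (f : R -> C) (x : R) : Prop :=
  is_pseries (K := R_AbsRing) (V := C_R_NormedModule)
    (fun k => (g_deriv f k 0 / RtoC (INR (fact k)))%C) (- x) (f x).

(** * Analytic functions on a half-plane *)

(** [G] is the sum of a power series near every point of [D].  Values of [G]
    outside [D] are irrelevant; at a boundary point of [D] the condition says
    that [G] extends analytically to a neighbourhood of that point. *)
Definition analytic_on (D : C -> Prop) (G : C -> C) : Prop :=
  forall s0 : C, D s0 ->
    exists (r : R) (c : nat -> C),
      0 < r /\
      forall s : C, D s -> Cmod (s - s0) < r ->
        is_pseries (K := C_AbsRing) (V := C_NormedModule) c (s - s0)%C (G s).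

Definition half_plane (delta : R) (s : C) : Prop := - delta <= Re s.

(** * Complex series depending on a real parameter *)

Definition C_Series (u : nat -> C) : C :=
  (Series (fun k => Re (u k)), Series (fun k => Im (u k))).

(** Absolute convergence for every [q > a], and uniform convergence on
    [[q0, +oo)] for every [q0 > a]. *)
Definition cv_abs_unif (a : R) (u : R -> nat -> C) : Prop :=
  (forall q, a < q -> ex_series (fun k => Cmod (u q k))) /\
  (forall q0, a < q0 ->
     forall eps, 0 < eps ->
       eventually (fun N => forall q, q0 <= q ->
         Cmod (sum_n (u q) N - C_Series (u q)) < eps)).

(** * The two series *)

Definition even_term (f : R -> C) (q : R) (m : nat) : C :=
  (RtoC ((-1) ^ m * (Gamma (2 * INR m + 2) / Gamma (INR m + 1) ^ 2))
   * C_Derive_n f (2 * m) 0 * RtoC (/ (2 * q) ^ (2 * m)))%C.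

Definition full_term (f : R -> C) (q : R) (k : nat) : C :=
  (RtoC (Gamma (INR k / 2 + 3 / 2) * rGamma (1 / 2 - INR k / 2)
         / Gamma (INR k + 1))
   * C_Derive_n f k 0 * RtoC (/ (q / 2) ^ k))%C.

(* Main.v *)
Require Import Defs.
From Stdlib Require Import Reals Lra Lia Factorial Psatz List ZArith.
From Coquelicot Require Import Coquelicot.
Open Scope R_scope.

(** The growth condition, read at the integers, says that |f^(k)(0)| <= M a^k:
    on the half-line [f] coincides with an entire function of exponential type [a].
    Taking real and imaginary parts and replacing [x] by [x / q] leaves a real
    series u(x) = sum_k c_k x^k, where |c_k| <= M b^k / k! and b = a / q < 1,
    and with the integral of h(x) = x J1(x) u(x). Since sqrt x J1(x) is bounded
    ([sqrt_J1_bounded]), the decay of [f] makes [h] tend to 0.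

    Formally the integral of [h] is the sum of c_k times the divergent moment
    of order k + 1 of [J1]. Abel summation gives these moments a value: for
    Re z > 0 the integral of x^n J1(x) exp(- z x) / n! is, up to sign, a Taylor
    coefficient of 1 - z / sqrt(1 + z^2), so that it continues to |z| < 1, where it
    is of size (1 - |z|)^(- n). The series of the c_k times the continued moments
    converges for |z| < 1 - b, and its value at z = 0 is the sum in the statement.
    Two points remain.

    First, the Laplace transform of [h] is that series, for Re z > 0 and |z| small
    ([abel_series_laplace]). When Re z > b the series integrates term by term. This
    extends along the horizontal line through [z], in small steps to the left,
    by expanding exp(t x) under the integral ([termwise_all]). It works because
    on the whole line the moments of order n are O(n! / rho^n) for some rho > b:
    the Bessel equation gives them a recurrence which, divided by z + i and z - i,
    is a convex combination ([bessel_rec_bound]). The initial value is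
    1 / sqrt(1 + z^2) ([Pmom_0_inv_sqrt]).

    Secondly, the integral of [h] itself converges to the value of the series at
    z = 0. This is the theorem of Fatou and Riesz ([fatou_riesz]): a function that
    tends to 0, and whose Laplace transform continues analytically to a disc
    around 0, has a convergent integral. Newman's argument proves it on one
    circle around 0. Holomorphy enters only through the mean value property, so
    that uniform limits of polynomials can stand for holomorphic functions.

    The value obtained is the series over the even derivatives, with
    coefficients (2 m + 1) binom(-1/2, m). In the series over all derivatives
    the odd terms vanish, since 1 / Gamma does at non-positive integers, and in
    the even ones Gamma(1/2) cancels ([full_coef_even]): it is half the other. Both
    are dominated by the series of M (k + 1) (a / q)^k. *)

(** * Power series of exponential type *)

(* [ring] and [field] need an equality stated in R itself, not in the carrier of
   an algebraic structure over R. *)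
Ltac eqR := match goal with |- @eq _ ?a ?b => change (@eq R a b) end.

Lemma ex_derive_cont (f : R -> R) (x : R) : ex_derive f x -> continuous f x.
Proof. apply (@ex_derive_continuous R_AbsRing R_NormedModule). Qed.

Definition exp_type (M b : R) (c : nat -> R) : Prop :=
  forall k, Rabs (c k) <= M * b ^ k / INR (fact k).

Lemma fact_pos (n : nat) : 0 < INR (fact n).
Proof. apply INR_fact_lt_0. Qed.

Lemma ex_series_dom (a v : nat -> R) :
  (forall n, Rabs (a n) <= v n) -> ex_series v -> ex_series (fun n => Rabs (a n)).
Proof.
  intros H Hv. apply (@ex_series_le R_AbsRing R_CompleteNormedModule _ v); auto.
  intro n. change norm with Rabs. rewrite Rabs_Rabsolu. apply H.
Qed.

Lemma Series_dom (a v : nat -> R) :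
  (forall n, Rabs (a n) <= v n) -> ex_series v -> Rabs (Series a) <= Series v.
Proof.
  intros H Hv. eapply Rle_trans. apply Series_Rabs. now apply (ex_series_dom a v).
  apply Series_le; auto. intro n; split. apply Rabs_pos. apply H.
Qed.

Lemma inv_ge0 (x : R) : 0 < x -> 0 <= / x.
Proof. intro H. left. now apply Rinv_0_lt_compat. Qed.

Lemma is_series_scal_R (c : R) (a : nat -> R) (l : R) :
  is_series a l -> is_series (fun n => c * a n) (c * l).
Proof. exact (is_series_scal_l c a l). Qed.

Lemma ex_series_scal_R (M : R) (a : nat -> R) : ex_series a -> ex_series (fun n => M * a n).
Proof. intros [l H]. exists (M * l). exact (is_series_scal_l M a l H). Qed.

Lemma is_series_exp (x : R) : is_series (fun k => x ^ k / INR (fact k)) (exp x).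
Proof.
  generalize (is_exp_Reals x); intro H. apply is_pseries_R in H.
  eapply is_series_ext; [|exact H]. intro n; simpl. unfold Rdiv; ring.
Qed.

Lemma ex_series_exp (x : R) : ex_series (fun k => x ^ k / INR (fact k)).
Proof. eexists; apply is_series_exp. Qed.

Lemma exp_tail_le (x : R) (n : nat) : 0 <= x ->
  ex_series (fun k => x ^ (n + k) / INR (fact (n + k))) /\
  Series (fun k => x ^ (n + k) / INR (fact (n + k))) <= exp x.
Proof.
  intros Hx. assert (He : ex_series (fun k => x ^ k / INR (fact k))) by (eexists; apply is_series_exp).
  assert (Hp : forall k, 0 <= x ^ k / INR (fact k)).
  { intro k. apply Rmult_le_pos. now apply pow_le. apply inv_ge0, fact_pos. }
  split. now apply (ex_series_incr_n (fun k => x ^ k / INR (fact k))).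
  destruct n as [|n]. simpl. right. apply is_series_unique, is_series_exp.
  rewrite <- (is_series_unique _ _ (is_series_exp x)).
  rewrite (Series_incr_n (fun k => x ^ k / INR (fact k)) (S n)); [|lia|exact He].
  assert (0 <= sum_f_R0 (fun k : nat => x ^ k / INR (fact k)) (Init.Nat.pred (S n))).
  { now apply cond_pos_sum. }
  lra.
Qed.

Lemma pow_fact_le_exp (x : R) (n : nat) : 0 <= x -> x ^ n / INR (fact n) <= exp x.
Proof.
  intros Hx. destruct (exp_tail_le x n Hx) as [He Hl]. eapply Rle_trans; [|exact Hl].
  rewrite (Series_incr_1 _ He). rewrite Nat.add_0_r.
  assert (0 <= Series (fun k : nat => x ^ (n + S k) / INR (fact (n + S k)))); [|lra].
  replace 0 with (Series (fun k : nat => 0 * (x ^ (n + S k) / INR (fact (n + S k)))))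
    by (rewrite Series_scal_l; ring).
  apply Series_le.
  - intro k. rewrite Rmult_0_l. split. lra. apply Rmult_le_pos. now apply pow_le. apply inv_ge0, fact_pos.
  - apply (ex_series_incr_1 (fun k => x ^ (n + k) / INR (fact (n + k)))). exact He.
Qed.

Section ExpType.
Variables (M b : R) (c : nat -> R).
Hypothesis (Hb : 0 <= b) (Hc : exp_type M b c).

Lemma exp_type_M_ge0 : 0 <= M.
Proof. generalize (Hc 0%nat); simpl. generalize (Rabs_pos (c 0%nat)). lra. Qed.

Lemma exp_type_term (x : R) k : Rabs (c k * x ^ k) <= M * ((b * Rabs x) ^ k / INR (fact k)).
Proof.
  rewrite Rabs_mult, <- RPow_abs, Rpow_mult_distr.
  replace (M * (b ^ k * Rabs x ^ k / INR (fact k))) with (M * b ^ k / INR (fact k) * Rabs x ^ k)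
   by (unfold Rdiv; ring).
  apply Rmult_le_compat_r. apply pow_le, Rabs_pos. apply Hc.
Qed.

Lemma exp_type_CV : CV_radius c = p_infty.
Proof.
  destruct (CV_radius_bounded c) as [H _].
  assert (Hr : forall r : R, Rbar_le r (CV_radius c)).
  { intro r. apply H. exists (M * exp (b * Rabs r)). intro n.
    eapply Rle_trans. apply exp_type_term. apply Rmult_le_compat_l. apply exp_type_M_ge0.
    apply pow_fact_le_exp. apply Rmult_le_pos; auto. apply Rabs_pos. }
  destruct (CV_radius c) as [r| |]; auto.
  - specialize (Hr (r + 1)). simpl in Hr. lra.
  - specialize (Hr 0). contradiction.
Qed.

Lemma exp_type_ex_series (x : R) : ex_series (fun k => c k * x ^ k).
Proof.
  apply ex_series_Rabs. apply (ex_series_dom _ (fun k => M * ((b * Rabs x) ^ k / INR (fact k)))).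
  - intro n. apply exp_type_term.
  - apply ex_series_scal_R, ex_series_exp.
Qed.

Lemma exp_type_continuous (x : R) : continuous (PSeries c) x.
Proof. apply continuity_pt_filterlim, PSeries_continuity. now rewrite exp_type_CV. Qed.

(** Comparing the tail with that of [exp (b' x)] gains the geometric factor
    [(b / b') ^ n] from every term. *)
Lemma exp_type_remainder (b' x : R) (n : nat) : b < b' -> 0 <= x ->
  Rabs (PSeries c x - sum_n (fun k => c k * x ^ k) n) <= M * (b / b') ^ S n * exp (b' * x).
Proof.
  intros Hbb Hx. unfold PSeries.
  rewrite (Series_incr_n _ (S n)); [|lia|apply exp_type_ex_series].
  rewrite sum_n_Reals. simpl Init.Nat.pred.
  replace (_ + _ - _) with (Series (fun k => c (S n + k)%nat * x ^ (S n + k))) by ring.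
  assert (Hbx : 0 <= b' * x) by (apply Rmult_le_pos; lra).
  destruct (exp_tail_le (b' * x) (S n) Hbx) as [He Hl].
  set (v := fun k => (b' * x) ^ (S n + k) / INR (fact (S n + k))) in *.
  assert (Hq : 0 <= b / b' <= 1).
  { split. apply Rmult_le_pos; auto. left. apply Rinv_0_lt_compat; lra.
    apply Rmult_le_reg_r with b'. lra. field_simplify; lra. }
  assert (Ht : forall k, Rabs (c (S n + k)%nat * x ^ (S n + k)) <= M * (b / b') ^ S n * v k).
  { intro k. eapply Rle_trans. apply exp_type_term. rewrite (Rabs_right x) by lra.
    rewrite Rmult_assoc. apply Rmult_le_compat_l. apply exp_type_M_ge0.
    unfold v. replace (b * x) with (b / b' * (b' * x)) by (field; lra).
    rewrite Rpow_mult_distr, pow_add. unfold Rdiv at 1. rewrite !Rmult_assoc.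
    apply Rmult_le_compat_l. apply pow_le; lra.
    rewrite <- (Rmult_1_l ((b' * x) ^ (S n + k) / INR (fact (S n + k)))).
    apply Rmult_le_compat_r. apply Rmult_le_pos. now apply pow_le. apply inv_ge0, fact_pos.
    rewrite <- (pow1 k). apply pow_incr. exact Hq. }
  assert (Hex : ex_series (fun k => M * (b / b') ^ S n * v k)).
  { now apply ex_series_scal_R. }
  eapply Rle_trans. apply (Series_dom _ _ Ht Hex).
  rewrite Series_scal_l. apply Rmult_le_compat_l; auto.
  apply Rmult_le_pos. apply exp_type_M_ge0. apply pow_le; lra.
Qed.

Lemma exp_type_le_exp (x : R) : 0 <= x -> Rabs (PSeries c x) <= M * exp (b * x).
Proof.
  intro Hx. unfold PSeries.
  assert (Hs : ex_series (fun k => M * ((b * Rabs x) ^ k / INR (fact k)))).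
  { apply ex_series_scal_R, ex_series_exp. }
  eapply Rle_trans. apply (Series_dom _ _ (fun k => exp_type_term x k) Hs).
  rewrite Series_scal_l. rewrite (is_series_unique _ _ (is_series_exp _)).
  rewrite Rabs_right by lra. lra.
Qed.
End ExpType.

(** * The Bessel functions of order 0 and 1 *)

Definition bcoef (n m : nat) : R := (-1) ^ m / (INR (fact m) * INR (fact (m + n))).

Lemma bcoef_exp_type n : exp_type 1 1 (bcoef n).
Proof.
  intro k. unfold bcoef. rewrite pow1, !Rmult_1_l.
  unfold Rdiv. rewrite Rabs_mult, pow_1_abs, Rmult_1_l, Rabs_inv.
  assert (H1 := fact_pos k). assert (H2 := fact_pos (k + n)).
  rewrite Rabs_right. 2: apply Rle_ge; nra. rewrite ?Rmult_1_l. apply Rinv_le_contravar; auto.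
  assert (1 <= INR (fact (k+n))). { change 1 with (INR 1). apply le_INR. apply lt_O_fact. } nra.
Qed.

Lemma bcoef_CV n : CV_radius (bcoef n) = p_infty.
Proof. eapply exp_type_CV. 2: apply bcoef_exp_type. lra. Qed.

Lemma bessel_J_PSeries n x : bessel_J n x = (x / 2) ^ n * PSeries (bcoef n) ((x / 2) ^ 2).
Proof.
  unfold bessel_J, PSeries. rewrite <- Series_scal_l. apply Series_ext. intro m.
  unfold bcoef. rewrite pow_add, pow_mult. ring.
Qed.

Lemma is_derive_bser0 t : is_derive (PSeries (bcoef 0)) t (- PSeries (bcoef 1) t).
Proof.
  evar_last. apply is_derive_PSeries. now rewrite bcoef_CV.
  rewrite <- PSeries_opp. apply PSeries_ext. intro m. unfold PS_derive, PS_opp, bcoef.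
  rewrite Nat.add_0_r, Nat.add_1_r. rewrite fact_simpl, mult_INR.
  change opp with Ropp. simpl pow. field.
  split; try apply INR_fact_neq_0. apply not_0_INR; lia.
Qed.

Lemma is_derive_bser1 t : is_derive (fun t => t * PSeries (bcoef 1) t) t (PSeries (bcoef 0) t).
Proof.
  apply (is_derive_ext (PSeries (PS_incr_1 (bcoef 1)))).
  { intro s. now rewrite PSeries_incr_1. }
  evar_last. apply is_derive_PSeries. now rewrite CV_radius_incr_1, bcoef_CV.
  apply PSeries_ext. intro m. unfold PS_derive, PS_incr_1, bcoef.
  rewrite Nat.add_0_r, Nat.add_1_r, fact_simpl, mult_INR. field.
  split; try apply INR_fact_neq_0. apply not_0_INR; lia.
Qed.

Notation J0 := (bessel_J 0).
Notation J1 := (bessel_J 1).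

Lemma is_derive_half_sq x : is_derive (fun x => (x / 2) ^ 2) x (x / 2).
Proof. auto_derive. auto. field. Qed.

Lemma is_derive_J0 x : is_derive J0 x (- J1 x).
Proof.
  apply (is_derive_ext (fun x => PSeries (bcoef 0) ((x / 2) ^ 2))).
  { intro y. rewrite bessel_J_PSeries. simpl; eqR; ring. }
  evar_last.
  apply (is_derive_comp (PSeries (bcoef 0)) (fun x => (x / 2) ^ 2)).
  apply is_derive_bser0. apply is_derive_half_sq.
  rewrite bessel_J_PSeries. unfold scal; simpl; unfold mult; simpl.  field.
Qed.

Lemma is_derive_xJ1 x : is_derive (fun x => x * J1 x) x (x * J0 x).
Proof.
  apply (is_derive_ext (fun x => 2 * ((x / 2) ^ 2 * PSeries (bcoef 1) ((x / 2) ^ 2)))).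
  { intro y. rewrite bessel_J_PSeries. eqR. field. }
  evar_last. apply is_derive_scal.
  apply (is_derive_comp (fun t => t * PSeries (bcoef 1) t) (fun x => (x / 2) ^ 2)).
  apply is_derive_bser1. apply is_derive_half_sq.
  rewrite bessel_J_PSeries. unfold scal; simpl; unfold mult; simpl. eqR. field.
Qed.

Lemma ex_derive_J1 x : ex_derive J1 x.
Proof.
  apply (ex_derive_ext (fun x => (x / 2) * PSeries (bcoef 1) ((x / 2) ^ 2))).
  { intro y. rewrite bessel_J_PSeries. simpl; eqR; field. }
  apply (ex_derive_mult (fun x => x / 2)). auto_derive; auto.
  apply (ex_derive_comp (PSeries (bcoef 1)) (fun x => (x / 2) ^ 2)).
  apply ex_derive_PSeries. now rewrite bcoef_CV. auto_derive; auto.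
Qed.

Lemma is_derive_J1 x : x <> 0 -> is_derive J1 x (J0 x - J1 x / x).
Proof.
  intro Hx. destruct (ex_derive_J1 x) as [d Hd].
  assert (H : J1 x + x * d = x * J0 x).
  { assert (H1 := is_derive_xJ1 x). apply is_derive_unique in H1. rewrite <- H1.
    symmetry. apply is_derive_unique. evar_last. apply (is_derive_mult (fun x => x) J1).
    apply is_derive_id. exact Hd. intros; apply Rmult_comm.
    unfold plus, mult, one; simpl. ring. }
  replace (J0 x - J1 x / x) with d; auto.
  apply (Rmult_eq_reg_l x); auto. field_simplify; auto. lra.
Qed.

Lemma J0_0 : J0 0 = 1.
Proof. rewrite bessel_J_PSeries. replace ((0/2)^2) with 0 by field. rewrite PSeries_0. unfold bcoef; simpl. field. Qed.

Lemma J1_0 : J1 0 = 0.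
Proof. rewrite bessel_J_PSeries. simpl. field. Qed.

Lemma continuous_J0 x : continuous J0 x.
Proof. apply ex_derive_cont. eexists; apply is_derive_J0. Qed.

Lemma continuous_J1 x : continuous J1 x.
Proof. apply ex_derive_cont. apply ex_derive_J1. Qed.

Lemma nonincr_of_derive (f df : R -> R) (a b : R) : a <= b ->
  (forall x, a <= x <= b -> continuous f x) ->
  (forall x, a < x < b -> is_derive f x (df x)) ->
  (forall x, a < x < b -> df x <= 0) -> f b <= f a.
Proof.
  intros Hab Hc Hd Hn. destruct (Req_dec a b) as [->|Hne]. lra.
  destruct (MVT_gen f a b (fun x => Rmin (df x) 0)) as [c [Hc1 Hc2]].
  - intros x. rewrite Rmin_left, Rmax_right by lra. intro Hx.
    rewrite Rmin_left; auto.
  - intros x. rewrite Rmin_left, Rmax_right by lra. intro Hx.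
    apply continuity_pt_filterlim, Hc; auto.
  - assert (Rmin (df c) 0 <= 0) by apply Rmin_r. nra.
Qed.

Definition energy (x : R) := J0 x ^ 2 + J1 x ^ 2.

Lemma is_derive_energy x : x <> 0 -> is_derive energy x (- 2 * J1 x ^ 2 / x).
Proof.
  intro Hx. unfold energy. evar_last.
  apply @is_derive_plus; apply is_derive_pow; [apply is_derive_J0 | now apply is_derive_J1].
  unfold plus; simpl. field. auto.
Qed.

Lemma continuous_energy x : continuous energy x.
Proof.
  unfold energy. apply (continuous_plus (fun x => J0 x ^ 2) (fun x => J1 x ^ 2)).
  apply (continuous_comp J0 (fun y => y ^ 2)). apply continuous_J0.
  apply ex_derive_cont. auto_derive; auto.
  apply (continuous_comp J1 (fun y => y ^ 2)). apply continuous_J1.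
  apply ex_derive_cont. auto_derive; auto.
Qed.

(** Along the Bessel system the energy has derivative [- 2 J1 ^ 2 / x]. *)
Lemma energy_le_1 x : 0 <= x -> energy x <= 1.
Proof.
  intro Hx. replace 1 with (energy 0). 2: { unfold energy. rewrite J0_0, J1_0. ring. }
  apply (nonincr_of_derive energy (fun x => - 2 * J1 x ^ 2 / x)); auto.
  - intros; apply continuous_energy.
  - intros y Hy. apply is_derive_energy. lra.
  - intros y Hy. assert (0 <= J1 y ^ 2 / y).
    { apply Rmult_le_pos. apply pow2_ge_0. apply inv_ge0; lra. }
    unfold Rdiv in *. nra.
Qed.

Lemma J0_le_1 x : 0 <= x -> Rabs (J0 x) <= 1.
Proof. intro Hx. apply Rabs_le. generalize (energy_le_1 x Hx). unfold energy. intro. nra. Qed.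

Lemma J1_le_1 x : 0 <= x -> Rabs (J1 x) <= 1.
Proof. intro Hx. apply Rabs_le. generalize (energy_le_1 x Hx). unfold energy. intro. nra. Qed.

(** The function [x (J0 ^ 2 + J1 ^ 2) - J0 J1] has the small derivative
    [J0 J1 / x], at most [1 / x ^ 2] times itself when [1 <= x]; multiplying it
    by [exp (1 / x)] therefore makes it decrease. *)
Lemma energy_decay x : 1 <= x -> x * energy x <= 2 * (energy 1 - J0 1 * J1 1) * exp 1.
Proof.
  intro Hx. set (F := fun x => x * energy x - J0 x * J1 x).
  assert (HdF : forall y, y <> 0 -> is_derive F y (J0 y * J1 y / y)).
  { intros y Hy. unfold F. evar_last. apply @is_derive_minus.
    apply (is_derive_mult (fun x => x) energy). apply is_derive_id. apply is_derive_energy; auto.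
    intros; apply Rmult_comm.
    apply (is_derive_mult J0 J1). apply is_derive_J0. apply is_derive_J1; auto.
    intros; apply Rmult_comm. unfold minus, plus, opp, mult, one; simpl. unfold energy. field; auto. }
  assert (HF : forall y, 1 <= y -> Rabs (J0 y * J1 y) <= energy y / 2 /\ y * energy y <= 2 * F y).
  { intros y Hy. assert (Rabs (J0 y * J1 y) <= energy y / 2).
    { apply Rabs_le. unfold energy. generalize (pow2_ge_0 (J0 y + J1 y)) (pow2_ge_0 (J0 y - J1 y)). split; nra. }
    split; auto. apply Rabs_le_between in H. unfold F.
    assert (0 <= energy y). { unfold energy. generalize (pow2_ge_0 (J0 y)) (pow2_ge_0 (J1 y)); lra. }
    nra. }
  assert (HE : F x * exp (/ x) <= F 1 * exp (/ 1)).
  { apply (nonincr_of_derive (fun x => F x * exp (/ x))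
      (fun y => J0 y * J1 y / y * exp (/ y) + F y * (- / y ^ 2 * exp (/ y)))); auto.
    - intros y Hy. apply (continuous_mult F (fun y => exp (/ y))).
      apply ex_derive_cont. eexists; apply HdF; lra.
      apply ex_derive_cont. auto_derive. lra.
    - intros y Hy. evar_last. apply (is_derive_mult F (fun y => exp (/ y))).
      apply HdF; lra. instantiate (1 := - / y ^ 2 * exp (/ y)). auto_derive. lra. field. lra. intros; apply Rmult_comm.
      unfold plus, mult; simpl. field. lra.
    - intros y Hy. destruct (HF y) as [H1 H2]. lra.
      assert (Hexp := exp_pos (/ y)).
      replace (_ + _) with (exp (/ y) / y ^ 2 * (y * (J0 y * J1 y) - F y)) by (field; lra).
      apply Rabs_le_between in H1.
      assert (0 < exp (/ y) / y ^ 2) by (apply Rdiv_lt_0_compat; [auto|apply pow_lt; lra]).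
      assert (y * (J0 y * J1 y) - F y <= 0) by nra. nra. }
  rewrite Rinv_1 in HE.
  assert (1 <= exp (/ x)).
  { rewrite <- exp_0. left. apply exp_increasing. apply Rinv_0_lt_compat; lra. }
  destruct (HF x Hx) as [_ H2].
  assert (0 <= energy x). { unfold energy. generalize (pow2_ge_0 (J0 x)) (pow2_ge_0 (J1 x)); lra. }
  replace (energy 1 - J0 1 * J1 1) with (F 1) by (unfold F; ring).
  assert (0 <= F x) by nra. assert (F x <= F x * exp (/ x)) by nra. lra.
Qed.

Lemma sqrt_J1_bounded : exists C, 0 <= C /\ forall x, 0 <= x -> sqrt x * Rabs (J1 x) <= C.
Proof.
  set (A := 2 * (energy 1 - J0 1 * J1 1) * exp 1).
  exists (1 + Rabs A). split. generalize (Rabs_pos A); lra. intros x Hx.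
  assert (HJ := J1_le_1 x Hx). assert (HJp := Rabs_pos (J1 x)).
  destruct (Rle_lt_dec x 1) as [H1|H1].
  - assert (sqrt x <= 1). { rewrite <- sqrt_1. now apply sqrt_le_1_alt. }
    generalize (sqrt_pos x) (Rabs_pos A); nra.
  - assert (H := energy_decay x (Rlt_le _ _ H1)). fold A in H.
    assert (Hs : (sqrt x * Rabs (J1 x)) ^ 2 <= A).
    { rewrite Rpow_mult_distr, pow2_sqrt, pow2_abs by lra. unfold energy in H.
      generalize (pow2_ge_0 (J0 x)); nra. }
    assert (0 <= sqrt x * Rabs (J1 x)) by (generalize (sqrt_pos x); nra).
    generalize (Rle_abs A). nra.
Qed.

(** * Laplace moments *)

(** Only the values on the half-line matter for the integrals below; continuity is
    required everywhere so that all integrals over segments exist. *)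
Definition exp_growth (A s : R) (g : R -> R) : Prop :=
  (forall x, continuous g x) /\ (forall x, 0 <= x -> Rabs (g x) <= A * exp (s * x)).

Lemma exp_growth_A_ge0 A s g : exp_growth A s g -> 0 <= A.
Proof.
  intros [_ H]. specialize (H 0 (Rle_refl _)). rewrite Rmult_0_r, exp_0 in H.
  generalize (Rabs_pos (g 0)); lra.
Qed.

Lemma exp_growth_ext A s f g : (forall x, f x = g x) -> exp_growth A s f -> exp_growth A s g.
Proof.
  intros H [H1 H2]. split.
  - intro x. apply (continuous_ext f); auto.
  - intros x Hx. rewrite <- H; auto.
Qed.

Lemma exp_growth_weaken A s A' s' g : A <= A' -> s <= s' -> exp_growth A s g -> exp_growth A' s' g.
Proof.
  intros HA Hs H. split. apply H. intros x Hx. eapply Rle_trans. now apply H.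
  assert (0 <= A) by (eapply exp_growth_A_ge0; eauto).
  apply Rmult_le_compat; auto. left; apply exp_pos.
  destruct (Req_dec (s * x) (s' * x)) as [->|Hn]. lra. left. apply exp_increasing. nra.
Qed.

Lemma exp_growth_lin A s A' f g al be : exp_growth A s f -> exp_growth A' s g ->
  exp_growth (Rabs al * A + Rabs be * A') s (fun x => al * f x + be * g x).
Proof.
  intros [H1 H2] [H3 H4]. split.
  - intro x. apply (continuous_plus (fun x => al * f x) (fun x => be * g x)).
    now apply (continuous_scal_r al f). now apply (continuous_scal_r be g).
  - intros x Hx. eapply Rle_trans. apply Rabs_triang. rewrite !Rabs_mult, Rmult_plus_distr_r, !Rmult_assoc.
    apply Rplus_le_compat; apply Rmult_le_compat_l; auto using Rabs_pos.
Qed.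

Lemma exp_growth_mult A s A' s' f g : exp_growth A s f -> exp_growth A' s' g ->
  exp_growth (A * A') (s + s') (fun x => f x * g x).
Proof.
  intros [H1 H2] [H3 H4]. split.
  - intro x. now apply (continuous_mult f g).
  - intros x Hx. rewrite Rabs_mult, Rmult_plus_distr_r, exp_plus.
    replace (A * A' * (exp (s * x) * exp (s' * x))) with (A * exp (s * x) * (A' * exp (s' * x))) by ring.
    apply Rmult_le_compat; auto using Rabs_pos.
Qed.

Lemma exp_growth_exp s : exp_growth 1 s (fun x => exp (s * x)).
Proof.
  split. intro x. apply ex_derive_cont. auto_derive; auto.
  intros x _. rewrite Rabs_right. lra. left; apply exp_pos.
Qed.

Lemma exp_growth_pow eta j : 0 < eta -> exp_growth (INR (fact j) / eta ^ j) eta (fun x => x ^ j).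
Proof.
  intro He. split. intro x. apply ex_derive_cont. auto_derive; auto.
  intros x Hx. rewrite Rabs_right. 2: { apply Rle_ge, pow_le; auto. }
  assert (H := pow_fact_le_exp (eta * x) j). rewrite Rpow_mult_distr in H.
  assert (Hf := fact_pos j). assert (Hp : 0 < eta ^ j) by now apply pow_lt.
  assert (Hx' : 0 <= eta * x) by nra. specialize (H Hx').
  replace (x ^ j) with (INR (fact j) / eta ^ j * (eta ^ j * x ^ j / INR (fact j))) by (field; lra).
  apply Rmult_le_compat_l; auto. left. now apply Rdiv_lt_0_compat.
Qed.

Lemma ex_RInt_cont (g : R -> R) a b : (forall x, continuous g x) -> ex_RInt g a b.
Proof. intro H. apply (@ex_RInt_continuous R_CompleteNormedModule). auto. Qed.

Lemma is_RInt_cont (g : R -> R) a b : (forall x, continuous g x) -> is_RInt g a b (RInt g a b).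
Proof. intro H. apply (@RInt_correct R_CompleteNormedModule). now apply ex_RInt_cont. Qed.

Lemma RInt_split (g : R -> R) (a b c : R) : (forall x, continuous g x) ->
  RInt g a c = RInt g a b + RInt g b c.
Proof. intro H. symmetry. apply (@RInt_Chasles R_CompleteNormedModule); now apply ex_RInt_cont. Qed.

Lemma RInt_exp_bound (g : R -> R) K s a b : s <> 0 -> a <= b -> (forall x, continuous g x) ->
  (forall x, a <= x <= b -> Rabs (g x) <= K * exp (- s * x)) ->
  Rabs (RInt g a b) <= K / s * (exp (- s * a) - exp (- s * b)).
Proof.
  intros Hs Hab Hc Hb.
  apply (@norm_RInt_le R_NormedModule g (fun x => K * exp (- s * x)) a b); auto.
  now apply is_RInt_cont.
  replace (K / s * (exp (- s * a) - exp (- s * b))) with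
    (minus ((fun x => - K / s * exp (- s * x)) b) ((fun x => - K / s * exp (- s * x)) a)).
  2: { unfold minus, plus, opp; simpl. field. auto. }
  apply (@is_RInt_derive R_CompleteNormedModule (fun x => - K / s * exp (- s * x))).
  - intros x _. auto_derive; auto. field. auto.
  - intros x _. apply ex_derive_cont. auto_derive; auto.
Qed.

Definition LI (g : R -> R) : R := real (Lim (fun X => RInt g 0 X) p_infty).

Lemma is_lim_LI A s g : 0 < s -> exp_growth A (- s) g -> is_lim (fun X => RInt g 0 X) p_infty (LI g).
Proof.
  intros Hs Hg. assert (HA := exp_growth_A_ge0 _ _ _ Hg). destruct Hg as [Hc Hb].
  assert (Hd : forall u v, 0 <= u <= v -> Rabs (RInt g 0 v - RInt g 0 u) <= A / s * exp (- s * u)).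
  { intros u v Huv.
    assert (E := RInt_split g 0 u v Hc). replace (RInt g 0 v - RInt g 0 u) with (RInt g u v) by lra.
    eapply Rle_trans. apply (RInt_exp_bound g A s u v); try lra; auto.
    intros x Hx. apply Hb; lra.
    apply Rmult_le_compat_l. apply Rmult_le_pos; auto. now apply inv_ge0.
    generalize (exp_pos (- s * v)); lra. }
  assert (Hex : exists l : R, filterlim (fun X => RInt g 0 X) (Rbar_locally p_infty) (locally l)).
  { apply (proj1 (@filterlim_locally_cauchy R R_CompleteSpace (Rbar_locally p_infty) _ (fun X => RInt g 0 X))).
    intro eps.
    (* beyond u0, every tail of the integral is below eps *)
    set (u0 := A / s / s / eps).
    assert (Hu0 : 0 <= u0).
    { unfold u0. apply Rmult_le_pos. apply Rmult_le_pos. apply Rmult_le_pos; auto.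
      now apply inv_ge0. now apply inv_ge0.
      apply inv_ge0, cond_pos. }
    assert (Hu : forall u, u0 < u -> A / s * exp (- s * u) < eps).
    { intros u Hu. assert (Heps := cond_pos eps).
      assert (H1 : s * u < exp (s * u)). { generalize (exp_ineq1 (s * u)). intro H. assert (0 < s * u) by nra. lra. }
      replace (- s * u) with (- (s * u)) by ring. rewrite exp_Ropp.
      apply Rmult_lt_reg_r with (exp (s * u)). apply exp_pos.
      rewrite Rmult_assoc, Rinv_l, Rmult_1_r by (generalize (exp_pos (s * u)); lra).
      assert (A / s < eps * (s * u)).
      { apply Rmult_lt_reg_r with (/ s / eps). apply Rdiv_lt_0_compat; auto. now apply Rinv_0_lt_compat.
        replace (eps * (s * u) * (/ s / eps)) with u by (field; lra).
        replace (A / s * (/ s / eps)) with u0. auto. unfold u0. field. lra. }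
      nra. }
    exists (fun u => u0 < u). split. exists u0; auto.
    intros u v H1 H2. change (Rabs (RInt g 0 v - RInt g 0 u) < eps).
    destruct (Rle_dec u v).
    - eapply Rle_lt_trans. apply Hd; lra. auto.
    - rewrite Rabs_minus_sym. eapply Rle_lt_trans. apply Hd; lra. auto. }
  destruct Hex as [l Hl]. assert (Hl' : is_lim (fun X => RInt g 0 X) p_infty l) by exact Hl.
  unfold LI. rewrite (is_lim_unique _ _ _ Hl'). exact Hl'.
Qed.

Lemma LI_unique g (l : R) : is_lim (fun X => RInt g 0 X) p_infty l -> LI g = l.
Proof. intro H. unfold LI. now rewrite (is_lim_unique _ _ _ H). Qed.

Lemma LI_ext f g : (forall x, 0 <= x -> f x = g x) -> LI f = LI g.
Proof.
  intro H. unfold LI. f_equal. apply Lim_ext_loc. exists 0. intros X HX.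
  apply RInt_ext. intros x Hx. rewrite Rmin_left in Hx by lra. symmetry; apply H; lra.
Qed.

Lemma LI_lin A A' s f g al be : 0 < s -> exp_growth A (- s) f -> exp_growth A' (- s) g ->
  LI (fun x => al * f x + be * g x) = al * LI f + be * LI g.
Proof.
  intros Hs Hf Hg. apply LI_unique.
  apply (is_lim_ext (fun X => al * RInt f 0 X + be * RInt g 0 X)).
  { intro X. symmetry. apply is_RInt_unique.
    apply (@is_RInt_plus R_NormedModule (fun x => al * f x) (fun x => be * g x)).
    apply (@is_RInt_scal R_NormedModule f). apply is_RInt_cont, Hf.
    apply (@is_RInt_scal R_NormedModule g). apply is_RInt_cont, Hg. }
  apply (is_lim_plus' (fun X => al * RInt f 0 X) (fun X => be * RInt g 0 X)).
  apply (is_lim_scal_l _ al _ (LI f)). eapply is_lim_LI; eauto.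
  apply (is_lim_scal_l _ be _ (LI g)). eapply is_lim_LI; eauto.
Qed.

Lemma LI_tail (g : R -> R) A s K T : 0 < s -> 0 <= T -> 0 <= K -> exp_growth A (- s) g ->
  (forall x, T <= x -> Rabs (g x) <= K * exp (- s * x)) ->
  Rabs (LI g - RInt g 0 T) <= K / s * exp (- s * T).
Proof.
  intros Hs HT HK Hg Hb. assert (H := is_lim_LI _ _ _ Hs Hg). destruct Hg as [Hc _].
  assert (H1 : is_lim (fun X => Rabs (RInt g 0 X - RInt g 0 T)) p_infty (Rabs (LI g - RInt g 0 T))).
  { apply (filterlim_comp R R R (fun X => RInt g 0 X - RInt g 0 T) Rabs _ (locally (LI g - RInt g 0 T))).
    2: apply (continuous_Rabs (LI g - RInt g 0 T)).
    apply (is_lim_minus' (fun X => RInt g 0 X) (fun _ => RInt g 0 T)); auto. apply is_lim_const. }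
  apply (is_lim_le_loc (fun X => Rabs (RInt g 0 X - RInt g 0 T)) (fun _ => K / s * exp (- s * T))
     p_infty (Rabs (LI g - RInt g 0 T)) (K / s * exp (- s * T))); auto.
  - exists T. intros X HX. assert (E := RInt_split g 0 T X Hc). replace (RInt g 0 X - RInt g 0 T) with (RInt g T X) by lra.
    eapply Rle_trans. apply (RInt_exp_bound g K s T X); try lra; auto.
    intros x Hx. apply Hb; lra.
    apply Rmult_le_compat_l. apply Rmult_le_pos; auto. now apply inv_ge0.
    generalize (exp_pos (- s * X)); lra.
  - apply is_lim_const.
Qed.

Lemma LI_bound g A s : 0 < s -> exp_growth A (- s) g -> Rabs (LI g) <= A / s.
Proof.
  intros Hs Hg. assert (HA := exp_growth_A_ge0 _ _ _ Hg).
  assert (H := LI_tail g A s A 0 Hs (Rle_refl _) HA Hg (proj2 Hg)).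
  rewrite RInt_point in H. unfold zero in H; simpl in H. rewrite Rminus_0_r, Rmult_0_r, exp_0 in H. lra.
Qed.

Lemma LI_derive F g A B s : 0 < s -> exp_growth A (- s) g -> exp_growth B (- s) F ->
  (forall x, is_derive F x (g x)) -> LI g = - F 0.
Proof.
  intros Hs Hg HF Hd. apply LI_unique.
  apply (is_lim_ext (fun X => F X - F 0)).
  { intro X. symmetry. apply is_RInt_unique. apply (@is_RInt_derive R_CompleteNormedModule F g).
    intros; apply Hd. intros; apply Hg. }
  replace (Finite (- F 0)) with (Finite (0 - F 0)) by (f_equal; ring).
  apply (is_lim_minus' F (fun _ => F 0)). 2: apply is_lim_const.
  assert (Hlim : is_lim (fun x => B * exp (- s * x)) p_infty 0).
  { replace (Finite 0) with (Rbar_mult B 0) by (simpl; now rewrite Rmult_0_r).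
    apply is_lim_scal_l. apply (is_lim_comp exp (fun x => - s * x) p_infty 0 m_infty).
    apply is_lim_exp_m.
    replace m_infty with (Rbar_mult (- s) p_infty).
    apply is_lim_scal_l, is_lim_id. rewrite Rbar_mult_comm. apply is_Rbar_mult_unique, is_Rbar_mult_p_infty_neg; simpl; lra.
    exists 0. intros; discriminate. }
  apply (is_lim_le_le_loc (fun x => - (B * exp (- s * x))) (fun x => B * exp (- s * x))).
  - exists 0. intros x Hx. apply Rabs_le_between. apply HF. lra.
  - replace (Finite 0) with (Rbar_opp 0) by (simpl; now rewrite Ropp_0). now apply is_lim_opp.
  - exact Hlim.
Qed.

Definition moment (j : nat) (w : R -> R) (e : R) : R := LI (fun x => x ^ j * w x * exp (- e * x)).

Lemma moment_exp_growth j w A s e : s < e -> exp_growth A s w ->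
  exp_growth (A * (INR (fact j) / ((e - s) / 2) ^ j)) (- ((e - s) / 2)) (fun x => x ^ j * w x * exp (- e * x)).
Proof.
  intros Hs Hw. eapply exp_growth_weaken. 3: apply exp_growth_mult; [apply exp_growth_mult; [apply (exp_growth_pow ((e - s) / 2) j); lra | exact Hw] | apply exp_growth_exp].
  right. ring. lra.
Qed.

Lemma moment_bound j w A s e : s < e -> exp_growth A s w ->
  Rabs (moment j w e) <= A * (INR (fact j) / ((e - s) / 2) ^ j) / ((e - s) / 2).
Proof. intros Hs Hw. apply LI_bound. lra. now apply moment_exp_growth. Qed.

Lemma moment_congr j f g e : (forall x, 0 <= x -> f x = g x) -> moment j f e = moment j g e.
Proof. intro H. apply LI_ext. intros x Hx. now rewrite H. Qed.

Lemma half_gap s e : s < e -> 0 < (e - s) / 2.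
Proof. lra. Qed.

Lemma moment_lin j f g A A' s e al be : s < e -> exp_growth A s f -> exp_growth A' s g ->
  moment j (fun x => al * f x + be * g x) e = al * moment j f e + be * moment j g e.
Proof.
  intros Hs Hf Hg. unfold moment.
  rewrite <- (LI_lin _ _ _ _ _ al be (half_gap _ _ Hs) (moment_exp_growth j _ _ _ _ Hs Hf) (moment_exp_growth j _ _ _ _ Hs Hg)).
  apply LI_ext. intros; ring.
Qed.

(** * Geometrically dominated series *)

Lemma is_lim_seq_0_small (u : nat -> R) (eta : R) : is_lim_seq u 0 -> 0 < eta ->
  exists N, forall n, (N <= n)%nat -> Rabs (u n) < eta.
Proof.
  intros H He. apply is_lim_seq_spec in H. destruct (H (mkposreal _ He)) as [N HN].
  exists N. intros n Hn. specialize (HN n Hn). simpl in HN. now rewrite Rminus_0_r in HN.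
Qed.

Lemma is_series_geom_err (a : nat -> R) (l C q : R) : 0 <= q < 1 ->
  (forall n, Rabs (l - sum_n a n) <= C * q ^ n) -> is_series a l.
Proof.
  intros Hq H. change (is_lim_seq (sum_n a) l).
  apply (is_lim_seq_le_le (fun n => l - C * q ^ n) _ (fun n => l + C * q ^ n)).
  - intro n. specialize (H n). apply Rabs_le_between in H. lra.
  - replace (Finite l) with (Finite (l - C * 0)) by (f_equal; ring).
    apply (is_lim_seq_minus' (fun _ => l)). apply is_lim_seq_const.
    apply (is_lim_seq_scal_l _ C 0). apply is_lim_seq_geom. rewrite Rabs_right; lra.
  - replace (Finite l) with (Finite (l + C * 0)) by (f_equal; ring).
    apply (is_lim_seq_plus' (fun _ => l)). apply is_lim_seq_const.
    apply (is_lim_seq_scal_l _ C 0). apply is_lim_seq_geom. rewrite Rabs_right; lra.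
Qed.

Lemma is_series_geom_le (a : nat -> R) (l C q : R) : 0 <= q < 1 ->
  (forall n, Rabs (a n) <= C * q ^ n) -> is_series a l -> Rabs l <= C / (1 - q).
Proof.
  intros Hq H Ha. rewrite <- (is_series_unique _ _ Ha).
  assert (Hg : is_series (fun n => C * q ^ n) (C / (1 - q))).
  { apply (is_series_scal_l C (fun n => q ^ n) (/ (1 - q))). apply is_series_geom. rewrite Rabs_right; lra. }
  rewrite <- (is_series_unique _ _ Hg). apply Series_dom; auto. eexists; eauto.
Qed.

Lemma ex_series_geom_dom (a : nat -> R) (C q : R) : 0 <= q < 1 ->
  (forall n, Rabs (a n) <= C * q ^ n) -> ex_series a.
Proof.
  intros Hq H. apply ex_series_Rabs. apply (ex_series_dom _ (fun n => C * q ^ n)); auto.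
  apply ex_series_scal_R. apply ex_series_geom. rewrite Rabs_right; lra.
Qed.

Lemma is_series_geom_tail (a : nat -> R) (l C q : R) n : 0 <= q < 1 ->
  (forall n, Rabs (a n) <= C * q ^ n) -> is_series a l ->
  Rabs (l - sum_n a n) <= C * q ^ S n / (1 - q).
Proof.
  intros Hq H Ha.
  assert (Ht : is_series (fun k => a (S n + k)%nat) (l - sum_n a n)).
  { apply (is_series_incr_n a (S n)). lia. simpl Init.Nat.pred.
change (is_series a (Rplus (l - sum_n a n) (sum_n a n))).
    replace (Rplus (l - sum_n a n) (sum_n a n)) with l by ring. exact Ha. }
  apply (is_series_geom_le _ _ (C * q ^ S n) q Hq) in Ht; auto.
  intro k. rewrite Rmult_assoc, <- pow_add. apply H.
Qed.

Lemma is_series_sum_n (a : nat -> nat -> R) (r : nat -> R) n :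
  (forall k, is_series (a k) (r k)) -> is_series (fun i => sum_n (fun k => a k i) n) (sum_n r n).
Proof.
  intro H. induction n as [|n IH].
  - rewrite sum_O. apply (is_series_ext (a 0%nat)); auto. intro i. now rewrite sum_O.
  - rewrite sum_Sn. apply (is_series_ext (fun i => plus (sum_n (fun k => a k i) n) (a (S n) i))).
    intro i. now rewrite sum_Sn. now apply (is_series_plus (fun i => sum_n (fun k => a k i) n) (a (S n))).
Qed.

(** The difference between the sum of [s] and a partial sum of [r] is the sum
    over [i] of the tails of the columns, each geometrically small. *)
Lemma double_series_swap (a : nat -> nat -> R) (r s : nat -> R) (sigma A x y : R) :
  0 <= x < 1 -> 0 <= y < 1 -> (forall k i, Rabs (a k i) <= A * x ^ k * y ^ i) ->
  (forall k, is_series (a k) (r k)) -> (forall i, is_series (fun k => a k i) (s i)) ->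
  is_series s sigma -> is_series r sigma.
Proof.
  intros Hx Hy Ha Hr Hs Hsig.
  apply (is_series_geom_err _ _ (A * x / (1 - x) / (1 - y)) x Hx). intro n.
  assert (H := is_series_minus s (fun i => sum_n (fun k => a k i) n) _ _ Hsig (is_series_sum_n a r n Hr)).
  apply (is_series_geom_le _ _ (A * x ^ S n / (1 - x)) y Hy) in H.
  - replace (A * x / (1 - x) / (1 - y) * x ^ n) with (A * x ^ S n / (1 - x) / (1 - y)).
    exact H. simpl. field. lra.
  - intro i. replace (A * x ^ S n / (1 - x) * y ^ i) with (A * y ^ i * x ^ S n / (1 - x)) by (field; lra).
    apply (is_series_geom_tail (fun k => a k i)); auto.
    intro k. eapply Rle_trans. apply Ha. right; ring.
Qed.

(** The left-hand side is one term of the binomial expansion of the right-hand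
    side. *)
Lemma binomial_term_le (x y : R) (n m : nat) : 0 <= x -> 0 <= y ->
  INR (fact (n + m)) / (INR (fact n) * INR (fact m)) * (x ^ n * y ^ m) <= (x + y) ^ (n + m).
Proof.
  intros Hx Hy. remember (n + m)%nat as N eqn:HN. revert n m HN.
  induction N as [|N IH]; intros n m HN.
  - assert (n = 0%nat) by lia. assert (m = 0%nat) by lia. subst. simpl. lra.
  - destruct n as [|n].
    { simpl in HN. subst m. simpl (fact 0). simpl (x ^ 0). rewrite INR_1, !Rmult_1_l.
      replace (_ / _) with 1 by (field; apply INR_fact_neq_0). rewrite Rmult_1_l. apply pow_incr; lra. }
    destruct m as [|m].
    { rewrite Nat.add_0_r in HN. rewrite HN. simpl (fact 0). simpl (y ^ 0). rewrite INR_1, !Rmult_1_r.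
      replace (_ / _) with 1 by (field; apply INR_fact_neq_0). rewrite Rmult_1_l. apply pow_incr; lra. }
    assert (H1 := IH n (S m) ltac:(lia)). assert (H2 := IH (S n) m ltac:(lia)).
    apply (Rmult_le_compat_l x) in H1; auto. apply (Rmult_le_compat_l y) in H2; auto.
    replace ((x + y) ^ S N) with (x * (x + y) ^ N + y * (x + y) ^ N) by (simpl; ring).
    eapply Rle_trans. 2: apply Rplus_le_compat; [exact H1 | exact H2].
    right. assert (HN' : INR N = INR n + INR m + 1).
    { replace N with (n + m + 1)%nat by lia. rewrite !plus_INR. simpl; ring. }
    rewrite !fact_simpl, !mult_INR, !S_INR, HN'. simpl.
    assert (INR n + 1 <> 0) by (generalize (pos_INR n); lra).
    assert (INR m + 1 <> 0) by (generalize (pos_INR m); lra).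
    field. repeat split; auto using INR_fact_neq_0.
Qed.

Lemma linear_geom_le (x : R) : 0 <= x < 1 ->
  exists K q, 0 <= K /\ 0 <= q < 1 /\ forall n, (INR n + 1) * x ^ n <= K * q ^ n.
Proof.
  intro Hx. set (s := (1 - x) / 2). assert (Hs : 0 < s) by (unfold s; lra).
  assert (Hq : 0 <= x + s < 1) by (unfold s; lra).
  exists ((x + s) / s), (x + s). split. { apply Rmult_le_pos. lra. now apply inv_ge0. }
  split; auto. intro n. assert (H := binomial_term_le x s n 1 ltac:(lra) ltac:(lra)).
  assert (F := fact_pos n).
  rewrite Nat.add_1_r, fact_simpl, mult_INR, S_INR in H. simpl (fact 1) in H. change (INR 1) with 1 in H.
  apply Rmult_le_reg_r with s; auto.
  replace ((x + s) / s * (x + s) ^ n * s) with ((x + s) ^ S n) by (simpl; field; lra).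
  eapply Rle_trans; [|exact H]. right. field. lra.
Qed.

(** * Expansion and continuation of Laplace moments *)

Lemma exp_growth_partial_sum (d : nat -> R) (eta : R) n : 0 < eta ->
  exists A, exp_growth A eta (fun x => sum_n (fun k => d k * x ^ k) n).
Proof.
  intro He. induction n as [|n [A IH]].
  - eexists. eapply exp_growth_ext; [|apply (exp_growth_lin _ eta _ _ _ (d 0%nat) 0 (exp_growth_pow eta 0 He) (exp_growth_pow eta 0 He))].
    intro x. rewrite sum_O. simpl. eqR. ring.
  - eexists. eapply exp_growth_ext; [|apply (exp_growth_lin _ eta _ _ _ 1 (d (S n)) IH (exp_growth_pow eta (S n) He))].
    intro x. rewrite sum_Sn. unfold plus; simpl. eqR. ring.
Qed.

Lemma moment_partial_sum (d : nat -> R) (j : nat) w A s e n : s < e -> exp_growth A s w ->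
  sum_n (fun k => d k * moment (k + j) w e) n = moment j (fun x => sum_n (fun k => d k * x ^ k) n * w x) e.
Proof.
  intros Hs Hw. set (eta := (e - s) / 2). assert (He : 0 < eta) by (unfold eta; lra).
  assert (Hk : forall k, moment (k + j) w e = moment j (fun x => x ^ k * w x) e).
  { intro k. apply LI_ext. intros x _. rewrite pow_add. ring. }
  assert (Hg : forall k, exp_growth (INR (fact k) / eta ^ k * A) (eta + s) (fun x => x ^ k * w x)).
  { intro k. apply exp_growth_mult; auto. now apply exp_growth_pow. }
  assert (Hse : eta + s < e) by (unfold eta; lra).
  induction n as [|n IH].
  - rewrite sum_O, Hk. eqR.
    transitivity (d 0%nat * moment j (fun x => x ^ 0 * w x) e + 0 * moment j (fun x => x ^ 0 * w x) e). ring.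
    rewrite <- (moment_lin j _ _ _ _ _ _ _ _ Hse (Hg 0%nat) (Hg 0%nat)). apply moment_congr.
    intros x _. rewrite sum_O. eqR. ring.
  - rewrite sum_Sn, IH, Hk. unfold plus; simpl AbelianMonoid.plus. eqR.
    destruct (exp_growth_partial_sum d eta n He) as [B HB].
    transitivity (1 * moment j (fun x => sum_n (fun k => d k * x ^ k) n * w x) e
       + d (S n) * moment j (fun x => x ^ S n * w x) e). unfold plus; simpl; eqR; ring.
    rewrite <- (moment_lin j _ _ _ _ _ _ _ _ Hse (exp_growth_mult _ _ _ _ _ _ HB Hw) (Hg (S n))). apply moment_congr.
    intros x _. rewrite sum_Sn. unfold plus; simpl; eqR; ring.
Qed.

Lemma exp_growth_exp_type M b d : 0 <= b -> exp_type M b d -> exp_growth M b (PSeries d).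
Proof.
  intros Hb Hd. split. intro x. eapply exp_type_continuous; eauto.
  intros x Hx. eapply exp_type_le_exp; eauto.
Qed.

(** Integration term by term: [w] times the remainder of the power series is
    still integrable against [exp (- e x)], because [b + s < e], and is smaller by a
    geometric factor ([exp_type_remainder]). *)
Lemma moment_expand M b d (j : nat) w A s e : 0 <= b -> exp_type M b d -> exp_growth A s w -> b + s < e ->
  is_series (fun k => d k * moment (k + j) w e) (moment j (fun x => PSeries d x * w x) e).
Proof.
  intros Hb Hd Hw Hs. set (b' := (b + (e - s)) / 2).
  assert (Hb1 : b < b') by (unfold b'; lra). assert (Hb2 : b' + s < e) by (unfold b'; lra).
  assert (Hq : 0 <= b / b' < 1).
  { split. apply Rmult_le_pos; auto. apply inv_ge0; lra.
    apply Rmult_lt_reg_r with b'. lra. field_simplify; lra. }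
  set (K := INR (fact j) / ((e - (b' + s)) / 2) ^ j / ((e - (b' + s)) / 2)).
  apply (is_series_geom_err _ _ (M * (b / b') * A * K) (b / b') Hq). intro n.
  rewrite (moment_partial_sum d j w A s e n) by (auto; lra).
  set (p := fun x => sum_n (fun k => d k * x ^ k) n).
  destruct (exp_growth_partial_sum d (b' - b) n) as [B HB]. lra.
  assert (HB' : exp_growth B b' p) by (eapply exp_growth_weaken; [| |exact HB]; lra).
  assert (Hu : exp_growth M b' (PSeries d)).
  { eapply exp_growth_weaken; [| |apply exp_growth_exp_type; eauto]; lra. }
  transitivity (Rabs (moment j (fun x => (PSeries d x - p x) * w x) e)).
  { right. f_equal.
    transitivity (1 * moment j (fun x => PSeries d x * w x) e + (-1) * moment j (fun x => p x * w x) e). unfold p; ring.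
    rewrite <- (moment_lin j _ _ _ _ _ _ _ _ Hb2 (exp_growth_mult _ _ _ _ _ _ Hu Hw) (exp_growth_mult _ _ _ _ _ _ HB' Hw)).
    apply moment_congr. intros; ring. }
  assert (Hr : exp_growth (M * (b / b') ^ S n * A) (b' + s) (fun x => (PSeries d x - p x) * w x)).
  { apply exp_growth_mult; auto. split.
    - intro x. apply (continuous_minus (PSeries d) p). apply Hu. apply HB.
    - intros x Hx. now apply exp_type_remainder. }
  eapply Rle_trans. apply (moment_bound j _ _ _ e Hb2 Hr). right. unfold K. simpl. unfold Rdiv; ring.
Qed.

Lemma PSeries_exp_scal (t x : R) : PSeries (fun i => t ^ i / INR (fact i)) x = exp (t * x).
Proof.
  unfold PSeries. rewrite <- (is_series_unique _ _ (is_series_exp (t * x))).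
  apply Series_ext. intro n. rewrite Rpow_mult_distr. unfold Rdiv; ring.
Qed.

Lemma exp_type_exp (t : R) : 0 <= t -> exp_type 1 t (fun i => t ^ i / INR (fact i)).
Proof.
  intros Ht k. rewrite Rabs_right. lra. apply Rle_ge, Rmult_le_pos. now apply pow_le.
  apply inv_ge0, fact_pos.
Qed.

(** Moving the Laplace variable by [- t] is multiplication by [exp (t x)]. *)
Lemma moment_shift (j : nat) w A s e t : exp_growth A s w -> 0 <= t -> t + s < e ->
  is_series (fun i => t ^ i / INR (fact i) * moment (i + j) w e) (moment j w (e - t)).
Proof.
  intros Hw Ht Hs.
  replace (moment j w (e - t)) with (moment j (fun x => PSeries (fun i => t ^ i / INR (fact i)) x * w x) e).
  apply (moment_expand 1 t _ j w A s e); auto. now apply exp_type_exp.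
  apply LI_ext. intros x _. rewrite PSeries_exp_scal.
  replace (- (e - t) * x) with (t * x + - e * x) by ring. rewrite exp_plus. ring.
Qed.

Section Continuation.
Variables (M b B0 rho : R) (c : nat -> R) (K : R -> R).
Hypotheses (Hb : 0 <= b) (Hc : exp_type M b c) (Hu : exp_growth B0 0 (PSeries c)) (HK : exp_growth 1 0 K) (Hrho : b < rho).
Hypothesis Hmom : forall e, 0 < e -> exists C, forall n, Rabs (moment n K e) <= C * INR (fact n) / rho ^ n.

(** All the [j] are needed at once: the moments of all orders at [e] determine
    those at neighbouring points. *)
Definition termwise (e : R) : Prop := forall j,
  is_series (fun k => c k * moment (k + j) K e) (moment j (fun x => PSeries c x * K x) e).

Lemma termwise_large e : b < e -> termwise e.
Proof. intros He j. apply (moment_expand M b c j K 1 0 e); auto. lra. Qed.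

(** Both sides at [e - t] are power series in [t] of moments at [e], and the moment
    bound makes the resulting double series absolutely convergent as long as
    [b + t < rho]. *)
Lemma termwise_step e t : 0 < e -> 0 <= t -> t < e -> b + t < rho -> termwise e -> termwise (e - t).
Proof.
  intros He Ht Hte Hbt HT j. destruct (Hmom e He) as [C HC].
  assert (HC0 : 0 <= C).
  { specialize (HC 0%nat). simpl in HC. generalize (Rabs_pos (moment 0 K e)). lra. }
  assert (HM : 0 <= M) by (eapply exp_type_M_ge0; eauto).
  (* half of the gap pays for the factor (n + j)! / n! *)
  set (sg := (rho - (b + t)) / 2). assert (Hsg : 0 < sg) by (unfold sg; lra).
  set (th := (b + t + sg) / rho).
  assert (Hth : 0 <= th < 1).
  { unfold th. split. apply Rmult_le_pos. lra. apply inv_ge0; lra.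
    apply Rmult_lt_reg_r with rho. lra. field_simplify; unfold sg; lra. }
  assert (HuK : exp_growth (B0 * 1) (0 + 0) (fun x => PSeries c x * K x)) by now apply exp_growth_mult.
  apply (double_series_swap (fun k i => c k * (t ^ i / INR (fact i) * moment (k + i + j) K e))
    (fun k => c k * moment (k + j) K (e - t))
    (fun i => t ^ i / INR (fact i) * moment (i + j) (fun x => PSeries c x * K x) e)
    (moment j (fun x => PSeries c x * K x) (e - t))
    (M * C * (INR (fact j) / sg ^ j) * th ^ j) th th); auto.
  - intros k i.
    assert (Fk := fact_pos k). assert (Fi := fact_pos i). assert (Fj := fact_pos j).
    assert (Fki := fact_pos (k + i)).
    assert (Hr : 0 < rho ^ (k + i + j)) by (apply pow_lt; lra).
    assert (Hsj : 0 < sg ^ j) by now apply pow_lt.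
    assert (Hti : 0 <= t ^ i / INR (fact i)).
    { apply Rmult_le_pos. now apply pow_le. now apply inv_ge0. }
    rewrite Rabs_mult, Rabs_mult, (Rabs_right (_ / _)) by lra.
    apply Rle_trans with (M * b ^ k / INR (fact k) *
       (t ^ i / INR (fact i) * (C * INR (fact (k + i + j)) / rho ^ (k + i + j)))).
    { apply Rmult_le_compat; auto using Rabs_pos. apply Rmult_le_pos; auto using Rabs_pos.
      apply Rmult_le_compat_l; auto. }
    assert (M1 := binomial_term_le b t k i Hb Ht).
    assert (M2 := binomial_term_le (b + t) sg (k + i) j ltac:(lra) ltac:(lra)).
    assert (Hm : b ^ k * t ^ i * INR (fact (k + i + j)) / (INR (fact k) * INR (fact i))
        <= INR (fact j) / sg ^ j * (b + t + sg) ^ (k + i + j)).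
    { apply Rmult_le_reg_r with (sg ^ j / INR (fact j)). now apply Rdiv_lt_0_compat.
      replace (INR (fact j) / sg ^ j * (b + t + sg) ^ (k + i + j) * (sg ^ j / INR (fact j)))
        with ((b + t + sg) ^ (k + i + j)) by (field; lra).
      eapply Rle_trans; [|exact M2].
      replace (b ^ k * t ^ i * INR (fact (k + i + j)) / (INR (fact k) * INR (fact i)) * (sg ^ j / INR (fact j)))
       with (INR (fact (k + i + j)) / (INR (fact (k + i)) * INR (fact j)) * (sg ^ j) *
         (INR (fact (k + i)) / (INR (fact k) * INR (fact i)) * (b ^ k * t ^ i))) by (field; lra).
      rewrite (Rmult_comm _ (sg ^ j)), (Rmult_comm ((b + t) ^ (k + i))), <- !Rmult_assoc, (Rmult_comm _ (sg ^ j)).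
      rewrite !Rmult_assoc. apply Rmult_le_compat_l. lra.
      apply Rmult_le_compat_l. { left. apply Rdiv_lt_0_compat. apply fact_pos. nra. }
      rewrite <- Rmult_assoc. rewrite <- Rmult_assoc in M1. exact M1. }
    replace (M * b ^ k / INR (fact k) * (t ^ i / INR (fact i) * (C * INR (fact (k + i + j)) / rho ^ (k + i + j))))
      with (M * C / rho ^ (k + i + j) * (b ^ k * t ^ i * INR (fact (k + i + j)) / (INR (fact k) * INR (fact i))))
      by (field; lra).
    replace (M * C * (INR (fact j) / sg ^ j) * th ^ j * th ^ k * th ^ i) with
      (M * C / rho ^ (k + i + j) * (INR (fact j) / sg ^ j * (b + t + sg) ^ (k + i + j))).
    2: { unfold th, Rdiv. rewrite !Rpow_mult_distr, !pow_inv, !pow_add. field.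
         repeat split; try (apply pow_nonzero; lra); lra. }
    apply Rmult_le_compat_l; auto. apply Rmult_le_pos. nra. now apply inv_ge0.
  - intro k. apply is_series_scal_R.
    eapply is_series_ext; [|apply (moment_shift (k + j) K 1 0 e t); auto; lra].
    intro i. simpl. now replace (i + (k + j))%nat with (k + i + j)%nat by lia.
  - intro i. specialize (HT (i + j)%nat). apply (is_series_scal_R (t ^ i / INR (fact i))) in HT.
    eapply is_series_ext; [|exact HT]. intro k. simpl.
    replace (k + (i + j))%nat with (k + i + j)%nat by lia. eqR. ring.
  - apply (moment_shift j _ (B0 * 1) (0 + 0)); auto. lra.
Qed.

(** Since [rho] is the same on the whole half-line, one step length serves to
    come down from large arguments to [e]. *)
Lemma termwise_all e : 0 < e -> termwise e.
Proof.
  intro He. set (t := Rmin (e / 2) ((rho - b) / 2)).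
  assert (Ht : 0 < t) by (unfold t; apply Rmin_glb_lt; lra).
  assert (Ht1 : t <= e / 2) by apply Rmin_l. assert (Ht2 : t <= (rho - b) / 2) by apply Rmin_r.
  assert (HN : forall n, termwise (e + INR n * t) -> termwise e).
  { induction n as [|n IH]; intro HT.
    - simpl in HT. replace (e + 0 * t) with e in HT by ring. exact HT.
    - apply IH. replace (e + INR n * t) with (e + INR (S n) * t - t) by (rewrite S_INR; ring).
      assert (Hp : 0 <= INR (S n) * t). { apply Rmult_le_pos. apply pos_INR. lra. }
      apply termwise_step; auto; lra. }
  destruct (nfloor_ex (b / t)) as [n Hn].
  { apply Rmult_le_pos; auto. now apply inv_ge0. }
  apply (HN (S n)). apply termwise_large. rewrite S_INR.
  assert (b < (INR n + 1) * t). { apply Rmult_lt_reg_r with (/ t). now apply Rinv_0_lt_compat.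
    rewrite Rmult_assoc, Rinv_r, Rmult_1_r by lra. apply Hn. }
  lra.
Qed.
End Continuation.

(** * Laplace moments of the Bessel functions *)

Lemma exp_growth_osc (f : R -> R) (g : R -> R) : (forall x, continuous f x) -> (forall x, continuous g x) ->
  (forall x, 0 <= x -> Rabs (f x) <= 1) -> (forall x, Rabs (g x) <= 1) -> exp_growth 1 0 (fun x => f x * g x).
Proof.
  intros Hf Hg H1 H2. split.
  - intro x. now apply (continuous_mult f g).
  - intros x Hx. rewrite Rmult_0_l, exp_0, Rabs_mult.
    generalize (H1 x Hx) (H2 x) (Rabs_pos (f x)) (Rabs_pos (g x)). nra.
Qed.

Lemma continuous_cos_scal y x : continuous (fun x => cos (y * x)) x.
Proof. apply ex_derive_cont. auto_derive; auto. Qed.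

Lemma continuous_sin_scal y x : continuous (fun x => sin (y * x)) x.
Proof. apply ex_derive_cont. auto_derive; auto. Qed.

Lemma Rabs_cos_le x : Rabs (cos x) <= 1.
Proof. apply Rabs_le, COS_bound. Qed.

Lemma Rabs_sin_le x : Rabs (sin x) <= 1.
Proof. apply Rabs_le, SIN_bound. Qed.

Definition J0c y x := J0 x * cos (y * x).
Definition J0s y x := J0 x * sin (y * x).
Definition J1c y x := J1 x * cos (y * x).
Definition J1s y x := J1 x * sin (y * x).

Lemma exp_growth_J0c y : exp_growth 1 0 (J0c y).
Proof. apply exp_growth_osc. apply continuous_J0. apply continuous_cos_scal. apply J0_le_1. intro; apply Rabs_cos_le. Qed.
Lemma exp_growth_J0s y : exp_growth 1 0 (J0s y).
Proof. apply exp_growth_osc. apply continuous_J0. apply continuous_sin_scal. apply J0_le_1. intro; apply Rabs_sin_le. Qed.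
Lemma exp_growth_J1c y : exp_growth 1 0 (J1c y).
Proof. apply exp_growth_osc. apply continuous_J1. apply continuous_cos_scal. apply J1_le_1. intro; apply Rabs_cos_le. Qed.
Lemma exp_growth_J1s y : exp_growth 1 0 (J1s y).
Proof. apply exp_growth_osc. apply continuous_J1. apply continuous_sin_scal. apply J1_le_1. intro; apply Rabs_sin_le. Qed.

Lemma exp_growth_pow_mult n f A e : 0 < e -> exp_growth A 0 f ->
  exp_growth (INR (fact n) / (e / 2) ^ n * A) (e / 2) (fun x => x ^ n * f x).
Proof.
  intros He Hf. eapply exp_growth_weaken. 3: apply exp_growth_mult; [apply (exp_growth_pow (e / 2) n); lra | exact Hf]. lra. lra.
Qed.

Lemma moment_pow n f e : moment 0 (fun x => x ^ n * f x) e = moment n f e.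
Proof. apply LI_ext. intros x _. simpl; ring. Qed.

(** Integration of the derivative of [x ^ m * f x * exp (- e x)]: the boundary term
    at infinity vanishes. *)
Lemma moment_by_parts (m n1 n2 n3 : nat) (f f1 f2 f3 : R -> R) (a1 a2 a3 A e : R) : 0 < e ->
  exp_growth A 0 f -> exp_growth A 0 f1 -> exp_growth A 0 f2 -> exp_growth A 0 f3 ->
  (forall x, is_derive (fun x => x ^ m * f x) x
      (a1 * (x ^ n1 * f1 x) + a2 * (x ^ n2 * f2 x) + a3 * (x ^ n3 * f3 x))) ->
  a1 * moment n1 f1 e + a2 * moment n2 f2 e + a3 * moment n3 f3 e - e * moment m f e = - (0 ^ m * f 0).
Proof.
  intros He Hf H1 H2 H3 Hd.
  assert (Hs : e / 2 < e) by lra.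
  assert (G := exp_growth_pow_mult m f A e He Hf).
  assert (G1 := exp_growth_pow_mult n1 f1 A e He H1).
  assert (G2 := exp_growth_pow_mult n2 f2 A e He H2).
  assert (G3 := exp_growth_pow_mult n3 f3 A e He H3).
  assert (G12 := exp_growth_lin _ _ _ _ _ a1 a2 G1 G2).
  assert (G123 := exp_growth_lin _ _ _ _ _ 1 a3 G12 G3).
  assert (G4 := exp_growth_lin _ _ _ _ _ 1 (- e) G123 G).
  rewrite <- (moment_pow n1), <- (moment_pow n2), <- (moment_pow n3), <- (moment_pow m).
  transitivity (1 * (1 * (a1 * moment 0 (fun x => x ^ n1 * f1 x) e + a2 * moment 0 (fun x => x ^ n2 * f2 x) e)
     + a3 * moment 0 (fun x => x ^ n3 * f3 x) e) + - e * moment 0 (fun x => x ^ m * f x) e). ring.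
  rewrite <- (moment_lin 0 _ _ _ _ _ _ _ _ Hs G1 G2).
  rewrite <- (moment_lin 0 _ _ _ _ _ _ _ _ Hs G12 G3).
  rewrite <- (moment_lin 0 _ _ _ _ _ _ _ _ Hs G123 G).
  set (H := fun x => _ + - e * _) in *.
  assert (L4 := moment_exp_growth 0 _ _ _ _ Hs G4). assert (L := moment_exp_growth 0 _ _ _ _ Hs G).
  unfold moment. rewrite (LI_derive (fun x => x ^ 0 * (x ^ m * f x) * exp (- e * x)) _ _ _ _ (half_gap _ _ Hs) L4 L).
  - rewrite Rmult_0_r, exp_0. simpl. ring.
  - intro x. apply (is_derive_ext (fun x => (x ^ m * f x) * exp (- e * x))). { intro t. simpl. eqR. ring. }
    evar_last. apply (is_derive_mult (fun x => x ^ m * f x) (fun x => exp (- e * x))). apply Hd.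
    { instantiate (1 := - e * exp (- e * x)). auto_derive; auto. ring. }
    intros; apply Rmult_comm.
    unfold plus, mult; simpl. unfold H. eqR. simpl. ring.
Qed.

Section Moments.
Variables (e y : R).
Hypothesis He : 0 < e.

Lemma J0c_parts_0 : moment 0 (J1c y) e + e * moment 0 (J0c y) e + y * moment 0 (J0s y) e = 1.
Proof.
  assert (H := moment_by_parts 0 0 0 0 (J0c y) (J1c y) (J0s y) (J0s y) (-1) (- y) 0 1 e He
    (exp_growth_J0c y) (exp_growth_J1c y) (exp_growth_J0s y) (exp_growth_J0s y)).
  lapply H. 2: { intro x. unfold J0c, J0s, J1c. evar_last.
    apply (is_derive_ext (fun x => J0 x * cos (y * x))). { intro t; simpl; eqR; ring. }
    apply (is_derive_mult J0 (fun x => cos (y * x))). apply is_derive_J0.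
    { instantiate (1 := - y * sin (y * x)). auto_derive; auto. ring. } intros; apply Rmult_comm.
    unfold plus, mult; simpl; eqR; ring. }
  unfold J0c at 2. rewrite J0_0, Rmult_0_r, cos_0. simpl. lra.
Qed.

Lemma J0s_parts_0 : moment 0 (J1s y) e + e * moment 0 (J0s y) e - y * moment 0 (J0c y) e = 0.
Proof.
  assert (H := moment_by_parts 0 0 0 0 (J0s y) (J1s y) (J0c y) (J0c y) (-1) y 0 1 e He
    (exp_growth_J0s y) (exp_growth_J1s y) (exp_growth_J0c y) (exp_growth_J0c y)).
  lapply H. 2: { intro x. unfold J0c, J0s, J1s. evar_last.
    apply (is_derive_ext (fun x => J0 x * sin (y * x))). { intro t; simpl; eqR; ring. }
    apply (is_derive_mult J0 (fun x => sin (y * x))). apply is_derive_J0.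
    { instantiate (1 := y * cos (y * x)). auto_derive; auto. ring. } intros; apply Rmult_comm.
    unfold plus, mult; simpl; eqR; ring. }
  unfold J0s at 2. rewrite J0_0, Rmult_0_r, sin_0. simpl. lra.
Qed.

Lemma is_derive_pow_S (m : nat) x : is_derive (fun x => x ^ S m) x (INR (S m) * x ^ m).
Proof.
  evar_last. apply (is_derive_pow (fun x => x) (S m) x 1). apply (@is_derive_id R_AbsRing).
  simpl Init.Nat.pred. eqR. ring.
Qed.

Lemma J0c_parts m : INR (S m) * moment m (J0c y) e
   = moment (S m) (J1c y) e + e * moment (S m) (J0c y) e + y * moment (S m) (J0s y) e.
Proof.
  assert (H := moment_by_parts (S m) m (S m) (S m) (J0c y) (J0c y) (J1c y) (J0s y) (INR (S m)) (-1) (- y) 1 e He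
    (exp_growth_J0c y) (exp_growth_J0c y) (exp_growth_J1c y) (exp_growth_J0s y)).
  lapply H. 2: { intro x. unfold J0c, J0s, J1c. evar_last.
    apply (is_derive_mult (fun x => x ^ S m) (fun x => J0 x * cos (y * x))). apply is_derive_pow_S.
    apply (is_derive_mult J0 (fun x => cos (y * x))). apply is_derive_J0.
    { instantiate (1 := - y * sin (y * x)). auto_derive; auto. ring. } intros; apply Rmult_comm.
    intros; apply Rmult_comm.
    generalize (INR (S m)); intro N. unfold plus, mult; simpl; eqR. ring. }
  rewrite pow_i by lia. lra.
Qed.

Lemma J0s_parts m : INR (S m) * moment m (J0s y) e
   = moment (S m) (J1s y) e + e * moment (S m) (J0s y) e - y * moment (S m) (J0c y) e.
Proof.
  assert (H := moment_by_parts (S m) m (S m) (S m) (J0s y) (J0s y) (J1s y) (J0c y) (INR (S m)) (-1) y 1 e He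
    (exp_growth_J0s y) (exp_growth_J0s y) (exp_growth_J1s y) (exp_growth_J0c y)).
  lapply H. 2: { intro x. unfold J0c, J0s, J1s. evar_last.
    apply (is_derive_mult (fun x => x ^ S m) (fun x => J0 x * sin (y * x))). apply is_derive_pow_S.
    apply (is_derive_mult J0 (fun x => sin (y * x))). apply is_derive_J0.
    { instantiate (1 := y * cos (y * x)). auto_derive; auto. ring. } intros; apply Rmult_comm.
    intros; apply Rmult_comm.
    generalize (INR (S m)); intro N. unfold plus, mult; simpl; eqR. ring. }
  rewrite pow_i by lia. lra.
Qed.

(** [x ^ S m * J1 x] is [x ^ m] times the function [x J1], whose derivative [x J0]
    has no singular term. *)
Lemma is_derive_pow_J1 m x : is_derive (fun x => x ^ S m * J1 x) x (INR m * (x ^ m * J1 x) + x ^ S m * J0 x).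
Proof.
  apply (is_derive_ext (fun x => x ^ m * (x * J1 x))). { intro t; simpl; eqR; ring. }
  destruct m as [|m].
  - apply (is_derive_ext (fun x => x * J1 x)). { intro t; simpl; eqR; ring. }
    evar_last. apply is_derive_xJ1. simpl; eqR; ring.
  - evar_last. apply (is_derive_mult (fun x => x ^ S m) (fun x => x * J1 x)).
    apply is_derive_pow_S. apply is_derive_xJ1. intros; apply Rmult_comm.
    generalize (INR (S m)); intro N. unfold plus, mult; simpl; eqR. simpl pow. ring.
Qed.

Lemma J1c_parts m : INR m * moment m (J1c y) e + moment (S m) (J0c y) e
   = e * moment (S m) (J1c y) e + y * moment (S m) (J1s y) e.
Proof.
  assert (H := moment_by_parts (S m) m (S m) (S m) (J1c y) (J1c y) (J0c y) (J1s y) (INR m) 1 (- y) 1 e He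
    (exp_growth_J1c y) (exp_growth_J1c y) (exp_growth_J0c y) (exp_growth_J1s y)).
  lapply H. 2: { intro x. unfold J0c, J1s, J1c. evar_last.
    apply (is_derive_ext (fun x => (x ^ S m * J1 x) * cos (y * x))). { intro t; eqR; ring. }
    apply (is_derive_mult (fun x => x ^ S m * J1 x) (fun x => cos (y * x))). apply is_derive_pow_J1.
    { instantiate (1 := - y * sin (y * x)). auto_derive; auto. ring. } intros; apply Rmult_comm.
    generalize (INR (S m)); intro N. unfold plus, mult; simpl; eqR. ring. }
  rewrite pow_i by lia. lra.
Qed.

Lemma J1s_parts m : INR m * moment m (J1s y) e + moment (S m) (J0s y) e
   = e * moment (S m) (J1s y) e - y * moment (S m) (J1c y) e.
Proof.
  assert (H := moment_by_parts (S m) m (S m) (S m) (J1s y) (J1s y) (J0s y) (J1c y) (INR m) 1 y 1 e He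
    (exp_growth_J1s y) (exp_growth_J1s y) (exp_growth_J0s y) (exp_growth_J1c y)).
  lapply H. 2: { intro x. unfold J0s, J1s, J1c. evar_last.
    apply (is_derive_ext (fun x => (x ^ S m * J1 x) * sin (y * x))). { intro t; eqR; ring. }
    apply (is_derive_mult (fun x => x ^ S m * J1 x) (fun x => sin (y * x))). apply is_derive_pow_J1.
    { instantiate (1 := y * cos (y * x)). auto_derive; auto. ring. } intros; apply Rmult_comm.
    generalize (INR (S m)); intro N. unfold plus, mult; simpl; eqR. ring. }
  rewrite pow_i by lia. lra.
Qed.
End Moments.

(** The moments of [J0] and [J1] against [exp (- z x)], divided by [n!]. *)
Definition Pmom (n : nat) (z : C) : C :=
  (moment n (J0c (Im z)) (Re z) / INR (fact n), - (moment n (J0s (Im z)) (Re z) / INR (fact n))).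
Definition Qmom (n : nat) (z : C) : C :=
  (moment n (J1c (Im z)) (Re z) / INR (fact n), - (moment n (J1s (Im z)) (Re z) / INR (fact n))).

(** The recurrence is the Bessel system [J0' = - J1], [(x J1)' = x J0] read on
    the moments. *)
Definition bessel_rec (z : C) (P Q : nat -> C) : Prop :=
  Q 0%nat = (1 - z * P 0%nat)%C /\
  forall n, (Q (S n) + z * P (S n) = P n)%C /\
            (P (S n) - z * Q (S n) = - (RtoC (INR n / INR (S n)) * Q n))%C.

Lemma moments_rec (z : C) : 0 < Re z -> bessel_rec z (fun n => Pmom n z) (fun n => Qmom n z).
Proof.
  intro Hz. destruct z as [e y]. simpl in Hz. unfold Pmom, Qmom. simpl Re; simpl Im.
  split.
  - assert (H1 := J0c_parts_0 e y Hz). assert (H2 := J0s_parts_0 e y Hz).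
    apply injective_projections; simpl; lra.
  - intro n. assert (H1 := J0c_parts e y Hz n). assert (H2 := J0s_parts e y Hz n).
    assert (H3 := J1c_parts e y Hz n). assert (H4 := J1s_parts e y Hz n).
    assert (Fn := fact_pos n). assert (Sn : 0 < INR (S n)) by (apply lt_0_INR; lia).
    rewrite !fact_simpl, !mult_INR.
    set (N := INR (S n)) in *. set (f := INR (fact n)) in *.
    split; apply injective_projections; unfold Cminus, Cplus, Cmult, Copp, RtoC; cbn [fst snd].
    + replace (moment n (J0c y) e) with ((N * moment n (J0c y) e) / N) by (field; lra). rewrite H1. field. lra.
    + replace (moment n (J0s y) e) with ((N * moment n (J0s y) e) / N) by (field; lra). rewrite H2. field. lra.
    + replace (moment (S n) (J0c y) e) with (e * moment (S n) (J1c y) e + y * moment (S n) (J1s y) e - INR n * moment n (J1c y) e) by lra.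
      field. lra.
    + replace (moment (S n) (J0s y) e) with (e * moment (S n) (J1s y) e - y * moment (S n) (J1c y) e - INR n * moment n (J1s y) e) by lra.
      field. lra.
Qed.

(** In terms of [P - i Q] and [P + i Q] the recurrence reads
    [(z + i) (P' - i Q') = k (P - i Q) + (1 - k) (P + i Q)] and the same with
    [i] replaced by [- i], where [0 <= k <= 1]: a convex combination. *)
Lemma bessel_rec_bound (z : C) (P Q : nat -> C) (rho : R) : bessel_rec z P Q -> 0 < rho ->
  rho <= Cmod (z + Ci) -> rho <= Cmod (z - Ci) ->
  forall n, Cmod (P n) <= (Cmod (P 0%nat) + Cmod (Q 0%nat)) / rho ^ n /\
            Cmod (Q n) <= (Cmod (P 0%nat) + Cmod (Q 0%nat)) / rho ^ n.
Proof.
  intros [_ Hrec] Hr H1 H2. set (C0 := Cmod (P 0%nat) + Cmod (Q 0%nat)).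
  assert (Ci2 : (Ci * Ci = -1)%C). { apply injective_projections; simpl; ring. }
  assert (E0 : (- Ci * Ci - 1 = 0)%C). { apply injective_projections; simpl; ring. }
  assert (HZ : forall n, Cmod (P n - Ci * Q n) <= C0 / rho ^ n /\ Cmod (P n + Ci * Q n) <= C0 / rho ^ n).
  { induction n as [|n [IH1 IH2]].
    - rewrite pow_O. unfold Rdiv; rewrite Rinv_1, Rmult_1_r. unfold C0, Cminus. split; (eapply Rle_trans; [apply Cmod_triangle|]).
      { rewrite Cmod_opp, Cmod_mult, Cmod_Ci; lra. } { rewrite Cmod_mult, Cmod_Ci; lra. }
    - destruct (Hrec n) as [Ha Hb].
      set (k := (1 + INR n / INR (S n)) / 2).
      assert (Hn : 0 <= INR n / INR (S n) <= 1).
      { assert (0 < INR (S n)) by (apply lt_0_INR; lia). assert (0 <= INR n) by apply pos_INR.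
        split. apply Rmult_le_pos; auto. now apply inv_ge0.
        apply Rmult_le_reg_r with (INR (S n)); auto. unfold Rdiv. rewrite Rmult_assoc, Rinv_l, S_INR by lra.
        rewrite S_INR in *. lra. }
      assert (Hk : 0 <= k <= 1) by (unfold k; lra).
      assert (Hpow : 0 < rho ^ n) by now apply pow_lt.
      assert (Hconv : forall u v : C, Cmod u <= C0 / rho ^ n -> Cmod v <= C0 / rho ^ n ->
         Cmod (RtoC k * u + RtoC (1 - k) * v) <= C0 / rho ^ n).
      { intros u v Hu Hv. eapply Rle_trans. apply Cmod_triangle.
        rewrite !Cmod_mult, !Cmod_R, !Rabs_right by lra. nra. }
      assert (Hdiv : forall w v u : C, rho <= Cmod w -> (w * v = u)%C -> Cmod u <= C0 / rho ^ n -> Cmod v <= C0 / rho ^ S n).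
      { intros w v u Hw <- Hu. rewrite Cmod_mult in Hu.
        apply Rmult_le_reg_l with rho; auto. apply Rle_trans with (C0 / rho ^ n).
        apply Rle_trans with (Cmod w * Cmod v); auto. apply Rmult_le_compat_r; auto. apply Cmod_ge_0.
        right. simpl. field. split; lra. }
      assert (Ek : RtoC (INR n / INR (S n)) = (2 * RtoC k - 1)%C).
      { unfold k. rewrite <- RtoC_mult, <- RtoC_minus. f_equal. field. apply not_0_INR; lia. }
      rewrite Ek in Hb.
      assert (E1k : RtoC (1 - k) = (1 - RtoC k)%C) by now rewrite RtoC_minus.
      split.
      + apply (Hdiv _ _ _ H1) with (2 := Hconv _ _ IH1 IH2).
        rewrite E1k. transitivity ((Q (S n) + z * P (S n)) + (Ci * (P (S n) - z * Q (S n))) + (- Ci * Ci - 1) * Q (S n))%C. ring.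
        rewrite Ha, Hb, E0. ring.
      + apply (Hdiv _ _ _ H2) with (2 := Hconv _ _ IH2 IH1).
        rewrite E1k. transitivity ((Q (S n) + z * P (S n)) - (Ci * (P (S n) - z * Q (S n))) + (- Ci * Ci - 1) * Q (S n))%C. ring.
        rewrite Ha, Hb, E0. ring. }
  intro n. destruct (HZ n) as [Z1 Z2].
  assert (HP : (P n = RtoC (1 / 2) * ((P n - Ci * Q n) + (P n + Ci * Q n)))%C).
  { replace (RtoC (1 / 2)) with (/ 2)%C by (apply injective_projections; simpl; field). field. }
  assert (HQ : (Q n = RtoC (1 / 2) * (- Ci) * ((P n + Ci * Q n) + - (P n - Ci * Q n)))%C).
  { transitivity (RtoC (1 / 2) * (- (Ci * Ci)) * (2 * Q n))%C. rewrite Ci2.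
    replace (RtoC (1 / 2)) with (/ 2)%C by (apply injective_projections; simpl; field). field. ring. }
  split.
  - rewrite HP, Cmod_mult, Cmod_R, Rabs_right by lra.
    assert (H := Cmod_triangle (P n - Ci * Q n) (P n + Ci * Q n)). lra.
  - rewrite HQ, !Cmod_mult, Cmod_R, Rabs_right, Cmod_opp, Cmod_Ci by lra.
    assert (H := Cmod_triangle (P n + Ci * Q n) (- (P n - Ci * Q n))). rewrite Cmod_opp in H. lra.
Qed.

Lemma im_le_Cmod (z : C) : Rabs (Im z) <= Cmod z.
Proof. exact (Rle_trans _ _ _ (Rmax_r _ _) (Rmax_Cmod z)). Qed.

Lemma Cmod_add_Ci_ge (z : C) : 1 - Rabs (Im z) <= Cmod (z + Ci) /\ 1 - Rabs (Im z) <= Cmod (z - Ci).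
Proof.
  split.
  - eapply Rle_trans; [|apply im_le_Cmod]. unfold Im; simpl. fold (Im z).
    unfold Rabs; repeat destruct Rcase_abs; lra.
  - eapply Rle_trans; [|apply im_le_Cmod]. unfold Im; simpl. fold (Im z).
    unfold Rabs; repeat destruct Rcase_abs; lra.
Qed.

(** The bound needed for [termwise_all] on the line [Im z = y]: the points of this
    line are at distance at least [1 - |y|] from [i] and [- i]. *)
Lemma J1_moment_bound (y rho : R) : 0 < rho -> rho <= 1 - Rabs y -> forall e, 0 < e ->
  exists C, forall n, Rabs (moment n (J1c y) e) <= C * INR (fact n) / rho ^ n /\
                      Rabs (moment n (J1s y) e) <= C * INR (fact n) / rho ^ n.
Proof.
  intros Hr Hy e He. set (z := (e, y) : C).
  destruct (Cmod_add_Ci_ge z) as [H1 H2]. change (Im z) with y in *.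
  assert (H := bessel_rec_bound z _ _ rho (moments_rec z He) Hr ltac:(lra) ltac:(lra)).
  set (C0 := Cmod (Pmom 0 z) + Cmod (Qmom 0 z)) in H. exists C0. intro n.
  destruct (H n) as [_ HQ]. assert (Fn := fact_pos n).
  assert (Hf : Rabs (/ INR (fact n)) = / INR (fact n)).
  { apply Rabs_right. left. now apply Rinv_0_lt_compat. }
  assert (Hm := Rmax_Cmod (Qmom n z)). unfold Qmom in Hm at 1 2. cbn [fst snd] in Hm.
  change (Re z) with e in Hm. change (Im z) with y in Hm.
  rewrite Rabs_Ropp in Hm. unfold Rdiv in Hm. rewrite !Rabs_mult, Hf in Hm.
  replace (C0 * INR (fact n) / rho ^ n) with (C0 / rho ^ n * INR (fact n)) by (unfold Rdiv; ring).
  assert (Hd : forall u, u * / INR (fact n) <= C0 / rho ^ n -> u <= C0 / rho ^ n * INR (fact n)).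
  { intros u Hu. apply Rmult_le_reg_r with (/ INR (fact n)). now apply Rinv_0_lt_compat.
    rewrite (Rmult_assoc (C0 / rho ^ n)), Rinv_r, Rmult_1_r by lra. exact Hu. }
  split; apply Hd; eapply Rle_trans; [|exact HQ| |exact HQ]; eapply Rle_trans; [|exact Hm| |exact Hm].
  { apply Rmax_l. } { apply Rmax_r. }
Qed.

(** * The Laplace transform of [J0] *)

(** By [moment_shift] the moment is a power series in the distance to [3 e / 2],
    with a radius of convergence greater than [e / 2]. *)
Lemma is_derive_moment (j : nat) w A e : 0 < e -> exp_growth A 0 w ->
  is_derive (moment j w) e (- moment (S j) w e).
Proof.
  intros He Hw. set (e0 := 3 * e / 2).
  assert (Ha : forall j t, 0 <= t < e0 ->
      is_pseries (fun k => moment (k + j) w e0 / INR (fact k)) t (moment j w (e0 - t))).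
  { intros i t Ht. apply is_pseries_R.
    eapply is_series_ext; [|apply (moment_shift i w A 0 e0 t Hw); lra].
    intro k. simpl. unfold Rdiv; ring. }
  set (a := fun k => moment (k + j) w e0 / INR (fact k)).
  assert (HCV : Rbar_lt (Rabs (e / 2)) (CV_radius a)).
  { apply Rbar_lt_le_trans with (3 * e / 4). simpl. rewrite Rabs_right; lra.
    apply Rbar_not_lt_le. intro Hlt.
    apply (CV_disk_outside a (3 * e / 4)). rewrite Rabs_right by lra. exact Hlt.
    apply (ex_series_lim_0 (fun n => a n * (3 * e / 4) ^ n)).
    assert (H := Ha j (3 * e / 4) ltac:(unfold e0; lra)). apply is_pseries_R in H. eexists; exact H. }
  apply (is_derive_ext_loc (fun x => PSeries a (e0 - x))).
  { assert (Hp : 0 < e / 2) by lra. exists (mkposreal _ Hp). intros x Hx.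
    change (Rabs (x - e) < e / 2) in Hx. apply Rabs_lt_between in Hx.
    transitivity (moment j w (e0 - (e0 - x))). 2: f_equal; ring.
    refine (is_pseries_unique a (e0 - x) _ (Ha j (e0 - x) _)). unfold e0; lra. }
  evar_last.
  apply (is_derive_comp (PSeries a) (fun x => e0 - x)). apply is_derive_PSeries.
  replace (e0 - e) with (e / 2) by (unfold e0; field). exact HCV.
  { instantiate (1 := -1). auto_derive; auto. }
  replace (e0 - e) with (e / 2) by (unfold e0; field).
  replace (PSeries (PS_derive a) (e / 2)) with (moment (S j) w e).
  { unfold scal; simpl; unfold mult; simpl; eqR; ring. }
  symmetry. replace (moment (S j) w e) with (moment (S j) w (e0 - e / 2)) by (f_equal; unfold e0; field).
  apply is_pseries_unique. eapply is_pseries_ext; [|apply (Ha (S j)); unfold e0; lra].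
  intro k. unfold PS_derive, a. replace (k + S j)%nat with (S k + j)%nat by lia.
  rewrite fact_simpl, mult_INR. eqR. field. split. apply INR_fact_neq_0. apply not_0_INR; lia.
Qed.

Lemma const_of_derive (f : R -> R) (a b : R) : 0 < a <= b ->
  (forall x, 0 < x -> is_derive f x 0) -> f a = f b.
Proof.
  intros Hab Hd. assert (Hc : forall x, a <= x <= b -> continuous f x).
  { intros x Hx. apply ex_derive_cont. eexists; apply Hd; lra. }
  apply Rle_antisym.
  - apply Ropp_le_cancel. apply (nonincr_of_derive (fun x => - f x) (fun _ => - 0) a b); try lra.
    + intros x Hx. apply (continuous_opp f). auto.
    + intros x Hx. apply (is_derive_opp f). apply Hd; lra.
    + intros x Hx. change (- 0 <= 0). lra.
  - apply (nonincr_of_derive f (fun _ => 0) a b); try lra; auto.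
    + intros x Hx; apply Hd; lra.
    + intros; lra.
Qed.

Lemma moment0_bound f e : 0 < e -> exp_growth 1 0 f -> Rabs (moment 0 f e) <= 2 / e.
Proof.
  intros He Hf. eapply Rle_trans. apply (moment_bound 0 f 1 0 e He Hf). right. simpl. field. lra.
Qed.

Section Transform.
Variable y : R.
Let p e := moment 0 (J0c y) e.
Let s e := moment 0 (J0s y) e.

(** The recurrence gives [(1 + z ^ 2) P 1 = z P 0], while [P 1] is the
    opposite of the derivative of [P 0]: so [P 0 ^ 2 (1 + z ^ 2)] is constant on
    horizontal lines. *)
Lemma transform_sq_const e1 e2 : 0 < e1 <= e2 ->
  (Pmom 0 (e1, y) * Pmom 0 (e1, y) * (1 + (e1, y) * (e1, y)) =
   Pmom 0 (e2, y) * Pmom 0 (e2, y) * (1 + (e2, y) * (e2, y)))%C.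
Proof.
  intros He.
  assert (E : forall e, (Pmom 0 (e, y) * Pmom 0 (e, y) * (1 + (e, y) * (e, y)))%C =
     ((p e ^ 2 - s e ^ 2) * (1 + e ^ 2 - y ^ 2) + 4 * p e * s e * e * y,
      (p e ^ 2 - s e ^ 2) * (2 * e * y) - 2 * p e * s e * (1 + e ^ 2 - y ^ 2))).
  { intro e. unfold Pmom, p, s. cbn [Re Im fst snd].
    unfold Cplus, Cmult, RtoC; cbn [fst snd fact]. change (INR 1) with 1.
    apply injective_projections; cbn [fst snd]; field. }
  rewrite !E.
  assert (R1 : forall e, 0 < e -> (1 + e ^ 2 - y ^ 2) * moment 1 (J0c y) e + 2 * e * y * moment 1 (J0s y) e = e * p e + y * s e /\
      2 * e * y * moment 1 (J0c y) e - (1 + e ^ 2 - y ^ 2) * moment 1 (J0s y) e = y * p e - e * s e).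
  { intros e H. assert (H1 := J0c_parts e y H 0). assert (H2 := J0s_parts e y H 0).
    assert (H3 := J1c_parts e y H 0). assert (H4 := J1s_parts e y H 0). fold (p e) in *. fold (s e) in *.
    change (INR 1) with 1 in *. change (INR 0) with 0 in *.
    assert (H1' : moment 1 (J1c y) e = p e - e * moment 1 (J0c y) e - y * moment 1 (J0s y) e) by lra.
    assert (H2' : moment 1 (J1s y) e = s e - e * moment 1 (J0s y) e + y * moment 1 (J0c y) e) by lra.
    rewrite H1', H2' in H3, H4. split; nra. }
  assert (Dp : forall e, 0 < e -> is_derive p e (- moment 1 (J0c y) e)).
  { intros e H. exact (is_derive_moment 0 _ _ _ H (exp_growth_J0c y)). }
  assert (Ds : forall e, 0 < e -> is_derive s e (- moment 1 (J0s y) e)).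
  { intros e H. exact (is_derive_moment 0 _ _ _ H (exp_growth_J0s y)). }
  f_equal.
  - apply (const_of_derive (fun e => (p e ^ 2 - s e ^ 2) * (1 + e ^ 2 - y ^ 2) + 4 * p e * s e * e * y)); auto.
    intros e H. destruct (R1 e H) as [H1 H2].
    assert (Dp' := Dp e H). assert (Ds' := Ds e H).
    assert (Ep : ex_derive p e) by (eexists; exact Dp'). assert (Es : ex_derive s e) by (eexists; exact Ds').
    clear E Dp Ds R1 He. apply is_derive_unique in Dp'. apply is_derive_unique in Ds'. clearbody p s.
    auto_derive. { repeat split; assumption. }
    change (Derive (fun x => p x) e) with (Derive p e). change (Derive (fun x => s x) e) with (Derive s e).
    rewrite Dp', Ds'.
    transitivity (-2 * p e * ((1 + e ^ 2 - y ^ 2) * moment 1 (J0c y) e + 2 * e * y * moment 1 (J0s y) e)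
      - 2 * s e * (2 * e * y * moment 1 (J0c y) e - (1 + e ^ 2 - y ^ 2) * moment 1 (J0s y) e)
      + 2 * e * (p e ^ 2 - s e ^ 2) + 4 * p e * s e * y). ring. rewrite H1, H2. ring.
  - apply (const_of_derive (fun e => (p e ^ 2 - s e ^ 2) * (2 * e * y) - 2 * p e * s e * (1 + e ^ 2 - y ^ 2))); auto.
    intros e H. destruct (R1 e H) as [H1 H2].
    assert (Dp' := Dp e H). assert (Ds' := Ds e H).
    assert (Ep : ex_derive p e) by (eexists; exact Dp'). assert (Es : ex_derive s e) by (eexists; exact Ds').
    clear E Dp Ds R1 He. apply is_derive_unique in Dp'. apply is_derive_unique in Ds'. clearbody p s.
    auto_derive. { repeat split; assumption. }
    change (Derive (fun x => p x) e) with (Derive p e). change (Derive (fun x => s x) e) with (Derive s e).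
    rewrite Dp', Ds'.
    transitivity (2 * s e * ((1 + e ^ 2 - y ^ 2) * moment 1 (J0c y) e + 2 * e * y * moment 1 (J0s y) e)
      - 2 * p e * (2 * e * y * moment 1 (J0c y) e - (1 + e ^ 2 - y ^ 2) * moment 1 (J0s y) e)
      + 2 * y * (p e ^ 2 - s e ^ 2) - 4 * p e * s e * e). ring. rewrite H1, H2. ring.
Qed.

(** The constant is the limit at infinity, where [P 0] tends to 0 and
    [z P 0 = 1 - Q 0] tends to 1. *)
Lemma transform_sq e : 0 < e -> (Pmom 0 (e, y) * Pmom 0 (e, y) * (1 + (e, y) * (e, y)) = 1)%C.
Proof.
  intro He. set (g := (Pmom 0 (e, y) * Pmom 0 (e, y) * (1 + (e, y) * (e, y)))%C).
  assert (Hb : forall x, e <= x -> 1 <= x -> Cmod (g - 1) <= 40 / x).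
  { intros x H1 H2. unfold g. rewrite (transform_sq_const e x) by lra.
    assert (Hx : 0 < Re (x, y)) by (simpl; lra).
    destruct (moments_rec (x, y) Hx) as [Hq _].
    replace (_ - 1)%C with (Pmom 0 (x, y) * Pmom 0 (x, y) + (Qmom 0 (x, y) * Qmom 0 (x, y) - 2 * Qmom 0 (x, y)))%C.
    2: { rewrite Hq. ring. }
    assert (Hm : forall f g : R -> R, exp_growth 1 0 f -> exp_growth 1 0 g ->
        Cmod (moment 0 f x / INR (fact 0), - (moment 0 g x / INR (fact 0))) <= 4 / x).
    { intros f0 g0 Hf Hg. rewrite Cmod_norm.
      assert (A1 := moment0_bound f0 x Hx Hf). assert (A2 := moment0_bound g0 x Hx Hg).
      simpl fact. change (INR 1) with 1. unfold Rdiv in *. rewrite Rinv_1, !Rmult_1_r.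
      rewrite <- Cmod_norm.
      replace (moment 0 f0 x, - moment 0 g0 x) with (RtoC (moment 0 f0 x) + RtoC (- moment 0 g0 x) * Ci)%C.
      2: { apply injective_projections; simpl; ring. }
      eapply Rle_trans. apply Cmod_triangle. rewrite Cmod_mult, Cmod_Ci, !Cmod_R, Rabs_Ropp. lra. }
    assert (HP : Cmod (Pmom 0 (x, y)) <= 4 / x) by (apply Hm; [apply exp_growth_J0c | apply exp_growth_J0s]).
    assert (HQ : Cmod (Qmom 0 (x, y)) <= 4 / x) by (apply Hm; [apply exp_growth_J1c | apply exp_growth_J1s]).
    eapply Rle_trans. apply Cmod_triangle.
    assert (HT := Cmod_triangle (Qmom 0 (x, y) * Qmom 0 (x, y)) (- (2 * Qmom 0 (x, y)))).
    rewrite Cmod_opp, !Cmod_mult, Cmod_R, (Rabs_right 2) in HT by lra.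
    rewrite Cmod_mult. unfold Cminus at 1.
    assert (A1 := Cmod_ge_0 (Pmom 0 (x, y))). assert (A2 := Cmod_ge_0 (Qmom 0 (x, y))).
    assert (A3 : 0 < 4 / x <= 4).
    { split. apply Rdiv_lt_0_compat; lra. apply Rmult_le_reg_r with x. lra. unfold Rdiv. rewrite Rmult_assoc, Rinv_l by lra. lra. }
    replace (40 / x) with (10 * (4 / x)) by (field; lra). nra. }
  assert (Hz : Cmod (g - 1) = 0).
  { apply Rle_antisym; [|apply Cmod_ge_0]. apply le_epsilon. intros eps Heps.
    assert (0 < 40 / eps) by (apply Rdiv_lt_0_compat; lra).
    specialize (Hb (e + 1 + 40 / eps) ltac:(lra) ltac:(lra)). rewrite Rplus_0_l.
    eapply Rle_trans. exact Hb. apply Rmult_le_reg_r with (e + 1 + 40 / eps). lra.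
    unfold Rdiv at 1. rewrite Rmult_assoc, Rinv_l, Rmult_1_r by lra.
    rewrite Rmult_plus_distr_l. replace (eps * (40 / eps)) with 40 by (field; lra). nra. }
  apply Cmod_eq_0 in Hz. replace g with ((g - 1) + 1)%C by ring. rewrite Hz. ring.
Qed.

(** On a horizontal line [Re (P 0)] is positive for large [e], and does not
    vanish: otherwise [P 0 ^ 2] would be a non-positive real number, and so would be
    [1 + z ^ 2 = 1 / P 0 ^ 2], which does not happen for [Re z > 0]. *)
Lemma transform_re_pos e : 0 < e -> 0 < Re (Pmom 0 (e, y)).
Proof.
  intro He.
  assert (Hnz : forall x, 0 < x -> p x <> 0).
  { intros x Hx Hp. assert (H := transform_sq x Hx). unfold Pmom in H. cbn [Re Im fst snd] in H.
    fold (p x) in H. fold (s x) in H. rewrite Hp in H.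
    assert (H1 := f_equal fst H). assert (H2 := f_equal snd H).
    simpl in H1, H2. unfold Rdiv in H1, H2. rewrite Rinv_1 in H1, H2.
    assert (E1 : - (s x * s x) * (1 + x * x - y * y) = 1) by (etransitivity; [|exact H1]; ring).
    assert (E2 : s x * s x * (x * y) = 0) by (clear - H2; lra).
    assert (Hs : s x * s x <> 0) by (intro Hs; rewrite Hs in E1; lra).
    assert (y = 0).
    { apply Rmult_integral in E2. destruct E2 as [E2|E2]. lra. apply Rmult_integral in E2. lra. }
    subst y. nra. }
  assert (Hlarge : forall x, 2 + 2 * Rabs y < x -> 0 < p x).
  { intros x Hx. assert (Hy := Rabs_pos y). assert (Hx0 : 0 < x) by lra.
    assert (H := J0c_parts_0 x y Hx0). fold (p x) in H. fold (s x) in H.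
    assert (A1 := moment0_bound _ x Hx0 (exp_growth_J1c y)).
    assert (A2 := moment0_bound _ x Hx0 (exp_growth_J0s y)). fold (s x) in A2.
    assert (A3 : Rabs (y * s x) <= Rabs y * (2 / x)).
    { rewrite Rabs_mult. now apply Rmult_le_compat_l. }
    assert (A4 : (1 + Rabs y) * (2 / x) < 1).
    { apply Rmult_lt_reg_r with x; auto. replace ((1 + Rabs y) * (2 / x) * x) with (2 + 2 * Rabs y) by (field; lra). lra. }
    apply Rabs_le_between in A1. apply Rabs_le_between in A3.
    assert (0 < x * p x) by lra. apply Rmult_lt_reg_l with x; auto. lra. }
  change (Re (Pmom 0 (e, y))) with (p e / 1). unfold Rdiv; rewrite Rinv_1, Rmult_1_r.
  destruct (Rtotal_order (p e) 0) as [Hn|[Hn|Hn]]; auto. 2: { exfalso; now apply (Hnz e). }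
  exfalso. assert (Hc : forall x, 0 < x -> continuous p x).
  { intros x Hx. apply ex_derive_cont. eexists. apply (is_derive_moment 0 _ _ _ Hx (exp_growth_J0c y)). }
  set (e2 := e + 3 + 2 * Rabs y). assert (Hy := Rabs_pos y).
  destruct (IVT_Rbar_incr p e e2 (p e) (p e2) 0) as [x [H1 [H2 H3]]].
  - apply is_lim_continuity. apply continuity_pt_filterlim, Hc; auto.
  - apply is_lim_continuity. apply continuity_pt_filterlim, Hc. unfold e2; lra.
  - intros x H1 H2. apply continuity_pt_filterlim, Hc. simpl in H1. lra.
  - simpl. unfold e2. lra.
  - simpl. split; auto. apply Hlarge. unfold e2; lra.
  - simpl in H1. apply (Hnz x); auto. lra.
Qed.
End Transform.

(** * The branch of [1 / sqrt (1 + z ^ 2)] with positive real part *)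

Definition csqrt (w : C) : C :=
  let r := sqrt ((Cmod w + Re w) / 2) in (r, Im w / (2 * r)).

Definition inv_sqrt (z : C) : C := (/ csqrt (1 + z * z))%C.

Lemma csqrt_spec (w : C) : 0 < Re w -> (csqrt w * csqrt w = w)%C /\ 0 < Re (csqrt w).
Proof.
  intro Hw. assert (Hm := Cmod2_alt w). assert (H0 := Cmod_ge_0 w).
  unfold csqrt. set (r := sqrt ((Cmod w + Re w) / 2)).
  assert (Hr : 0 < r) by (apply sqrt_lt_R0; lra).
  assert (Hr2 : r * r = (Cmod w + Re w) / 2) by (apply sqrt_sqrt; lra).
  split; [|exact Hr]. apply injective_projections; simpl.
  - change (fst w) with (Re w).
    apply Rmult_eq_reg_r with (4 * (r * r)); [|nra].
    transitivity (4 * (r * r) * (r * r) - Im w ^ 2). field. lra. rewrite Hr2. lra.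
  - change (snd w) with (Im w). field. lra.
Qed.

Lemma Re_inv_pos (w : C) : 0 < Re w -> 0 < Re (/ w).
Proof.
  destruct w as [a c]. simpl. intro H. apply Rdiv_lt_0_compat; auto. nra.
Qed.

Lemma inv_sqrt_spec (z : C) : 0 < Re (1 + z * z) ->
  (inv_sqrt z * inv_sqrt z * (1 + z * z) = 1)%C /\ 0 < Re (inv_sqrt z).
Proof.
  intro H. destruct (csqrt_spec _ H) as [H1 H2]. unfold inv_sqrt. split.
  - rewrite <- H1 at 3. field. intro E. rewrite E in H2. simpl in H2. lra.
  - now apply Re_inv_pos.
Qed.

Lemma inv_sqrt_unique (u v w : C) : 0 < Re u -> 0 < Re v ->
  (u * u * w = 1)%C -> (v * v * w = 1)%C -> u = v.
Proof.
  intros Hu Hv H1 H2.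
  assert (E : ((u - v) * ((u + v) * w) = 0)%C).
  { transitivity (u * u * w - v * v * w)%C. ring. rewrite H1, H2. ring. }
  assert (Hw : w <> 0%C). { intro E0. rewrite E0 in H1. apply (f_equal Re) in H1. simpl in H1. lra. }
  assert (Huv : (u + v)%C <> 0%C). { intro E0. apply (f_equal Re) in E0. simpl in E0. unfold Re in *. lra. }
  assert (Hd : (u - v = 0)%C).
  { transitivity ((u - v) * ((u + v) * w) * (/ ((u + v) * w)))%C. field; auto. rewrite E. ring. }
  replace u with ((u - v) + v)%C by ring. rewrite Hd. ring.
Qed.

Lemma Pmom_0_inv_sqrt (z : C) : 0 < Re z -> 0 < Re (1 + z * z) -> Pmom 0 z = inv_sqrt z.
Proof.
  intros Hz Hw. destruct (inv_sqrt_spec z Hw) as [H1 H2]. destruct z as [e y]. simpl in Hz.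
  apply inv_sqrt_unique with (w := (1 + (e, y) * (e, y))%C); auto.
  now apply transform_re_pos. now apply transform_sq.
Qed.

Lemma inv_sqrt_0 : inv_sqrt 0 = RtoC 1.
Proof.
  destruct (inv_sqrt_spec 0) as [H1 H2]. { simpl. lra. }
  apply inv_sqrt_unique with (w := (1 + 0 * 0)%C); auto. simpl; lra. ring.
Qed.

(** * Uniform limits of polynomials on a disc *)

Fixpoint peval (l : list C) (z : C) : C :=
  match l with nil => RtoC 0 | c :: l' => (c + z * peval l' z)%C end.

Definition is_poly (F : C -> C) : Prop := exists l, forall z, F z = peval l z.

Lemma is_poly_ext F G : (forall z, F z = G z) -> is_poly F -> is_poly G.
Proof. intros H [l Hl]. exists l. intro z. now rewrite <- H. Qed.

Lemma is_poly_const c : is_poly (fun _ => c).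
Proof. exists (c :: nil). intro z. simpl peval. ring. Qed.

Lemma is_poly_id : is_poly (fun z => z).
Proof. exists (RtoC 0 :: RtoC 1 :: nil). intro z. simpl peval. ring. Qed.

Lemma is_poly_plus F G : is_poly F -> is_poly G -> is_poly (fun z => F z + G z)%C.
Proof.
  intros [l1 H1] [l2 H2].
  assert (H : is_poly (fun z => peval l1 z + peval l2 z)%C).
  { clear. revert l2; induction l1 as [|c l1 IH]; intro l2.
    - exists l2. intro z. simpl peval. ring.
    - destruct l2 as [|c2 l2].
      + exists (c :: l1). intro z. simpl peval. ring.
      + destruct (IH l2) as [l Hl]. exists ((c + c2)%C :: l). intro z. simpl peval. rewrite <- Hl. ring. }
  eapply is_poly_ext; [|exact H]. intro z. cbv beta. now rewrite H1, H2.
Qed.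

Lemma is_poly_scal c F : is_poly F -> is_poly (fun z => c * F z)%C.
Proof.
  intros [l Hl]. exists (map (Cmult c) l). intro z. rewrite Hl. clear Hl.
  induction l as [|d l IH]; simpl map; simpl peval. ring. rewrite <- IH. ring.
Qed.

Lemma is_poly_mult F G : is_poly F -> is_poly G -> is_poly (fun z => F z * G z)%C.
Proof.
  intros [l1 H1] HG.
  assert (H : is_poly (fun z => peval l1 z * G z)%C).
  { clear H1. induction l1 as [|c l1 [l Hl]].
    - apply (is_poly_ext (fun _ => RtoC 0)). intro; simpl peval; ring. apply is_poly_const.
    - apply (is_poly_ext (fun z => c * G z + peval (RtoC 0 :: l) z)%C).
      { intro z. simpl peval. rewrite <- Hl. ring. }
      apply is_poly_plus. now apply is_poly_scal. now exists (RtoC 0 :: l). }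
  eapply is_poly_ext; [|exact H]. intro z. cbv beta. now rewrite H1.
Qed.

Lemma is_poly_pow n : is_poly (fun z => z ^ n)%C.
Proof.
  induction n as [|n IH]. exact (is_poly_const 1).
  apply (is_poly_ext (fun z => z * z ^ n)%C). intro z; now rewrite Cpow_S. apply (is_poly_mult (fun z => z)); auto using is_poly_id.
Qed.

Definition circ (r t : R) : C := (r * cos t, r * sin t).

Lemma circ_pow r t n : (circ r t ^ n)%C = (r ^ n * cos (INR n * t), r ^ n * sin (INR n * t)).
Proof.
  induction n as [|n IH].
  - simpl. rewrite Rmult_0_l, cos_0, sin_0. unfold RtoC. f_equal; ring.
  - rewrite Cpow_S, IH, S_INR. replace ((INR n + 1) * t) with (INR n * t + t) by ring.
    rewrite cos_plus, sin_plus. unfold circ, Cmult; simpl. f_equal; ring.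
Qed.

Lemma Cmod_circ r t : 0 <= r -> Cmod (circ r t) = r.
Proof.
  intro Hr. unfold circ, Cmod; simpl. replace (_ + _) with (r ^ 2 * ((sin t) ^ 2 + (cos t) ^ 2)) by ring.
  replace ((sin t) ^ 2 + (cos t) ^ 2) with (Rsqr (sin t) + Rsqr (cos t)) by (unfold Rsqr; ring).
  rewrite sin2_cos2, Rmult_1_r. now apply sqrt_pow2.
Qed.

(** On a circle, [z ^ S j] integrates to a multiple of itself. *)
Lemma periodic_primitive (r : R) (l : list C) (j : nat) :
  exists Th : R -> R, Th (2 * PI) = Th 0 /\
    forall t, is_derive Th t (Re (circ r t ^ S j * peval l (circ r t))).
Proof.
  revert j; induction l as [|c l IH]; intro j.
  - exists (fun _ => 0). split; auto. intro t. replace (Re _) with 0. apply @is_derive_const.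
    simpl peval. rewrite Cmult_0_r. reflexivity.
  - destruct (IH (S j)) as [Th [H1 H2]]. remember (INR (S j)) as n eqn:En.
    assert (Hn : n <> 0) by (rewrite En; apply not_0_INR; lia).
    remember (r ^ S j) as rj eqn:Erj.
    exists (fun t => rj * (Re c * sin (n * t) + Im c * cos (n * t)) / n + Th t). split.
    + rewrite H1. f_equal. f_equal. f_equal.
      replace (n * (2 * PI)) with (0 + 2 * INR (S j) * PI) by (rewrite En; ring).
      rewrite sin_period, cos_period, Rmult_0_r. reflexivity.
    + intro t. evar_last. apply @is_derive_plus; [|apply H2].
      instantiate (1 := rj * (Re c * cos (n * t) - Im c * sin (n * t))).
      auto_derive; auto. field; auto.
      replace (circ r t ^ S j * peval (c :: l) (circ r t))%C with
        (circ r t ^ S j * c + circ r t ^ S (S j) * peval l (circ r t))%C.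
      2: { rewrite (Cpow_S _ (S j)). simpl peval. ring. }
      rewrite (circ_pow r t (S j)), <- En, <- Erj.
      generalize (circ r t ^ S (S j) * peval l (circ r t))%C. intros [X1 X2]. destruct c as [c1 c2].
      unfold plus; simpl AbelianMonoid.plus. eqR. unfold Re, Im, Cplus, Cmult; cbn [fst snd]. ring.
Qed.

(** The mean value theorem, applied to [Re c * t] plus the periodic primitive,
    provides a point of the circle where the real part of the polynomial is the
    real part of its constant term [c]. *)
Lemma poly_mean_re (l : list C) (r m : R) : 0 <= r ->
  (forall z, Cmod z = r -> Cmod (peval l z) <= m) -> Rabs (Re (peval l 0)) <= m.
Proof.
  intros Hr H. destruct l as [|c l].
  { simpl peval. simpl. rewrite Rabs_R0. specialize (H (circ r 0) (Cmod_circ r 0 Hr)). simpl peval in H.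
    rewrite Cmod_0 in H. exact H. }
  destruct (periodic_primitive r l 0) as [Th [H1 H2]].
  assert (Hd : forall t, is_derive (fun t => Re c * t + Th t) t (Re (peval (c :: l) (circ r t)))).
  { intro t. evar_last. apply @is_derive_plus; [|apply H2]. instantiate (1 := Re c). auto_derive; auto. ring.
    rewrite Cpow_1_r. change (peval (c :: l) (circ r t)) with (c + circ r t * peval l (circ r t))%C.
    reflexivity. }
  destruct (MVT_gen (fun t => Re c * t + Th t) 0 (2 * PI) (fun t => Re (peval (c :: l) (circ r t)))) as [x [_ Hx]].
  - intros t _. apply Hd.
  - intros t _. apply continuity_pt_filterlim. apply (ex_derive_cont (fun t => Re c * t + Th t)). eexists; apply Hd.
  - rewrite H1 in Hx. assert (HP := PI_RGT_0).
    assert (E : Re c = Re (peval (c :: l) (circ r x))).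
    { apply Rmult_eq_reg_r with (2 * PI); lra. }
    replace (Re (peval (c :: l) 0)) with (Re c). 2: { simpl peval. unfold Re; simpl. ring. }
    rewrite E. eapply Rle_trans. apply re_le_Cmod. apply H. now apply Cmod_circ.
Qed.

Lemma Cmod_le_re_im (z : C) : Cmod z <= Rabs (Re z) + Rabs (Im z).
Proof.
  replace z with (RtoC (Re z) + RtoC (Im z) * Ci)%C at 1.
  2: { destruct z; apply injective_projections; simpl; ring. }
  eapply Rle_trans. apply Cmod_triangle. rewrite Cmod_mult, Cmod_Ci, !Cmod_R. lra.
Qed.

Lemma poly_mean (l : list C) (r m : R) : 0 <= r ->
  (forall z, Cmod z = r -> Cmod (peval l z) <= m) -> Cmod (peval l 0) <= 2 * m.
Proof.
  intros Hr H. eapply Rle_trans. apply Cmod_le_re_im.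
  assert (H1 := poly_mean_re l r m Hr H).
  destruct (is_poly_scal (- Ci) (peval l)) as [l' Hl']. { exists l; auto. }
  assert (H2 : Rabs (Re (peval l' 0)) <= m).
  { apply (poly_mean_re l' r m Hr). intros z Hz. rewrite <- Hl', Cmod_mult, Cmod_opp, Cmod_Ci. specialize (H z Hz). lra. }
  rewrite <- Hl' in H2. replace (Re (- Ci * peval l 0)) with (Im (peval l 0)) in H2.
  lra. unfold Re, Im; simpl. ring.
Qed.

Lemma lim_geom_0 (K q : R) : 0 <= q < 1 -> is_lim_seq (fun n => K * q ^ n) 0.
Proof.
  intro Hq. replace (Finite 0) with (Finite (K * 0)) by (f_equal; ring).
  apply (is_lim_seq_scal_l _ _ 0). apply is_lim_seq_geom. rewrite Rabs_right; lra.
Qed.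

Lemma C_Series_tail (u : nat -> C) (K q : R) n : 0 <= q < 1 ->
  (forall n, Cmod (u n) <= K * q ^ n) -> Cmod (C_Series u - sum_n u n) <= 2 * K / (1 - q) * q ^ S n.
Proof.
  intros Hq Hb.
  assert (Hcomp : forall pr : C -> R, (forall w, Rabs (pr w) <= Cmod w) ->
    Rabs (Series (fun k => pr (u k)) - sum_n (fun k => pr (u k)) n) <= K * q ^ S n / (1 - q)).
  { intros pr Hpr.
    assert (Hpb : forall k, Rabs (pr (u k)) <= K * q ^ k) by (intro k; eapply Rle_trans; [apply Hpr|auto]).
    apply is_series_geom_tail; auto. apply Series_correct. now apply (ex_series_geom_dom _ K q). }
  assert (Hre : Re (sum_n u n) = sum_n (fun k => Re (u k)) n).
  { clear. induction n as [|n IH]. now rewrite !sum_O. rewrite !sum_Sn, <- IH. reflexivity. }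
  assert (Him : Im (sum_n u n) = sum_n (fun k => Im (u k)) n).
  { clear. induction n as [|n IH]. now rewrite !sum_O. rewrite !sum_Sn, <- IH. reflexivity. }
  assert (A1 := Hcomp Re re_le_Cmod). assert (A2 := Hcomp Im im_le_Cmod).
  rewrite <- Hre in A1. rewrite <- Him in A2.
  eapply Rle_trans. apply Cmod_le_re_im. eapply Rle_trans. apply Rplus_le_compat; [exact A1 | exact A2].
  right. field. lra.
Qed.

(** A function holomorphic near the disc of radius [r] is used only through its
    uniform approximations by polynomials there: they are enough for the bound
    [disc_mean] of the value at the centre. *)
Definition disc_alg (r : R) (F : C -> C) : Prop :=
  forall eta, 0 < eta -> exists p, is_poly p /\ forall z, Cmod z <= r -> Cmod (F z - p z) <= eta.

Section Disc.
Variable r : R.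
Hypothesis Hr : 0 <= r.

Lemma is_poly_disc F : is_poly F -> disc_alg r F.
Proof.
  intros HF eta He. exists F; split; auto. intros z _.
  replace (F z - F z)%C with (RtoC 0) by ring. rewrite Cmod_0. lra.
Qed.

Lemma disc_limit F : (forall eta, 0 < eta -> exists G, disc_alg r G /\ forall z, Cmod z <= r -> Cmod (F z - G z) <= eta) -> disc_alg r F.
Proof.
  intros H eta He. destruct (H (eta / 2)) as [G [HG H1]]. lra.
  destruct (HG (eta / 2)) as [p [Hp H2]]. lra. exists p; split; auto.
  intros z Hz. replace (F z - p z)%C with ((F z - G z) + (G z - p z))%C by ring.
  eapply Rle_trans. apply Cmod_triangle. specialize (H1 z Hz). specialize (H2 z Hz). lra.
Qed.

Lemma disc_ext F G : (forall z, Cmod z <= r -> F z = G z) -> disc_alg r F -> disc_alg r G.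
Proof.
  intros H HF eta He. destruct (HF eta He) as [p [Hp H1]]. exists p; split; auto.
  intros z Hz. rewrite <- H; auto.
Qed.

Lemma disc_plus F G : disc_alg r F -> disc_alg r G -> disc_alg r (fun z => F z + G z)%C.
Proof.
  intros HF HG eta He. destruct (HF (eta / 2)) as [p [Hp H1]]. lra.
  destruct (HG (eta / 2)) as [q [Hq H2]]. lra.
  exists (fun z => p z + q z)%C; split. now apply is_poly_plus.
  intros z Hz. replace (F z + G z - (p z + q z))%C with ((F z - p z) + (G z - q z))%C by ring.
  eapply Rle_trans. apply Cmod_triangle. specialize (H1 z Hz). specialize (H2 z Hz). lra.
Qed.

Lemma is_poly_bounded p : is_poly p -> exists B, 0 <= B /\ forall z, Cmod z <= r -> Cmod (p z) <= B.
Proof.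
  intros [l Hl]. assert (H : exists B, 0 <= B /\ forall z, Cmod z <= r -> Cmod (peval l z) <= B).
  { clear Hl. induction l as [|c l [B [HB IH]]].
    - exists 0. split. lra. intros z _. simpl peval. rewrite Cmod_0. lra.
    - exists (Cmod c + r * B). assert (H0 := Cmod_ge_0 c). split. nra. intros z Hz. simpl peval.
      eapply Rle_trans. apply Cmod_triangle. rewrite Cmod_mult.
      apply Rplus_le_compat_l. apply Rmult_le_compat; auto using Cmod_ge_0. }
  destruct H as [B [HB H]]. exists B; split; auto. intros z Hz. rewrite Hl. auto.
Qed.

Lemma disc_bounded F : disc_alg r F -> exists B, 0 <= B /\ forall z, Cmod z <= r -> Cmod (F z) <= B.
Proof.
  intros HF. destruct (HF 1) as [p [Hp H1]]. lra. destruct (is_poly_bounded p Hp) as [B [HB H2]].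
  exists (B + 1). split. lra. intros z Hz. replace (F z) with ((F z - p z) + p z)%C by ring.
  eapply Rle_trans. apply Cmod_triangle. specialize (H1 z Hz). specialize (H2 z Hz). lra.
Qed.

Lemma disc_mult F G : disc_alg r F -> disc_alg r G -> disc_alg r (fun z => F z * G z)%C.
Proof.
  intros HF HG eta He. destruct (disc_bounded F HF) as [B [HB HFB]].
  destruct (HG (eta / (2 * (B + 1)))) as [q [Hq H2]]. { apply Rdiv_lt_0_compat; lra. }
  destruct (is_poly_bounded q Hq) as [D [HD HqD]].
  destruct (HF (eta / (2 * (D + 1)))) as [p [Hp H1]]. { apply Rdiv_lt_0_compat; lra. }
  exists (fun z => p z * q z)%C; split. now apply is_poly_mult.
  intros z Hz. replace (F z * G z - p z * q z)%C with (F z * (G z - q z) + q z * (F z - p z))%C by ring.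
  eapply Rle_trans. apply Cmod_triangle. rewrite !Cmod_mult.
  assert (A1 : Cmod (F z) * Cmod (G z - q z) <= (B + 1) * (eta / (2 * (B + 1)))).
  { apply Rmult_le_compat; auto using Cmod_ge_0. specialize (HFB z Hz); lra. }
  assert (A2 : Cmod (q z) * Cmod (F z - p z) <= (D + 1) * (eta / (2 * (D + 1)))).
  { apply Rmult_le_compat; auto using Cmod_ge_0. specialize (HqD z Hz); lra. }
  replace ((B + 1) * (eta / (2 * (B + 1)))) with (eta / 2) in A1 by (field; lra).
  replace ((D + 1) * (eta / (2 * (D + 1)))) with (eta / 2) in A2 by (field; lra). lra.
Qed.

Lemma disc_const c : disc_alg r (fun _ => c).
Proof. apply is_poly_disc, is_poly_const. Qed.

Lemma disc_id : disc_alg r (fun z => z).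
Proof. apply is_poly_disc, is_poly_id. Qed.

Lemma disc_mean F m : disc_alg r F -> (forall z, Cmod z = r -> Cmod (F z) <= m) -> Cmod (F 0) <= 2 * m.
Proof.
  intros HF H. apply le_epsilon. intros eps Heps.
  destruct (HF (eps / 3)) as [p [[l Hl] H1]]. lra.
  assert (H2 : Cmod (peval l 0) <= 2 * (m + eps / 3)).
  { apply (poly_mean l r); auto. intros z Hz. rewrite <- Hl.
    replace (p z) with (F z + - (F z - p z))%C by ring. eapply Rle_trans. apply Cmod_triangle.
    rewrite Cmod_opp. specialize (H z Hz). specialize (H1 z ltac:(lra)). lra. }
  specialize (H1 0). rewrite Cmod_0 in H1. specialize (H1 Hr). rewrite <- Hl in H2.
  replace (F 0) with ((F 0 - p 0) + p 0)%C by ring. eapply Rle_trans. apply Cmod_triangle. lra.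
Qed.

Lemma disc_series (u : C -> nat -> C) (K q : R) : 0 <= q < 1 ->
  (forall n, disc_alg r (fun z => u z n)) ->
  (forall z n, Cmod z <= r -> Cmod (u z n) <= K * q ^ n) ->
  disc_alg r (fun z => C_Series (u z)).
Proof.
  intros Hq Hd Hb. apply disc_limit. intros eta He.
  destruct (is_lim_seq_0_small _ _ (lim_geom_0 (2 * K / (1 - q) * q) q Hq) He) as [N HN].
  specialize (HN N ltac:(lia)). exists (fun z => sum_n (u z) N). split.
  - clear HN. induction N as [|N IH].
    + apply (disc_ext (fun z => u z 0%nat)); auto. intros z _. now rewrite sum_O.
    + apply (disc_ext (fun z => sum_n (u z) N + u z (S N))%C). intros z _. now rewrite sum_Sn.
      now apply disc_plus.
  - intros z Hz. eapply Rle_trans. apply (C_Series_tail (u z) K q N Hq); auto.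
    apply Rlt_le. eapply Rle_lt_trans; [|exact HN]. eapply Rle_trans; [|apply Rle_abs].
    right. simpl. ring.
Qed.
End Disc.

(** * The complex exponential *)

(** [exp (t z)] for real [t]. *)
Definition cexp (z : C) (t : R) : C :=
  (exp (Re z * t) * cos (Im z * t), exp (Re z * t) * sin (Im z * t)).

(** The first [n] terms of the Taylor series of [exp (t z)]. *)
Fixpoint texp (z : C) (n : nat) (t : R) : C :=
  match n with
  | O => RtoC 0
  | S m => (texp z m t + RtoC (t ^ m / INR (fact m)) * z ^ m)%C
  end.

Lemma Cmod_cexp z t : Cmod (cexp z t) = exp (Re z * t).
Proof.
  unfold cexp, Cmod; simpl.
  replace (_ + _) with (exp (Re z * t) ^ 2 * (Rsqr (sin (Im z * t)) + Rsqr (cos (Im z * t)))) by (unfold Rsqr; ring).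
  rewrite sin2_cos2, Rmult_1_r. apply sqrt_pow2. left; apply exp_pos.
Qed.

Lemma is_derive_cexp z t : is_derive (fun t => Re (cexp z t)) t (Re (z * cexp z t)) /\
  is_derive (fun t => Im (cexp z t)) t (Im (z * cexp z t)).
Proof.
  destruct z as [a c]. unfold cexp, Re, Im, Cmult; cbn [fst snd]. split.
  - auto_derive; auto. ring.
  - auto_derive; auto. ring.
Qed.

Lemma is_derive_texp z n t : is_derive (fun t => Re (texp z (S n) t)) t (Re (z * texp z n t)) /\
  is_derive (fun t => Im (texp z (S n) t)) t (Im (z * texp z n t)).
Proof.
  assert (Hp : forall n, is_derive (fun t => t ^ S n / INR (fact (S n))) t (t ^ n / INR (fact n))).
  { intro m. assert (Hm := INR_fact_neq_0 m). assert (H1 : INR (S m) <> 0) by (apply not_0_INR; lia).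
    evar_last. unfold Rdiv. apply (is_derive_ext (fun t => / INR (fact (S m)) * t ^ S m)).
    { intro s; eqR; ring. } apply is_derive_scal. apply is_derive_pow_S.
    rewrite fact_simpl, mult_INR. remember (INR (S m)) as N. simpl. eqR. field. auto. }
  induction n as [|n [IH1 IH2]].
  - change (texp z 0 t) with (RtoC 0). rewrite Cmult_0_r. split.
    + apply (is_derive_ext (fun _ => Re (texp z 1 0))). intro s; reflexivity. apply @is_derive_const.
    + apply (is_derive_ext (fun _ => Im (texp z 1 0))). intro s; reflexivity. apply @is_derive_const.
  - change (texp z (S n) t) with (texp z n t + RtoC (t ^ n / INR (fact n)) * z ^ n)%C.
    destruct (z ^ S n)%C as [b1 b2] eqn:Eb.
    assert (Ez : (z * (texp z n t + RtoC (t ^ n / INR (fact n)) * z ^ n) =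
       z * texp z n t + RtoC (t ^ n / INR (fact n)) * (b1, b2))%C).
    { rewrite <- Eb, Cpow_S. ring. }
    rewrite Ez. split.
    + apply (is_derive_ext (fun t => Re (texp z (S n) t) + t ^ S n / INR (fact (S n)) * b1)).
      { intro s. change (texp z (S (S n)) s) with (texp z (S n) s + RtoC (s ^ S n / INR (fact (S n))) * z ^ S n)%C.
        rewrite Eb. generalize (texp z (S n) s). intros [u1 u2]. unfold Re, Cplus, Cmult, RtoC; cbn [fst snd]. eqR. ring. }
      evar_last. apply @is_derive_plus. exact IH1.
      apply (is_derive_ext (fun t => b1 * (t ^ S n / INR (fact (S n))))). { intro s; eqR; ring. }
      apply is_derive_scal. apply Hp. generalize (z * texp z n t)%C. intros [u1 u2].
      unfold plus; simpl AbelianMonoid.plus; unfold Re, Cplus, Cmult, RtoC; cbn [fst snd]. eqR. ring.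
    + apply (is_derive_ext (fun t => Im (texp z (S n) t) + t ^ S n / INR (fact (S n)) * b2)).
      { intro s. change (texp z (S (S n)) s) with (texp z (S n) s + RtoC (s ^ S n / INR (fact (S n))) * z ^ S n)%C.
        rewrite Eb. generalize (texp z (S n) s). intros [u1 u2]. unfold Im, Cplus, Cmult, RtoC; cbn [fst snd]. eqR. ring. }
      evar_last. apply @is_derive_plus. exact IH2.
      apply (is_derive_ext (fun t => b2 * (t ^ S n / INR (fact (S n))))). { intro s; eqR; ring. }
      apply is_derive_scal. apply Hp. generalize (z * texp z n t)%C. intros [u1 u2].
      unfold plus; simpl AbelianMonoid.plus; unfold Im, Cplus, Cmult, RtoC; cbn [fst snd]. eqR. ring.
Qed.

Lemma abs_le_of_derive (g dg : R -> R) (A T : R) (n : nat) : 0 <= T -> g 0 = 0 ->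
  (forall t, is_derive g t (dg t)) -> (forall t, 0 <= t <= T -> Rabs (dg t) <= A * t ^ n) ->
  Rabs (g T) <= A * T ^ S n / INR (S n).
Proof.
  intros HT H0 Hd Hb. assert (HN : INR (S n) <> 0) by (apply not_0_INR; lia).
  remember (INR (S n)) as N.
  assert (Hm : forall t, is_derive (fun t => A * t ^ S n / N) t (A * t ^ n)).
  { intro t. evar_last. apply (is_derive_ext (fun t => A / N * t ^ S n)). { intro s; eqR; field; auto. }
    apply is_derive_scal. apply is_derive_pow_S. rewrite <- HeqN. eqR. simpl. field. auto. }
  assert (Hc : forall (f df : R -> R) x, (forall t, is_derive f t (df t)) -> continuous f x).
  { intros f df x Hf. apply ex_derive_cont. eexists; apply Hf. }
  assert (D1 : forall t, is_derive (fun t => g t - A * t ^ S n / N) t (dg t - A * t ^ n)).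
  { intro t. apply (is_derive_minus g); auto. }
  assert (D2 : forall t, is_derive (fun t => - g t - A * t ^ S n / N) t (- dg t - A * t ^ n)).
  { intro t. apply (is_derive_minus (fun t => - g t)); auto. now apply (is_derive_opp g). }
  assert (Z : A * 0 ^ S n / N = 0) by (rewrite pow_i by lia; field; auto).
  apply Rabs_le. split.
  - assert (H := nonincr_of_derive _ _ 0 T HT (fun x _ => Hc _ _ x D2) (fun x _ => D2 x)).
    cbv beta in H. rewrite Z, H0 in H. lapply H. lra. intros x Hx. specialize (Hb x ltac:(lra)).
    apply Rabs_le_between in Hb. lra.
  - assert (H := nonincr_of_derive _ _ 0 T HT (fun x _ => Hc _ _ x D1) (fun x _ => D1 x)).
    cbv beta in H. rewrite Z, H0 in H. lapply H. lra. intros x Hx. specialize (Hb x ltac:(lra)).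
    apply Rabs_le_between in Hb. lra.
Qed.

(** The derivative in [t] of each remainder is [z] times the previous remainder.
    The factor 2 comes from treating real and imaginary parts separately. *)
Lemma cexp_texp_bound z r T n : 0 <= T -> Cmod z <= r -> forall t, 0 <= t <= T ->
  Cmod (cexp z t - texp z n t) <= exp (r * T) * ((2 * r * t) ^ n / INR (fact n)).
Proof.
  intros HT Hz. assert (Hr : 0 <= r) by (eapply Rle_trans; [apply Cmod_ge_0|eauto]).
  set (B := exp (r * T)). assert (HB : 0 < B) by apply exp_pos.
  induction n as [|n IH]; intros t Ht.
  - simpl texp. replace (cexp z t - 0)%C with (cexp z t) by ring. rewrite Cmod_cexp.
    simpl pow. simpl fact. change (INR 1) with 1. replace (B * (1 / 1)) with B by field.
    unfold B. assert (Re z <= r). { eapply Rle_trans; [apply Rle_abs|]. eapply Rle_trans; [apply re_le_Cmod|]; auto. }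
    assert (Re z * t <= r * T) by nra.
    destruct (Req_dec (Re z * t) (r * T)) as [->|Hn]. lra. left. apply exp_increasing. lra.
  - eapply Rle_trans. apply Cmod_le_re_im.
    assert (Fn := fact_pos n). assert (Sn : 0 < INR (S n)) by (apply lt_0_INR; lia).
    set (A := B * r * (2 * r) ^ n / INR (fact n)).
    assert (HA : forall s, 0 <= s <= t -> Cmod (z * cexp z s - z * texp z n s) <= A * s ^ n).
    { intros s Hs. replace (z * cexp z s - z * texp z n s)%C with (z * (cexp z s - texp z n s))%C by ring.
      rewrite Cmod_mult. apply Rle_trans with (r * (B * ((2 * r * s) ^ n / INR (fact n)))).
      apply Rmult_le_compat; auto using Cmod_ge_0. apply IH; lra.
      right. unfold A. rewrite (Rpow_mult_distr (2 * r) s n). field. lra. }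
    assert (H0 : (cexp z 0 - texp z (S n) 0 = 0)%C).
    { assert (E1 : cexp z 0 = RtoC 1). { unfold cexp. rewrite !Rmult_0_r, exp_0, cos_0, sin_0. apply injective_projections; simpl; ring. }
      assert (E2 : forall m, texp z (S m) 0 = RtoC 1).
      { induction m as [|m IHm]. simpl. apply injective_projections; simpl; field.
        change (texp z (S (S m)) 0) with (texp z (S m) 0 + RtoC (0 ^ S m / INR (fact (S m))) * z ^ S m)%C.
        rewrite IHm, pow_i by lia. unfold Rdiv. rewrite Rmult_0_l. ring. }
      rewrite E1, E2. ring. }
    assert (A1 : Rabs (Re (cexp z t - texp z (S n) t)) <= A * t ^ S n / INR (S n)).
    { apply (abs_le_of_derive (fun t => Re (cexp z t - texp z (S n) t)) (fun s => Re (z * cexp z s - z * texp z n s))).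
      lra. now rewrite H0.
      - intro s. apply (is_derive_minus (fun t => Re (cexp z t)) (fun t => Re (texp z (S n) t)) s).
        apply is_derive_cexp. apply is_derive_texp.
      - intros s Hs. eapply Rle_trans. apply re_le_Cmod. auto. }
    assert (A2 : Rabs (Im (cexp z t - texp z (S n) t)) <= A * t ^ S n / INR (S n)).
    { apply (abs_le_of_derive (fun t => Im (cexp z t - texp z (S n) t)) (fun s => Im (z * cexp z s - z * texp z n s))).
      lra. now rewrite H0.
      - intro s. apply (is_derive_minus (fun t => Im (cexp z t)) (fun t => Im (texp z (S n) t)) s).
        apply is_derive_cexp. apply is_derive_texp.
      - intros s Hs. eapply Rle_trans. apply im_le_Cmod. auto. }
    eapply Rle_trans. apply Rplus_le_compat; [exact A1 | exact A2]. right.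
    unfold A. rewrite fact_simpl, mult_INR. rewrite (Rpow_mult_distr (2 * r) t (S n)).
    remember (INR (S n)) as N. simpl pow. field. lra.
Qed.

Lemma is_poly_texp c n t : is_poly (fun z => texp (c * z) n t).
Proof.
  induction n as [|n IH]. exact (is_poly_const 0).
  apply (is_poly_plus (fun z => texp (c * z) n t)); auto. apply is_poly_scal.
  apply (is_poly_ext (fun z => c ^ n * z ^ n)%C). intro z. now rewrite Cpow_mult_l.
  apply is_poly_scal, is_poly_pow.
Qed.

Lemma is_lim_pow_fact (x : R) : is_lim_seq (fun n => x ^ n / INR (fact n)) 0.
Proof. apply ex_series_lim_0, ex_series_exp. Qed.

Lemma disc_cexp r t : 0 <= r -> 0 <= t -> disc_alg r (fun z => cexp z t).
Proof.
  intros Hr Ht eta He.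
  assert (Hl : is_lim_seq (fun n => exp (r * t) * ((2 * r * t) ^ n / INR (fact n))) 0).
  { replace (Finite 0) with (Finite (exp (r * t) * 0)) by (f_equal; ring). apply (is_lim_seq_scal_l _ _ 0), is_lim_pow_fact. }
  destruct (is_lim_seq_0_small _ _ Hl He) as [N HN]. specialize (HN N ltac:(lia)). exists (fun z => texp z N t). split.
  - apply (is_poly_ext (fun z => texp (1 * z) N t)). intro z. now rewrite Cmult_1_l. apply is_poly_texp.
  - intros z Hz. eapply Rle_trans. apply (cexp_texp_bound z r t); auto; lra.
    eapply Rle_trans; [apply Rle_abs|]. now left.
Qed.

(** * The Tauberian theorem of Fatou and Riesz *)

Definition RIntC (h : R -> R) (w : R -> C) (T : R) : C :=
  (RInt (fun t => h t * Re (w t)) 0 T, RInt (fun t => h t * Im (w t)) 0 T).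

Definition laplace_trunc (h : R -> R) (T : R) (z : C) : C := RIntC h (cexp (- z)) T.

Lemma continuous_cexp z t : continuous (fun t => Re (cexp z t)) t /\ continuous (fun t => Im (cexp z t)) t.
Proof.
  destruct (is_derive_cexp z t) as [H1 H2]. split.
  - exact (ex_derive_cont _ _ (ex_intro _ _ H1)).
  - exact (ex_derive_cont _ _ (ex_intro _ _ H2)).
Qed.

Lemma continuous_texp z n t : continuous (fun t => Re (texp z n t)) t /\ continuous (fun t => Im (texp z n t)) t.
Proof.
  destruct n as [|n]. split; apply continuous_const.
  destruct (is_derive_texp z n t) as [H1 H2]. split.
  - exact (ex_derive_cont _ _ (ex_intro _ _ H1)).
  - exact (ex_derive_cont _ _ (ex_intro _ _ H2)).
Qed.

Lemma is_poly_RInt_texp (h : R -> R) T n : (forall x, continuous h x) ->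
  is_poly (fun z => RIntC h (texp (- z) n) T).
Proof.
  intro Hh. induction n as [|n IH].
  - apply (is_poly_ext (fun _ => RtoC 0)); [|apply is_poly_const]. intro z.
    apply injective_projections; simpl.
    + rewrite (RInt_ext _ (fun _ => 0)). now rewrite RInt_const, Rmult_0_r. intros; now rewrite Rmult_0_r.
    + rewrite (RInt_ext _ (fun _ => 0)). now rewrite RInt_const, Rmult_0_r. intros; now rewrite Rmult_0_r.
  - set (m := RInt (fun t => h t * (t ^ n / INR (fact n))) 0 T).
    apply (is_poly_ext (fun z => RIntC h (texp (- z) n) T
         + (RtoC m * (- (1)) ^ n) * z ^ n)%C).
    2: { apply is_poly_plus; auto. apply is_poly_scal, is_poly_pow. }
    intro z. replace (RtoC m * (- (1)) ^ n * z ^ n)%C with (RtoC m * (- z) ^ n)%C.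
    2: { replace (- z)%C with (- (1) * z)%C by ring. rewrite Cpow_mult_l. ring. }
    change (texp (- z) (S n)) with (fun t => texp (- z) n t + RtoC (t ^ n / INR (fact n)) * (- z) ^ n)%C.
    generalize ((- z) ^ n)%C. intros [b1 b2].
    assert (H : forall (F : R -> R) b, (forall x, continuous F x) ->
       RInt (fun t => h t * F t + b * (h t * (t ^ n / INR (fact n)))) 0 T = RInt (fun t => h t * F t) 0 T + b * m).
    { intros F b HF. apply is_RInt_unique.
      apply (@is_RInt_plus R_NormedModule (fun t => h t * F t)). apply is_RInt_cont. intro x; now apply (continuous_mult h F).
      apply (@is_RInt_scal R_NormedModule (fun t => h t * (t ^ n / INR (fact n)))). apply is_RInt_cont.
      intro x; apply (continuous_mult h); auto. apply ex_derive_cont.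
      auto_derive; auto. }
    apply injective_projections; unfold RIntC, Cplus, Cmult, RtoC; cbn [fst snd].
    + transitivity (RInt (fun t => h t * Re (texp (- z) n t)) 0 T + b1 * m)%R. ring.
      rewrite <- H. 2: { intro x; apply continuous_texp. } apply RInt_ext. intros t _. unfold Re; cbn [fst snd]. eqR. ring.
    + transitivity (RInt (fun t => h t * Im (texp (- z) n t)) 0 T + b2 * m)%R. ring.
      rewrite <- H. 2: { intro x; apply continuous_texp. } apply RInt_ext. intros t _. unfold Im; cbn [fst snd]. eqR. ring.
Qed.

Lemma RInt_mult_le (h F G : R -> R) T B d : 0 <= T -> (forall x, continuous h x) -> (forall x, continuous F x) ->
  (forall x, continuous G x) -> (forall t, 0 <= t <= T -> Rabs (h t) <= B) ->
  (forall t, 0 <= t <= T -> Rabs (F t - G t) <= d) -> 0 <= B ->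
  Rabs (RInt (fun t => h t * F t) 0 T - RInt (fun t => h t * G t) 0 T) <= T * (B * d).
Proof.
  intros HT Hh HF HG Hb Hd HB.
  assert (Hc1 : forall x, continuous (fun t => h t * F t) x) by (intro x; now apply (continuous_mult h F)).
  assert (Hc2 : forall x, continuous (fun t => h t * G t) x) by (intro x; now apply (continuous_mult h G)).
  replace (T * (B * d)) with ((T - 0) * (B * d)) by ring.
  apply (@norm_RInt_le_const R_NormedModule (fun t => h t * F t - h t * G t) 0 T); auto.
  - intros t Ht. change (Rabs (h t * F t - h t * G t) <= B * d).
    replace (h t * F t - h t * G t) with (h t * (F t - G t)) by ring.
    rewrite Rabs_mult. apply Rmult_le_compat; auto using Rabs_pos.
  - apply (@is_RInt_minus R_NormedModule (fun t => h t * F t) (fun t => h t * G t)); now apply is_RInt_cont.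
Qed.

(** Integrating the Taylor polynomials of the exponential against [h] gives
    polynomials in [z]. *)
Lemma disc_laplace_trunc (h : R -> R) r T B : 0 <= r -> 0 <= T -> exp_growth B 0 h -> disc_alg r (laplace_trunc h T).
Proof.
  intros Hr HT [Hh HhB] eta He.
  assert (HB : forall t, 0 <= t <= T -> Rabs (h t) <= B).
  { intros t Ht. specialize (HhB t ltac:(lra)). rewrite Rmult_0_l, exp_0 in HhB. lra. }
  assert (HB0 : 0 <= B) by (eapply exp_growth_A_ge0; split; eauto).
  assert (Hl : is_lim_seq (fun n => 2 * T * B * exp (r * T) * ((2 * r * T) ^ n / INR (fact n))) 0).
  { replace (Finite 0) with (Finite (2 * T * B * exp (r * T) * 0)) by (f_equal; ring).
    apply (is_lim_seq_scal_l _ _ 0), is_lim_pow_fact. }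
  destruct (is_lim_seq_0_small _ _ Hl He) as [N HN]. specialize (HN N ltac:(lia)).
  eexists; split. apply (is_poly_RInt_texp h T N Hh).
  intros z Hz. set (d := exp (r * T) * ((2 * r * T) ^ N / INR (fact N))) in *.
  assert (Hd : forall t, 0 <= t <= T -> Cmod (cexp (- z) t - texp (- z) N t) <= d).
  { intros t Ht. eapply Rle_trans. apply (cexp_texp_bound (- z) r T N); auto. now rewrite Cmod_opp.
    apply Rmult_le_compat_l. left; apply exp_pos. apply Rmult_le_compat_r.
    apply inv_ge0, fact_pos. apply pow_incr. split; nra. }
  assert (A1 : Rabs (RInt (fun t => h t * Re (cexp (- z) t)) 0 T - RInt (fun t => h t * Re (texp (- z) N t)) 0 T) <= T * (B * d)).
  { apply RInt_mult_le; auto; try (intro x; apply continuous_cexp || apply continuous_texp).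
    intros t Ht. eapply Rle_trans; [|apply (Hd t Ht)].
    apply (re_le_Cmod (cexp (- z) t - texp (- z) N t)). }
  assert (A2 : Rabs (RInt (fun t => h t * Im (cexp (- z) t)) 0 T - RInt (fun t => h t * Im (texp (- z) N t)) 0 T) <= T * (B * d)).
  { apply RInt_mult_le; auto; try (intro x; apply continuous_cexp || apply continuous_texp).
    intros t Ht. eapply Rle_trans; [|apply (Hd t Ht)].
    apply (im_le_Cmod (cexp (- z) t - texp (- z) N t)). }
  eapply Rle_trans. apply Cmod_le_re_im.
  eapply Rle_trans. apply Rplus_le_compat; [exact A1 | exact A2].
  apply Rlt_le. eapply Rle_lt_trans; [|exact HN]. eapply Rle_trans; [|apply Rle_abs].
  right. unfold d; ring.
Qed.

(** On the circle [z ^ 2 + r ^ 2 = 2 Re z * z]. *)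
Lemma circle_factor (z : C) (r : R) : 0 < r -> Cmod z = r ->
  Cmod (1 + RtoC (/ r ^ 2) * (z * z)) = 2 * Rabs (Re z) / r.
Proof.
  intros Hr Hz. assert (H := Cmod2_alt z). rewrite Hz in H.
  replace (1 + RtoC (/ r ^ 2) * (z * z))%C with (RtoC (2 * Re z / r ^ 2) * z)%C.
  - rewrite Cmod_mult, Cmod_R, Hz. unfold Rdiv. rewrite !Rabs_mult, (Rabs_right 2), (Rabs_right (/ r ^ 2)).
    field. lra. left. apply Rinv_0_lt_compat, pow_lt; auto. lra.
  - destruct z as [x y]. simpl Re in *; simpl Im in *.
    apply injective_projections; unfold Cplus, Cmult, RtoC; cbn [fst snd].
    + assert (H2 : 2 * x * x = r ^ 2 + (x * x - y * y)) by (rewrite H; ring).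
      transitivity ((2 * x * x) / r ^ 2). field; lra. rewrite H2. field. lra.
    + field. lra.
Qed.

Lemma mul_exp_neg_le (x s : R) : 0 <= x -> 0 < s -> x * exp (- (x * s)) <= / s.
Proof.
  intros Hx Hs. apply Rmult_le_reg_r with (s * exp (x * s)). apply Rmult_lt_0_compat; auto using exp_pos.
  rewrite exp_Ropp. assert (He := exp_pos (x * s)).
  replace (x * / exp (x * s) * (s * exp (x * s))) with (x * s) by (field; lra).
  replace (/ s * (s * exp (x * s))) with (exp (x * s)) by (field; lra).
  generalize (exp_ineq1_le (x * s)). lra.
Qed.

(** Newman's contour argument, on a circle centred at 0. The factor
    [1 + z ^ 2 / r ^ 2] is of size [2 |Re z| / r] on the circle: it absorbs the
    singularity [1 / Re z] of the trivial bounds for the tail (on the right) and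
    for the truncated integral (on the left), and since [h] tends to 0 these
    bounds tend to 0 uniformly on the circle, hence also at the centre. *)
Lemma fatou_riesz (h : R -> R) (B r : R) (F : C -> C) :
  0 < r -> exp_growth B 0 h -> is_lim h p_infty 0 -> disc_alg r F ->
  (forall z, 0 < Re z -> Cmod z <= r ->
     F z = (LI (fun t => h t * Re (cexp (- z) t)), LI (fun t => h t * Im (cexp (- z) t)))) ->
  is_lim (fun T => RInt h 0 T) p_infty (Re (F 0)).
Proof.
  intros Hr Hh Hlim HF HL. assert (HB : 0 <= B) by (eapply exp_growth_A_ge0; eauto).
  destruct (disc_bounded r (Rlt_le _ _ Hr) F HF) as [CF [HCF HFb]].
  apply is_lim_spec. intro eps. assert (Heps := cond_pos eps).
  (* The circle bound below is 6 eta / r, and the value at the centre is at most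
     twice that. *)
  set (eta := eps * r / 24). assert (Heta : 0 < eta) by (unfold eta; nra).
  apply is_lim_spec in Hlim. destruct (Hlim (mkposreal _ Heta)) as [T00 HT00].
  set (T0 := Rabs T00 + 1). assert (HT0 : 0 < T0) by (unfold T0; generalize (Rabs_pos T00); lra).
  assert (Hsmall : forall t, T0 <= t -> Rabs (h t) <= eta).
  { intros t Ht. left. rewrite <- (Rminus_0_r (h t)). apply (HT00 t). unfold T0 in Ht. generalize (Rle_abs T00). lra. }
  assert (Hbd : forall t, 0 <= t -> Rabs (h t) <= B).
  { intros t Ht. destruct Hh as [_ H]. specialize (H t Ht). rewrite Rmult_0_l, exp_0 in H. lra. }
  (* Up to the factor 2 / r, this is what F and the integral over [0, T0]
     contribute, multiplied by T - T0. *)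
  set (D := CF + 2 * T0 * B). assert (HD : 0 <= D) by (unfold D; nra).
  exists (T0 + D / eta + 1). intros T HT.
  assert (HDe : 0 <= D / eta) by (apply Rmult_le_pos; auto; now apply inv_ge0).
  assert (HTT : 0 < T - T0) by lra.
  set (Phi := fun z => ((F z + (- (1)) * laplace_trunc h T z) * (cexp z T * (1 + RtoC (/ r ^ 2) * (z * z))))%C).
  assert (HPhi : disc_alg r Phi).
  { assert (Hr0 : 0 <= r) by lra.
    apply disc_mult; auto.
    - apply disc_plus; auto. apply disc_mult; auto. now apply disc_const. apply (disc_laplace_trunc h r T B); auto; lra.
    - apply disc_mult; auto. apply disc_cexp; lra.
      apply disc_plus; auto. now apply disc_const.
      apply disc_mult; auto. now apply disc_const. apply disc_mult; auto; now apply disc_id. }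
  assert (Hcomp : forall z t, Rabs (Re (cexp z t)) <= exp (Re z * t) /\ Rabs (Im (cexp z t)) <= exp (Re z * t)).
  { intros z t. rewrite <- Cmod_cexp. split. apply re_le_Cmod. apply im_le_Cmod. }
  assert (Hcirc : forall z, Cmod z = r -> Cmod (Phi z) <= 6 * eta / r).
  { intros z Hz. unfold Phi. rewrite !Cmod_mult, circle_factor, Cmod_cexp by auto.
    assert (Htr : forall w : C, Cmod w <= Rabs (Re w) + Rabs (Im w)) by apply Cmod_le_re_im.
    destruct (Rlt_le_dec 0 (Re z)) as [Hx|Hx].
    - (* the difference is the tail of the integral *)
      set (x := Re z) in *.
      assert (Htail : forall pr : C -> R, (forall t, continuous (fun t => pr (cexp (- z) t)) t) ->
         (forall t, Rabs (pr (cexp (- z) t)) <= exp (- x * t)) ->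
         Rabs (LI (fun t => h t * pr (cexp (- z) t)) - RInt (fun t => h t * pr (cexp (- z) t)) 0 T) <= eta / x * exp (- x * T)).
      { intros pr Hc Hp.
        assert (Hg : exp_growth B (- x) (fun t => h t * pr (cexp (- z) t))).
        { split. intro t. apply (continuous_mult h (fun t => pr (cexp (- z) t))). apply Hh. apply Hc.
          intros t Ht. rewrite Rabs_mult. apply Rmult_le_compat; auto using Rabs_pos. }
        apply (LI_tail _ B x eta T); auto; try lra.
        intros t Ht. rewrite Rabs_mult. apply Rmult_le_compat; auto using Rabs_pos. apply Hsmall. lra. }
      assert (A1 := Htail Re (fun t => proj1 (continuous_cexp _ t)) (fun t => proj1 (Hcomp (- z)%C t))).
      assert (A2 := Htail Im (fun t => proj2 (continuous_cexp _ t)) (fun t => proj2 (Hcomp (- z)%C t))).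
      rewrite HL; auto. 2: lra.
      assert (Hdiff : Cmod ((LI (fun t => h t * Re (cexp (- z) t)), LI (fun t => h t * Im (cexp (- z) t))) + - (1) * laplace_trunc h T z)
          <= 2 * (eta / x * exp (- x * T))).
      { eapply Rle_trans. apply Htr. rewrite <- Rplus_diag. apply Rplus_le_compat.
        - eapply Rle_trans; [|exact A1]. right. f_equal. unfold laplace_trunc, RIntC. simpl. ring.
        - eapply Rle_trans; [|exact A2]. right. f_equal. unfold laplace_trunc, RIntC. simpl. ring. }
      apply Rle_trans with (2 * (eta / x * exp (- x * T)) * (exp (x * T) * (2 * Rabs x / r))).
      apply Rmult_le_compat_r; auto.
      { apply Rmult_le_pos. left; apply exp_pos. apply Rmult_le_pos. generalize (Rabs_pos x); lra. now apply inv_ge0. }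
      rewrite (Rabs_right x) by lra.
      replace (- x * T) with (- (x * T)) by ring. rewrite exp_Ropp.
      assert (He := exp_pos (x * T)).
      replace (2 * (eta / x * / exp (x * T)) * (exp (x * T) * (2 * x / r))) with (4 * eta / r) by (field; lra).
      unfold Rdiv. apply Rmult_le_compat_r. now apply inv_ge0. lra.
    - (* here the weight exp (T z) is small, and both terms are bounded separately *)
      set (xi := - Re z). assert (Hxi : 0 <= xi) by (unfold xi; lra).
      replace (Re z) with (- xi) by (unfold xi; ring). rewrite Rabs_Ropp, (Rabs_right xi) by lra.
      destruct (Req_dec xi 0) as [E0|Hn0].
      { rewrite E0. replace (2 * 0 / r) with 0 by (field; lra). rewrite !Rmult_0_r.
        apply Rmult_le_pos. lra. now apply inv_ge0. }
      assert (Hpos : 0 < xi) by lra.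
      assert (Htrunc : forall pr : C -> R, (forall t, continuous (fun t => pr (cexp (- z) t)) t) ->
         (forall t, Rabs (pr (cexp (- z) t)) <= exp (xi * t)) ->
         Rabs (RInt (fun t => h t * pr (cexp (- z) t)) 0 T) <= T0 * (B * exp (xi * T0)) + eta / xi * exp (xi * T)).
      { intros pr Hc Hp.
        assert (Hgc : forall t, continuous (fun t => h t * pr (cexp (- z) t)) t).
        { intro t. apply (continuous_mult h (fun t => pr (cexp (- z) t))). apply Hh. apply Hc. }
        set (w := fun t => h t * pr (cexp (- z) t)) in *. rewrite (RInt_split w 0 T0 T Hgc). eapply Rle_trans. apply Rabs_triang. apply Rplus_le_compat.
        - replace (T0 * (B * exp (xi * T0))) with ((T0 - 0) * (B * exp (xi * T0))) by ring.
          apply (@norm_RInt_le_const R_NormedModule (fun t => h t * pr (cexp (- z) t)) 0 T0). lra.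
          + intros t Ht. change (Rabs (h t * pr (cexp (- z) t)) <= B * exp (xi * T0)). rewrite Rabs_mult.
            apply Rmult_le_compat; auto using Rabs_pos. apply Hbd; lra.
            eapply Rle_trans. apply Hp. destruct (Req_dec t T0) as [->|Hne]. lra. left. apply exp_increasing. nra.
          + now apply is_RInt_cont.
        - eapply Rle_trans. apply (RInt_exp_bound _ eta (- xi) T0 T); auto; try lra.
          + intros t Ht. unfold w; rewrite Rabs_mult. apply Rmult_le_compat; auto using Rabs_pos. apply Hsmall; lra.
            rewrite Ropp_involutive. apply Hp.
          + rewrite Ropp_involutive. replace (eta / - xi * (exp (xi * T0) - exp (xi * T)))
              with (eta / xi * exp (xi * T) - eta / xi * exp (xi * T0)) by (field; lra).
            assert (0 <= eta / xi * exp (xi * T0)). { apply Rmult_le_pos. apply Rmult_le_pos. lra. now apply inv_ge0. left; apply exp_pos. }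
            lra. }
      assert (Hcomp' : forall t, Rabs (Re (cexp (- z) t)) <= exp (xi * t) /\ Rabs (Im (cexp (- z) t)) <= exp (xi * t)).
      { intro t. exact (Hcomp (- z)%C t). }
      assert (A1 := Htrunc Re (fun t => proj1 (continuous_cexp _ t)) (fun t => proj1 (Hcomp' t))).
      assert (A2 := Htrunc Im (fun t => proj2 (continuous_cexp _ t)) (fun t => proj2 (Hcomp' t))).
      assert (Hsum : Cmod (F z + - (1) * laplace_trunc h T z) <= CF + 2 * (T0 * (B * exp (xi * T0)) + eta / xi * exp (xi * T))).
      { eapply Rle_trans. apply Cmod_triangle. rewrite Cmod_mult, Cmod_m1, Rmult_1_l.
        apply Rplus_le_compat. apply HFb; lra. eapply Rle_trans. apply Htr.
        rewrite <- Rplus_diag. apply Rplus_le_compat; [exact A1 | exact A2]. }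
      apply Rle_trans with ((CF + 2 * (T0 * (B * exp (xi * T0)) + eta / xi * exp (xi * T))) * (exp (- xi * T) * (2 * xi / r))).
      apply Rmult_le_compat_r; auto.
      { apply Rmult_le_pos. left; apply exp_pos. apply Rmult_le_pos. lra. now apply inv_ge0. }
      assert (E1 : exp (xi * T) * exp (- xi * T) = 1). { rewrite <- exp_plus, <- exp_0. f_equal; ring. }
      assert (E2 : exp (xi * T0) * exp (- xi * T) = exp (- (xi * (T - T0)))). { rewrite <- exp_plus. f_equal; ring. }
      replace ((CF + 2 * (T0 * (B * exp (xi * T0)) + eta / xi * exp (xi * T))) * (exp (- xi * T) * (2 * xi / r)))
       with (2 / r * (CF * (xi * exp (- xi * T)) + 2 * T0 * B * (xi * (exp (xi * T0) * exp (- xi * T))) + 2 * eta * (exp (xi * T) * exp (- xi * T)))) by (field; lra).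
      rewrite E1, E2.
      assert (M1 := mul_exp_neg_le xi (T - T0) Hxi HTT).
      assert (M2 : xi * exp (- xi * T) <= / (T - T0)).
      { eapply Rle_trans; [|exact M1]. apply Rmult_le_compat_l; auto. replace (- xi * T) with (- (xi * T)) by ring.
        left. apply exp_increasing. nra. }
      assert (M3 : D * / (T - T0) <= eta).
      { apply Rmult_le_reg_r with (T - T0); auto. rewrite Rmult_assoc, Rinv_l, Rmult_1_r by lra.
        assert (D = eta * (D / eta)) by (field; lra). nra. }
      assert (M4 : CF * (xi * exp (- xi * T)) + 2 * T0 * B * (xi * exp (- (xi * (T - T0)))) <= eta).
      { eapply Rle_trans; [|exact M3]. unfold D. rewrite Rmult_plus_distr_r.
        apply Rplus_le_compat; apply Rmult_le_compat_l; auto. nra. }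
      replace (6 * eta / r) with (2 / r * (3 * eta)) by (field; lra).
      apply Rmult_le_compat_l. left. apply Rdiv_lt_0_compat; lra. lra. }
  assert (H := disc_mean r (Rlt_le _ _ Hr) Phi _ HPhi Hcirc).
  assert (E0 : Re (Phi 0) = Re (F 0) - RInt h 0 T).
  { assert (Ec : forall t, cexp (- 0) t = RtoC 1).
    { intro t. unfold cexp. simpl. rewrite Ropp_0, !Rmult_0_l, exp_0, cos_0, sin_0. apply injective_projections; simpl; ring. }
    assert (Ec0 : cexp 0 T = RtoC 1). { rewrite <- (Ec T). f_equal. ring. }
    unfold Phi. rewrite Ec0. replace (_ * (1 * _))%C with (F 0 + - (1) * laplace_trunc h T 0)%C by ring.
    unfold laplace_trunc, RIntC. replace (RInt (fun t => h t * Re (cexp (- 0) t)) 0 T) with (RInt h 0 T).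
    unfold Re, Cplus, Cmult, Copp, RtoC; cbn [fst snd]. ring.
    apply RInt_ext. intros t _. rewrite Ec. simpl. eqR. ring. }
  rewrite Rabs_minus_sym, <- E0. eapply Rle_lt_trans. apply re_le_Cmod. eapply Rle_lt_trans. exact H.
  replace (2 * (6 * eta / r)) with (eps / 2) by (unfold eta; field; lra). lra.
Qed.

(** * Continuation of the Bessel moments to a disc *)

Fixpoint newton (n : nat) (z : C) : C :=
  match n with
  | O => RtoC 1
  | S m => (newton m z + RtoC (1 / 2) * (1 + RtoC (-1) * ((1 + z * z) * (newton m z * newton m z))))%C
  end.

Lemma is_poly_newton n : is_poly (newton n).
Proof.
  induction n as [|n IH]. exact (is_poly_const 1).
  apply (is_poly_plus (newton n)); auto. apply is_poly_scal.
  apply (is_poly_plus (fun _ => RtoC 1)). apply is_poly_const. apply is_poly_scal.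
  apply (is_poly_mult (fun z => 1 + z * z)%C).
  - apply (is_poly_plus (fun _ => RtoC 1)). apply is_poly_const.
    apply (is_poly_mult (fun z => z)); apply is_poly_id.
  - now apply is_poly_mult.
Qed.

Lemma small_re_pos z : Cmod z <= 1 / 3 -> 0 < Re (1 + z * z).
Proof.
  intro Hz. assert (H := re_le_Cmod (z * z)). rewrite Cmod_mult in H. assert (H0 := Cmod_ge_0 z).
  apply Rabs_le_between in H. unfold Re, Cplus, RtoC in *. cbn [fst snd] in *. nra.
Qed.

(* From (s - 1) (s + 1) (1 + z ^ 2) = - z ^ 2 and |s + 1| >= 1. *)
Lemma inv_sqrt_near_1 z : Cmod z <= 1 / 3 -> Cmod (inv_sqrt z - 1) <= 1 / 8.
Proof.
  intro Hz. destruct (inv_sqrt_spec z (small_re_pos z Hz)) as [H1 H2]. assert (H0 := Cmod_ge_0 z).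
  set (w := (1 + z * z)%C) in *.
  assert (Hw : 8 / 9 <= Cmod w).
  { assert (H := Cmod_triangle w (- (z * z))). replace (w + - (z * z))%C with (RtoC 1) in H by (unfold w; ring).
    rewrite Cmod_1, Cmod_opp, Cmod_mult in H. nra. }
  assert (E : ((inv_sqrt z - 1) * (inv_sqrt z + 1) * w = - (z * z))%C).
  { transitivity (inv_sqrt z * inv_sqrt z * w - w)%C. ring. rewrite H1. unfold w. ring. }
  assert (Hp : 1 <= Cmod (inv_sqrt z + 1)).
  { eapply Rle_trans; [|apply re_le_Cmod]. eapply Rle_trans; [|apply Rle_abs].
    change (Re (inv_sqrt z + 1)) with (Re (inv_sqrt z) + 1). lra. }
  assert (En := f_equal Cmod E). rewrite !Cmod_mult, Cmod_opp, Cmod_mult in En.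
  assert (Hr := Cmod_ge_0 (inv_sqrt z - 1)). set (A := Cmod (inv_sqrt z - 1)) in *. set (P := Cmod (inv_sqrt z + 1)) in *.
  assert (Cmod z * Cmod z <= 1 / 9) by nra.
  assert (A * (8 / 9) <= A * P * Cmod w). { rewrite Rmult_assoc. apply Rmult_le_compat_l; auto. replace (8 / 9) with (1 * (8 / 9)) by ring.
    apply Rmult_le_compat; lra. }
  lra.
Qed.

(** The iteration [p + (1 - (1 + z ^ 2) p ^ 2) / 2] fixes [1 / sqrt (1 + z ^ 2)]
    and contracts towards it when [z] is small. *)
Lemma newton_inv_sqrt z n : Cmod z <= 1 / 3 -> Cmod (newton n z - inv_sqrt z) <= 1 / 8 * (1 / 2) ^ n.
Proof.
  intro Hz. destruct (inv_sqrt_spec z (small_re_pos z Hz)) as [H1 _]. assert (Hn := inv_sqrt_near_1 z Hz).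
  induction n as [|n IH].
  - simpl newton. simpl pow. replace (1 - inv_sqrt z)%C with (- (inv_sqrt z - 1))%C by ring. rewrite Cmod_opp. lra.
  - set (p := newton n z) in *. set (s := inv_sqrt z) in *.
    assert (E : (newton (S n) z - s = (p - s) * (- (z * z + (1 + z * z) * (RtoC (1 / 2) * (p - s) + (s - 1)))))%C).
    { simpl newton. fold p.
      transitivity (p + RtoC (1 / 2) * (s * s * (1 + z * z) + RtoC (-1) * ((1 + z * z) * (p * p))) - s)%C.
      now rewrite H1.
      replace (RtoC (-1)) with (- (1))%C by (apply injective_projections; simpl; ring).
      replace (RtoC (1 / 2)) with (/ 2)%C by (apply injective_projections; simpl; field).
      field. }
    rewrite E, Cmod_mult, Cmod_opp. simpl pow.
    replace (1 / 8 * (1 / 2 * (1 / 2) ^ n)) with (1 / 8 * (1 / 2) ^ n * (1 / 2)) by ring.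
    apply Rmult_le_compat; auto using Cmod_ge_0.
    assert (Hpow : (1 / 2) ^ n <= 1). { apply Rle_trans with (1 ^ n). apply pow_incr. lra. rewrite pow1. lra. }
    assert (A1 := Cmod_triangle (RtoC (1 / 2) * (p - s)) (s - 1)).
    rewrite Cmod_mult, Cmod_R, Rabs_right in A1 by lra.
    assert (A2 := Cmod_triangle 1 (z * z)). rewrite Cmod_1, Cmod_mult in A2.
    eapply Rle_trans. apply Cmod_triangle. rewrite !Cmod_mult.
    assert (H0 := Cmod_ge_0 z). set (d := Cmod (RtoC (1 / 2) * (p - s) + (s - 1))) in *.
    assert (Hd0 : 0 <= d) by apply Cmod_ge_0. assert (Hd : d <= 3 / 16) by lra.
    assert (Hz2 : Cmod z * Cmod z <= 1 / 9) by nra.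
    assert (Cmod (1 + z * z) * d <= 10 / 9 * (3 / 16)) by (apply Rmult_le_compat; auto using Cmod_ge_0; lra). lra.
Qed.

Lemma disc_inv_sqrt r : r <= 1 / 3 -> disc_alg r inv_sqrt.
Proof.
  intros Hr eta He.
  destruct (is_lim_seq_0_small _ _ (lim_geom_0 (1 / 8) (1 / 2) ltac:(lra)) He) as [N HN]. specialize (HN N ltac:(lia)).
  exists (newton N). split. apply is_poly_newton. intros z Hz.
  replace (inv_sqrt z - newton N z)%C with (- (newton N z - inv_sqrt z))%C by ring. rewrite Cmod_opp.
  eapply Rle_trans. apply newton_inv_sqrt. lra. eapply Rle_trans; [apply Rle_abs|]. lra.
Qed.

(** The solution of the moment recurrence that starts from [inv_sqrt z]; here
    [inv_sqrt z ^ 2] is the inverse of the determinant [1 + z ^ 2]. *)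
Fixpoint moment_ext (z : C) (n : nat) : C * C :=
  match n with
  | O => (inv_sqrt z, 1 - z * inv_sqrt z)%C
  | S m => let PQ := moment_ext z m in
           let k := RtoC (INR m / INR (S m)) in
           (inv_sqrt z * inv_sqrt z * (z * fst PQ - k * snd PQ), inv_sqrt z * inv_sqrt z * (fst PQ + k * (z * snd PQ)))%C
  end.

Lemma moment_ext_rec z : 0 < Re (1 + z * z) ->
  bessel_rec z (fun n => fst (moment_ext z n)) (fun n => snd (moment_ext z n)).
Proof.
  intro Hz. destruct (inv_sqrt_spec z Hz) as [H _]. split. reflexivity.
  intro n. change (moment_ext z (S n)) with
    (inv_sqrt z * inv_sqrt z * (z * fst (moment_ext z n) - RtoC (INR n / INR (S n)) * snd (moment_ext z n)),
     inv_sqrt z * inv_sqrt z * (fst (moment_ext z n) + RtoC (INR n / INR (S n)) * (z * snd (moment_ext z n))))%C.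
  cbv beta. cbn [fst snd]. generalize (fst (moment_ext z n)) (snd (moment_ext z n)) (RtoC (INR n / INR (S n))).
  intros P Q k. split.
  - transitivity ((inv_sqrt z * inv_sqrt z * (1 + z * z)) * P)%C. ring. rewrite H. ring.
  - transitivity ((inv_sqrt z * inv_sqrt z * (1 + z * z)) * (- (k * Q)))%C. ring. rewrite H. ring.
Qed.

Lemma bessel_rec_unique z P Q P' Q' : (1 + z * z)%C <> 0%C -> bessel_rec z P Q -> bessel_rec z P' Q' ->
  P 0%nat = P' 0%nat -> forall n, P n = P' n /\ Q n = Q' n.
Proof.
  intros Hz [H0 H] [H0' H'] E n. induction n as [|n [IH1 IH2]].
  - split; auto. now rewrite H0, H0', E.
  - destruct (H n) as [A1 A2]. destruct (H' n) as [B1 B2].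
    set (k := RtoC (INR n / INR (S n))) in *.
    assert (S1 : forall p q p1 q1 : C, (q1 + z * p1 = p)%C -> (p1 - z * q1 = - (k * q))%C ->
       p1 = ((z * p - k * q) / (1 + z * z))%C /\ q1 = ((p + z * (k * q)) / (1 + z * z))%C).
    { intros p q p1 q1 E1 E2. assert (E3 : (k * q = z * q1 - p1)%C).
      { transitivity (- (- (k * q)))%C. ring. rewrite <- E2. ring. }
      rewrite E3, <- E1. split; field; auto. }
    destruct (S1 _ _ _ _ A1 A2) as [-> ->]. destruct (S1 _ _ _ _ B1 B2) as [-> ->]. now rewrite IH1, IH2.
Qed.

Lemma disc_moment_ext r n : 0 <= r -> r <= 1 / 3 ->
  disc_alg r (fun z => fst (moment_ext z n)) /\ disc_alg r (fun z => snd (moment_ext z n)).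
Proof.
  intros Hr0 Hr. assert (HR := disc_inv_sqrt r Hr). assert (Hid := disc_id r).
  assert (Hc := fun c => disc_const r c).
  induction n as [|n [IH1 IH2]].
  - split. exact HR.
    apply (disc_ext r (fun z => 1 + RtoC (-1) * (z * inv_sqrt z))%C).
    { intros z _. change (snd (moment_ext z 0)) with (1 - z * inv_sqrt z)%C.
      replace (RtoC (-1)) with (- (1))%C by (apply injective_projections; simpl; ring). ring. }
    apply disc_plus; auto. apply disc_mult; auto. now apply disc_mult.
  - set (k := RtoC (INR n / INR (S n))).
    assert (HRR : disc_alg r (fun z => inv_sqrt z * inv_sqrt z)%C) by now apply disc_mult.
    split.
    + apply (disc_ext r (fun z => inv_sqrt z * inv_sqrt z * (z * fst (moment_ext z n) + (- k) * snd (moment_ext z n)))%C).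
      { intros z _. change (fst (moment_ext z (S n))) with (inv_sqrt z * inv_sqrt z * (z * fst (moment_ext z n) - k * snd (moment_ext z n)))%C. ring. }
      apply disc_mult; auto. apply disc_plus; auto; now apply disc_mult.
    + apply (disc_ext r (fun z => inv_sqrt z * inv_sqrt z * (fst (moment_ext z n) + k * (z * snd (moment_ext z n))))%C).
      { intros z _. reflexivity. }
      apply disc_mult; auto. apply disc_plus; auto. apply disc_mult; auto. now apply disc_mult.
Qed.

Lemma moment_ext_bound r z n : 0 <= r -> r <= 1 / 3 -> Cmod z <= r ->
  Cmod (snd (moment_ext z n)) <= 4 / (1 - r) ^ n.
Proof.
  intros Hr0 Hr Hz. assert (Hn := inv_sqrt_near_1 z ltac:(lra)).
  destruct (Cmod_add_Ci_ge z) as [H1 H2]. assert (HI := im_le_Cmod z).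
  assert (H := bessel_rec_bound z _ _ (1 - r) (moment_ext_rec z (small_re_pos z ltac:(lra))) ltac:(lra) ltac:(lra) ltac:(lra) n).
  destruct H as [_ H]. eapply Rle_trans. exact H.
  unfold Rdiv. apply Rmult_le_compat_r. left. apply Rinv_0_lt_compat, pow_lt. lra.
  cbn [moment_ext fst snd].
  assert (HR : Cmod (inv_sqrt z) <= 9 / 8).
  { replace (inv_sqrt z) with ((inv_sqrt z - 1) + 1)%C by ring. eapply Rle_trans. apply Cmod_triangle. rewrite Cmod_1. lra. }
  assert (HQ : Cmod (1 - z * inv_sqrt z) <= 1 + 1 / 3 * (9 / 8)).
  { eapply Rle_trans. apply Cmod_triangle. rewrite Cmod_1, Cmod_opp, Cmod_mult. apply Rplus_le_compat_l.
    apply Rmult_le_compat; auto using Cmod_ge_0. lra. }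
  lra.
Qed.

Lemma moment_ext_Qmom z n : 0 < Re z -> Cmod z <= 1 / 3 -> snd (moment_ext z n) = Qmom n z.
Proof.
  intros Hz Hm. assert (Hp := small_re_pos z Hm).
  refine (proj2 (bessel_rec_unique z _ _ _ _ _ (moment_ext_rec z Hp) (moments_rec z Hz) _ n)).
  - intro E. rewrite E in Hp. simpl in Hp. lra.
  - simpl. symmetry. now apply Pmom_0_inv_sqrt.
Qed.

(** * The Hankel transform of a real function at frequency 1 *)

Section AbelSum.
Variables (M b : R) (c : nat -> R).
Hypotheses (Hb : 0 < b < 1) (Hc : exp_type M b c).
Let u := PSeries c.
Hypothesis (Hdecay : is_lim (fun x => sqrt x * u x) p_infty 0).
Let h x := x * J1 x * u x.

Lemma u_cont x : continuous u x.
Proof. eapply exp_type_continuous; eauto. lra. Qed.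

Lemma sqrt_u_bounded : exists B, forall x, 0 <= x -> Rabs (sqrt x * u x) <= B /\ Rabs (u x) <= B.
Proof.
  apply is_lim_spec in Hdecay. destruct (Hdecay (mkposreal 1 Rlt_0_1)) as [X HX]. simpl in HX.
  set (Y := Rabs X + 1). assert (HY : 1 <= Y) by (unfold Y; generalize (Rabs_pos X); lra).
  assert (HM : 0 <= M) by (eapply exp_type_M_ge0; eauto).
  set (E := M * exp (b * Y)). assert (HE : 0 <= E) by (unfold E; generalize (exp_pos (b * Y)); nra).
  exists (1 + Y * E). intros x Hx. rewrite Rabs_mult, (Rabs_right (sqrt x)) by (apply Rle_ge, sqrt_pos).
  destruct (Rle_lt_dec x Y) as [H|H].
  - assert (Hu : Rabs (u x) <= E).
    { eapply Rle_trans. exact (exp_type_le_exp M b c Hc x Hx). unfold E. apply Rmult_le_compat_l; auto.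
      destruct (Req_dec x Y) as [->|Hn]. lra. left. apply exp_increasing. nra. }
    assert (Hs : sqrt x <= Y).
    { apply Rle_trans with (sqrt (Y * Y)). apply sqrt_le_1_alt. nra. rewrite sqrt_square; lra. }
    assert (H1 := sqrt_pos x). assert (H2 := Rabs_pos (u x)).
    assert (sqrt x * Rabs (u x) <= Y * E) by (apply Rmult_le_compat; auto).
    split; nra.
  - assert (Hs : Rabs (sqrt x * u x) < 1).
    { rewrite <- (Rminus_0_r (sqrt x * u x)). apply HX. unfold Y in H. generalize (Rle_abs X). lra. }
    rewrite Rabs_mult, (Rabs_right (sqrt x)) in Hs by (apply Rle_ge, sqrt_pos).
    assert (H1 : 1 <= sqrt x). { rewrite <- sqrt_1. apply sqrt_le_1_alt. lra. }
    assert (H2 := Rabs_pos (u x)). split; nra.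
Qed.

Lemma exp_growth_u : exists B, exp_growth B 0 u.
Proof.
  destruct sqrt_u_bounded as [B HB]. exists B. split. apply u_cont.
  intros x Hx. rewrite Rmult_0_l, exp_0, Rmult_1_r. apply HB; auto.
Qed.

Lemma h_bound : exists C1, 0 <= C1 /\ forall x, 0 <= x -> Rabs (h x) <= C1 * Rabs (sqrt x * u x).
Proof.
  destruct sqrt_J1_bounded as [C1 [HC1 H]]. exists C1. split; auto. intros x Hx.
  unfold h. replace (x * J1 x * u x) with ((sqrt x * J1 x) * (sqrt x * u x)).
  rewrite Rabs_mult. apply Rmult_le_compat_r. apply Rabs_pos.
  rewrite Rabs_mult, (Rabs_right (sqrt x)). auto. apply Rle_ge, sqrt_pos.
  transitivity ((sqrt x * sqrt x) * J1 x * u x). ring. now rewrite sqrt_sqrt.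
Qed.

Lemma h_cont x : continuous h x.
Proof.
  apply (continuous_mult (fun x => x * J1 x) u). 2: apply u_cont.
  apply (continuous_mult (fun x => x) J1). apply continuous_id. apply continuous_J1.
Qed.

Lemma exp_growth_h : exists B, exp_growth B 0 h.
Proof.
  destruct h_bound as [C1 [HC1 H]]. destruct sqrt_u_bounded as [B HB].
  exists (C1 * B). split. apply h_cont. intros x Hx. rewrite Rmult_0_l, exp_0, Rmult_1_r.
  eapply Rle_trans. apply H; auto. apply Rmult_le_compat_l; auto. apply HB; auto.
Qed.

Lemma h_lim : is_lim h p_infty 0.
Proof.
  destruct h_bound as [C1 [HC1 H]].
  assert (HL : is_lim (fun x => C1 * Rabs (sqrt x * u x)) p_infty 0).
  { replace (Finite 0) with (Rbar_mult C1 0) by (simpl; now rewrite Rmult_0_r).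
    apply is_lim_scal_l. replace (Finite 0) with (Finite (Rabs 0)) by (now rewrite Rabs_R0).
    apply (filterlim_comp R R R (fun x => sqrt x * u x) Rabs _ (locally 0)). exact Hdecay. apply (continuous_Rabs 0). }
  apply (is_lim_le_le_loc (fun x => - (C1 * Rabs (sqrt x * u x))) (fun x => C1 * Rabs (sqrt x * u x))).
  - exists 0. intros x Hx. apply Rabs_le_between. apply H. lra.
  - replace (Finite 0) with (Rbar_opp 0) by (simpl; now rewrite Ropp_0). now apply is_lim_opp.
  - exact HL.
Qed.

(* The radius satisfies r <= 1 / 3, for [inv_sqrt], and b < 1 - r, so that the
   moments, of size n! / (1 - r) ^ n, are summable against b ^ n / n!. *)
Let r := (1 - b) / 3.

(** The factor [(k + 1)!] turns [Q (k + 1)] into the moment of order [k + 1], the one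
    extra power of [x] being the weight of the Hankel transform. *)
Definition abel_term (z : C) (k : nat) : C := (RtoC (c k * INR (fact (S k))) * snd (moment_ext z (S k)))%C.

Lemma abel_term_bound : exists K q, 0 <= q < 1 /\ forall z k, Cmod z <= r -> Cmod (abel_term z k) <= K * q ^ k.
Proof.
  set (x := b / (1 - r)). assert (Hr : 0 < 1 - r) by (unfold r; lra).
  assert (Hx : 0 <= x < 1).
  { unfold x. split. apply Rmult_le_pos. lra. now apply inv_ge0.
    apply Rmult_lt_reg_r with (1 - r); auto. unfold Rdiv. rewrite Rmult_assoc, Rinv_l by lra. unfold r; lra. }
  assert (HM : 0 <= M) by (eapply exp_type_M_ge0; eauto).
  destruct (linear_geom_le x Hx) as [K [q [_ [Hq HK]]]].
  exists (4 * M / (1 - r) * K), q. split; auto.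
  intros z k Hz. unfold abel_term. rewrite Cmod_mult, Cmod_R, Rabs_mult, (Rabs_right (INR _)).
  2: { left. apply fact_pos. }
  assert (Hp : 0 < (1 - r) ^ k) by now apply pow_lt.
  assert (Fk := fact_pos k). assert (Fk1 := fact_pos (S k)).
  apply Rle_trans with (M * b ^ k / INR (fact k) * INR (fact (S k)) * (4 / (1 - r) ^ S k)).
  { apply Rmult_le_compat; auto using Cmod_ge_0. apply Rmult_le_pos; auto using Rabs_pos; lra.
    apply Rmult_le_compat_r. lra. apply Hc. apply moment_ext_bound; auto; unfold r; lra. }
  rewrite (Rmult_assoc _ K). apply Rle_trans with (4 * M / (1 - r) * ((INR k + 1) * x ^ k)).
  { right. unfold x, Rdiv. rewrite Rpow_mult_distr, pow_inv, fact_simpl, mult_INR, S_INR. simpl pow. field. lra. }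
  apply Rmult_le_compat_l; auto. repeat apply Rmult_le_pos; try lra; now apply inv_ge0.
Qed.

Lemma abel_series_disc : disc_alg r (fun z => C_Series (abel_term z)).
Proof.
  destruct abel_term_bound as [K [q [Hq H]]]. assert (Hr0 : 0 <= r) by (unfold r; lra).
  apply (disc_series r abel_term K q Hq); auto.
  intro n. unfold abel_term. apply disc_mult; auto. now apply disc_const.
  apply (disc_moment_ext r (S n)); unfold r; lra.
Qed.

Lemma moment_opp j w A e : 0 < e -> exp_growth A 0 w -> moment j (fun x => - w x) e = - moment j w e.
Proof.
  intros He Hw. transitivity (-1 * moment j w e + 0 * moment j w e). 2: ring.
  rewrite <- (moment_lin j w w A A 0 e (-1) 0 He Hw Hw). apply moment_congr. intros; ring.
Qed.

(** The real and imaginary parts are the cases [K = J1 cos (y x)] and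
    [K = J1 sin (- y x)] of [termwise_all], on the line [Im z = y]. *)
Lemma abel_series_laplace z : 0 < Re z -> Cmod z <= r ->
  C_Series (abel_term z) = (LI (fun t => h t * Re (cexp (- z) t)), LI (fun t => h t * Im (cexp (- z) t))).
Proof.
  intros Hz Hm. destruct exp_growth_u as [B HB]. set (e := Re z) in *. set (y := Im z).
  assert (Hy := im_le_Cmod z). fold y in Hy.
  assert (Hrho : 0 < 1 - r) by (unfold r; lra). assert (Hbr : b < 1 - r) by (unfold r; lra).
  assert (Hmz : Cmod z <= 1 / 3) by (unfold r in Hm; lra).
  assert (Ht : forall k, (RtoC (c k * INR (fact (S k))) * snd (moment_ext z (S k)))%C =
     (c k * moment (S k) (J1c y) e, c k * (- moment (S k) (J1s y) e))).
  { intro k. rewrite moment_ext_Qmom by auto. assert (F := fact_pos (S k)).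
    remember (INR (fact (S k))) as f. unfold Qmom. rewrite <- Heqf. fold y. fold e.
    apply injective_projections; unfold Cmult, RtoC; cbn [fst snd]; field; lra. }
  assert (HJ := J1_moment_bound y (1 - r) Hrho ltac:(lra)).
  unfold C_Series, abel_term. f_equal.
  - rewrite (Series_ext _ (fun k => c k * moment (k + 1) (J1c y) e)).
    2: { intro k. rewrite Ht. now rewrite Nat.add_1_r. }
    transitivity (moment 1 (fun x => u x * J1c y x) e).
    { apply is_series_unique. apply (termwise_all M b B (1 - r) c (J1c y)); auto; try lra.
      apply exp_growth_J1c. intros e' He'. destruct (HJ e' He') as [C0 HC]. exists C0. intro n. exact (proj1 (HC n)). }
    apply LI_ext. intros x _. unfold h, J1c. change (Re (cexp (- z) x)) with (exp (- e * x) * cos (- y * x)).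
    replace (- y * x) with (- (y * x)) by ring. rewrite cos_neg. simpl. ring.
  - rewrite (Series_ext _ (fun k => c k * moment (k + 1) (J1s (- y)) e)).
    2: { intro k. rewrite Ht, Nat.add_1_r. cbn [Im snd]. f_equal.
         rewrite <- (moment_opp (S k) (J1s y) 1 e Hz (exp_growth_J1s y)). apply moment_congr. intros x _.
         unfold J1s. replace (- y * x) with (- (y * x)) by ring. rewrite sin_neg. ring. }
    assert (HJ' := J1_moment_bound (- y) (1 - r) Hrho ltac:(rewrite Rabs_Ropp; lra)).
    transitivity (moment 1 (fun x => u x * J1s (- y) x) e).
    { apply is_series_unique. apply (termwise_all M b B (1 - r) c (J1s (- y))); auto; try lra.
      apply exp_growth_J1s. intros e' He'. destruct (HJ' e' He') as [C0 HC]. exists C0. intro n. exact (proj2 (HC n)). }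
    apply LI_ext. intros x _. unfold h, J1s. change (Im (cexp (- z) x)) with (exp (- e * x) * sin (- y * x)). simpl. ring.
Qed.

Lemma hankel_abel_sum : is_lim (fun T => RInt h 0 T) p_infty (Re (C_Series (abel_term 0))).
Proof.
  destruct exp_growth_h as [B HB].
  apply (fatou_riesz h B r (fun z => C_Series (abel_term z))); auto.
  - unfold r; lra.
  - exact h_lim.
  - exact abel_series_disc.
  - exact abel_series_laplace.
Qed.
End AbelSum.

(** The binomial coefficient of [- 1 / 2] over [m], which is the coefficient of
    [z ^ (2 m)] in [1 / sqrt (1 + z ^ 2)]. *)
Definition binom_neg_half (m : nat) : R := (-1) ^ m * INR (fact (2 * m)) / (4 ^ m * INR (fact m) ^ 2).

(** At [z = 0] the recurrence exchanges [P] and [Q], up to factors: it splits into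
    two chains, and in one of them the first factor [0 / 1] makes all that
    follows vanish. *)
Lemma moment_ext_0 m :
  snd (moment_ext 0 (S (2 * m))) = RtoC (binom_neg_half m) /\ snd (moment_ext 0 (S (S (2 * m)))) = RtoC 0.
Proof.
  destruct (moment_ext_rec 0) as [H0 H]. { simpl. lra. }
  assert (HQ : forall n, snd (moment_ext 0 (S n)) = fst (moment_ext 0 n)).
  { intro n. destruct (H n) as [H1 _]. rewrite <- H1. ring. }
  assert (HP : forall n, fst (moment_ext 0 (S n)) = (- (RtoC (INR n / INR (S n)) * snd (moment_ext 0 n)))%C).
  { intro n. destruct (H n) as [_ H1]. rewrite <- H1. ring. }
  rewrite !HQ. induction m as [|m [IH1 IH2]].
  - split.
    + simpl (2 * 0)%nat. change (fst (moment_ext 0 0)) with (inv_sqrt 0). rewrite inv_sqrt_0. unfold binom_neg_half. simpl. f_equal. field.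
    + rewrite HP. simpl. unfold Rdiv. rewrite Rmult_0_l. apply injective_projections; simpl; ring.
  - replace (2 * S m)%nat with (S (S (2 * m))) by lia. split.
    + rewrite HP, HQ, IH1. rewrite <- RtoC_mult, <- RtoC_opp. f_equal. unfold binom_neg_half.
      replace (2 * S m)%nat with (S (S (2 * m))) by lia.
      rewrite (fact_simpl (S (2 * m))), (fact_simpl (2 * m)), (fact_simpl m), !mult_INR.
      rewrite !S_INR, mult_INR. simpl (INR 2). assert (F := fact_pos m). assert (Hm := pos_INR m).
      assert (H4 : 4 ^ m <> 0) by (apply pow_nonzero; lra). simpl pow. field. repeat split; lra.
    + rewrite HP, HQ, IH2. ring.
Qed.

(** * The Gamma function at integers and half-integers *)

Definition gamma_integrand (x t : R) : R := Rpower t (x - 1) * exp (- t).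

Definition is_gamma (x l : R) : Prop :=
  is_RInt_gen (gamma_integrand x) (at_right 0) (Rbar_locally p_infty) l.

Lemma is_gamma_unique x l : is_gamma x l -> euler_Gamma x = l.
Proof. intro H. unfold euler_Gamma. now apply (is_RInt_gen_unique (V := R_CompleteNormedModule)). Qed.

Lemma is_derive_Rpower (x t : R) : 0 < t -> is_derive (fun t => Rpower t x) t (x * Rpower t (x - 1)).
Proof.
  intro Ht. unfold Rpower. auto_derive; auto.
  replace ((x - 1) * ln t) with (x * ln t + - ln t) by ring. rewrite exp_plus, exp_Ropp, exp_ln by auto. field. lra.
Qed.

Lemma Rpower_exp_lim_p x : is_lim (fun t => Rpower t x * exp (- t)) p_infty 0.
Proof.
  destruct (nfloor_ex (Rabs x) (Rabs_pos x)) as [n Hn].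
  assert (HK : forall t, 1 <= t -> 0 <= Rpower t x * exp (- t) <= INR (fact (S (S n))) * / t).
  { intros t Ht. split. apply Rmult_le_pos; left; apply exp_pos.
    assert (H := pow_fact_le_exp t (S (S n)) ltac:(lra)). assert (F := fact_pos (S (S n))).
    assert (H1 : Rpower t x <= t ^ S n).
    { rewrite <- Rpower_pow by lra. apply Rle_Rpower; auto. rewrite S_INR. generalize (Rle_abs x). lra. }
    rewrite exp_Ropp. assert (He := exp_pos t).
    apply Rmult_le_reg_r with (exp t * t). nra.
    replace (Rpower t x * / exp t * (exp t * t)) with (Rpower t x * t) by (field; lra).
    replace (INR (fact (S (S n))) * / t * (exp t * t)) with (INR (fact (S (S n))) * exp t) by (field; lra).
    apply Rle_trans with (t ^ S n * t). apply Rmult_le_compat_r; lra.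
    replace (t ^ S n * t) with (t ^ S (S n)) by (simpl; ring).
    apply Rmult_le_reg_r with (/ INR (fact (S (S n)))). now apply Rinv_0_lt_compat.
    replace (INR (fact (S (S n))) * exp t * / INR (fact (S (S n)))) with (exp t) by (field; lra). exact H. }
  apply (is_lim_le_le_loc (fun _ => 0) (fun t => INR (fact (S (S n))) * / t)).
  - exists 1. intros t Ht. apply HK. lra.
  - apply is_lim_const.
  - replace (Finite 0) with (Rbar_mult (INR (fact (S (S n)))) (Rbar_inv p_infty)) by (simpl; f_equal; ring).
    apply is_lim_scal_l. apply is_lim_inv. apply is_lim_id. discriminate.
Qed.

Lemma Rpower_lim_0 x : 0 < x -> filterlim (fun t => Rpower t x) (at_right 0) (locally 0).
Proof.
  intro Hx. unfold Rpower. apply (filterlim_comp R R R (fun t => x * ln t) exp (at_right 0) (Rbar_locally m_infty)).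
  2: apply is_lim_exp_m.
  apply (filterlim_comp R R R ln (fun s => x * s) (at_right 0) (Rbar_locally m_infty)). apply is_lim_ln_0.
  replace (Rbar_locally m_infty) with (Rbar_locally (Rbar_mult x m_infty)) at 2.
  apply (is_lim_scal_l (fun s => s) x m_infty m_infty). apply is_lim_id.
  f_equal. rewrite Rbar_mult_comm. apply is_Rbar_mult_unique, is_Rbar_mult_m_infty_pos. exact Hx.
Qed.

Lemma filter_prod_pos (P : R -> R -> Prop) : (forall a b, 0 < a -> 1 < b -> P a b) ->
  filter_prod (at_right 0) (Rbar_locally p_infty) (fun ab => P (fst ab) (snd ab)).
Proof.
  intro H. exists (fun a => 0 < a) (fun b => 1 < b).
  - exists (mkposreal 1 Rlt_0_1). auto.
  - exists 1. auto.
  - auto.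
Qed.

Lemma is_RInt_gen_primitive (F f : R -> R) (l0 l1 : R) :
  (forall t, 0 < t -> is_derive F t (f t)) -> (forall t, 0 < t -> continuous f t) ->
  filterlim F (at_right 0) (locally l0) -> is_lim F p_infty l1 ->
  is_RInt_gen f (at_right 0) (Rbar_locally p_infty) (l1 - l0).
Proof.
  intros Hd Hc H0 H1.
  assert (Hpos : forall a b x, 0 < a -> 1 < b -> Rmin a b <= x -> 0 < x).
  { intros a b x Ha Hb Hx. assert (0 < Rmin a b) by (apply Rmin_glb_lt; lra). lra. }
  apply (is_RInt_gen_ext (V := R_NormedModule) (Derive F)).
  - apply (filter_prod_pos (fun a b => forall x, Rmin a b < x < Rmax a b -> Derive F x = f x)).
    intros a b Ha Hb x Hx. apply is_derive_unique, Hd. apply (Hpos a b); lra.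
  - apply is_RInt_gen_Derive; auto.
    + apply (filter_prod_pos (fun a b => forall x, Rmin a b <= x <= Rmax a b -> ex_derive F x)).
      intros a b Ha Hb x Hx. eexists. apply Hd. apply (Hpos a b); lra.
    + apply (filter_prod_pos (fun a b => forall x, Rmin a b <= x <= Rmax a b -> continuous (Derive F) x)).
      intros a b Ha Hb x Hx. assert (Hx0 : 0 < x) by (apply (Hpos a b); lra).
      apply (continuous_ext_loc _ f); auto.
      exists (mkposreal x Hx0). intros y Hy. symmetry. apply is_derive_unique, Hd.
      change (Rabs (y - x) < x) in Hy. apply Rabs_lt_between in Hy. lra.
Qed.

Lemma gamma_integrand_cont x t : 0 < t -> continuous (gamma_integrand x) t.
Proof.
  intro Ht. apply ex_derive_cont. unfold gamma_integrand, Rpower. auto_derive; auto.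
Qed.

(** The derivative of [t ^ x * exp (- t)], which vanishes at both ends, is [x] times
    one integrand minus the other. *)
Lemma is_gamma_succ x l : 0 < x -> is_gamma x l -> is_gamma (x + 1) (x * l).
Proof.
  intros Hx H.
  set (D := fun t => x * gamma_integrand x t - gamma_integrand (x + 1) t).
  assert (HD : is_RInt_gen D (at_right 0) (Rbar_locally p_infty) (0 - 0)).
  { apply (is_RInt_gen_primitive (fun t => Rpower t x * exp (- t))).
    - intros t Ht. evar_last. apply (is_derive_mult (fun t => Rpower t x) (fun t => exp (- t))).
      now apply is_derive_Rpower. { instantiate (1 := - exp (- t)). auto_derive; auto. ring. }
      intros; apply Rmult_comm. unfold D, gamma_integrand, plus, mult; simpl.
      replace (x + 1 - 1) with x by ring. eqR. ring.
    - intros t Ht. apply (continuous_minus (fun t => x * gamma_integrand x t)).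
      apply (continuous_scal_r x (gamma_integrand x)). now apply gamma_integrand_cont. now apply gamma_integrand_cont.
    - replace (locally 0) with (locally (0 * exp (- 0))) by (f_equal; ring).
      apply (filterlim_comp_2 (F := at_right 0) (G := locally 0) (H := locally (exp (- 0))) (fun t => Rpower t x) (fun t => exp (- t)) Rmult).
      now apply Rpower_lim_0.
      eapply filterlim_filter_le_1. apply filter_le_within.
      apply (ex_derive_cont (fun t => exp (- t))). auto_derive; auto.
      apply (filterlim_mult (K := R_AbsRing) 0 (exp (- 0))).
    - apply Rpower_exp_lim_p. }
  assert (HS := is_RInt_gen_minus (V := R_NormedModule) _ _ _ _ (is_RInt_gen_scal (V := R_NormedModule) _ x _ H) HD).
  unfold is_gamma. replace (x * l) with (minus (scal x l) (0 - 0)).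
  2: { unfold minus, plus, opp, scal; simpl. unfold mult; simpl. eqR. ring. }
  eapply is_RInt_gen_ext; [|exact HS].
  apply filter_forall. intros [a b] t _. unfold D, minus, plus, opp, scal; simpl. unfold mult; simpl. eqR. ring.
Qed.

Lemma is_gamma_1 : is_gamma 1 1.
Proof.
  unfold is_gamma. replace 1 with (0 - - 1) at 2 by ring.
  apply (is_RInt_gen_primitive (fun t => - exp (- t))).
  - intros t Ht. unfold gamma_integrand. rewrite Rminus_diag, Rpower_O by auto. auto_derive; auto. ring.
  - intros t Ht. now apply gamma_integrand_cont.
  - eapply filterlim_filter_le_1. apply filter_le_within.
    replace (- 1) with (- exp (- 0)) by (rewrite Ropp_0, exp_0; ring).
    apply (ex_derive_cont (fun t => - exp (- t))). auto_derive; auto.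
  - replace (Finite 0) with (Rbar_opp 0) by (simpl; f_equal; ring). apply is_lim_opp.
    apply (is_lim_comp exp (fun t => - t) p_infty 0 m_infty). apply is_lim_exp_m.
    apply (is_lim_opp (fun t => t) p_infty p_infty). apply is_lim_id. exists 0. intros; discriminate.
Qed.

Lemma monotone_lim (G : R -> R) (B : R) : (forall x y, 0 < x <= y -> G x <= G y) -> (forall x, 0 < x -> G x <= B) ->
  exists l : R, is_lim G p_infty l /\ forall x, 0 < x -> G x <= l.
Proof.
  intros Hm HB. destruct (completeness (fun v => exists x, 0 < x /\ v = G x)) as [l [H1 H2]].
  - exists B. intros v [x [Hx ->]]. auto.
  - exists (G 1), 1. split; auto. lra.
  - exists l. split. 2: { intros x Hx. apply H1. exists x; auto. }
    apply is_lim_spec. intro eps. assert (Heps := cond_pos eps).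
    assert (Hex : exists x, 0 < x /\ l - eps < G x).
    { apply Classical_Prop.NNPP. intro Hn. assert (l <= l - eps); [|lra].
      apply H2. intros v [x [Hx ->]]. apply Rnot_lt_le. intro Hlt. apply Hn. exists x; auto. }
    destruct Hex as [x [Hx Hl]]. exists x. intros y Hy.
    assert (G x <= G y) by (apply Hm; lra). assert (G y <= l) by (apply H1; exists y; split; auto; lra).
    apply Rabs_lt_between'. lra.
Qed.

(** A primitive of the integrand increases, and it is bounded by comparison with
    the primitives [- exp (- t)] near infinity and [2 * sqrt t] near 0: so it has
    limits at both ends. *)
Lemma is_gamma_half : exists l, 0 < l /\ is_gamma (1 / 2) l.
Proof.
  set (g := gamma_integrand (1 / 2)). set (G := (fun T => RInt g 1 T) : R -> R).
  assert (Hg : forall t, 0 < t -> continuous g t) by (intros t Ht; now apply gamma_integrand_cont).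
  assert (Hgp : forall t, 0 < g t) by (intro t; apply Rmult_lt_0_compat; apply exp_pos).
  assert (HG : forall t, 0 < t -> is_derive G t (g t)).
  { intros t Ht. apply (is_derive_RInt g G 1 t); auto. exists (mkposreal t Ht). intros y Hy.
    change (Rabs (y - t) < t) in Hy. apply Rabs_lt_between in Hy.
    apply (@RInt_correct R_CompleteNormedModule). apply (@ex_RInt_continuous R_CompleteNormedModule).
    intros s Hs. apply Hg. assert (0 < Rmin 1 y) by (apply Rmin_glb_lt; lra). lra. }
  assert (HGc : forall t, 0 < t -> continuous G t).
  { intros t Ht. apply ex_derive_cont. eexists. now apply HG. }
  assert (HG1 : G 1 = 0) by exact (RInt_point (V := R_CompleteNormedModule) 1 g).
  assert (Hmono : forall x y, 0 < x <= y -> G x <= G y).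
  { intros x y Hxy. apply Ropp_le_cancel. apply (nonincr_of_derive (fun t => - G t) (fun t => - g t) x y); try lra.
    - intros t Ht. apply (continuous_opp G). apply HGc; lra.
    - intros t Ht. apply (is_derive_opp G). apply HG; lra.
    - intros t Ht. specialize (Hgp t). lra. }
  assert (Hup : forall x, 0 < x -> G x <= 1).
  { intros x Hx. destruct (Rle_lt_dec x 1) as [H|H].
    - specialize (Hmono x 1 ltac:(lra)). lra.
    - assert (A : G x + exp (- x) <= G 1 + exp (- 1)).
      { apply (nonincr_of_derive (fun t => G t + exp (- t)) (fun t => g t + - exp (- t)) 1 x); try lra.
        - intros t Ht. apply (continuous_plus G (fun t => exp (- t))). apply HGc; lra.
          apply ex_derive_cont. auto_derive; auto.
        - intros t Ht. apply @is_derive_plus. apply HG; lra. auto_derive; auto. ring.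
        - intros t Ht. unfold g, gamma_integrand.
          assert (Rpower t (1 / 2 - 1) <= Rpower t 0) by (apply Rle_Rpower; lra). rewrite Rpower_O in H0 by lra.
          generalize (exp_pos (- t)). nra. }
      assert (exp (- 1) <= 1). { rewrite <- exp_0. left. apply exp_increasing. lra. }
      generalize (exp_pos (- x)). lra. }
  assert (Hlow : forall x, 0 < x -> - 2 <= G x).
  { intros x Hx. destruct (Rle_lt_dec 1 x) as [H|H].
    - specialize (Hmono 1 x ltac:(lra)). lra.
    - assert (A : G 1 + - 2 * Rpower 1 (1 / 2) <= G x + - 2 * Rpower x (1 / 2)).
      { apply (nonincr_of_derive (fun t => G t + - 2 * Rpower t (1 / 2)) (fun t => g t + - 2 * (1 / 2 * Rpower t (1 / 2 - 1))) x 1); try lra.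
        - intros t Ht. apply (continuous_plus G (fun t => - 2 * Rpower t (1 / 2))). apply HGc; lra.
          apply ex_derive_cont. unfold Rpower. auto_derive; lra.
        - intros t Ht. apply @is_derive_plus. apply HG; lra. apply is_derive_scal. apply is_derive_Rpower; lra.
        - intros t Ht. unfold g, gamma_integrand.
          assert (exp (- t) <= 1). { rewrite <- exp_0. left. apply exp_increasing. lra. }
          assert (0 < Rpower t (1 / 2 - 1)) by apply exp_pos. nra. }
      assert (Rpower 1 (1 / 2) = 1). { unfold Rpower. rewrite ln_1, Rmult_0_r. apply exp_0. }
      assert (0 < Rpower x (1 / 2)) by apply exp_pos. lra. }
  destruct (monotone_lim G 1 Hmono Hup) as [l1 [L1 L1']].
  destruct (monotone_lim (fun s => - G (/ s)) 2) as [l0 [L0 L0']].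
  { intros x y Hxy. apply Ropp_le_contravar. apply Hmono. split. apply Rinv_0_lt_compat; lra. apply Rinv_le_contravar; lra. }
  { intros x Hx. specialize (Hlow (/ x) ltac:(now apply Rinv_0_lt_compat)). lra. }
  exists (l1 - - l0). split.
  - specialize (L0' 1 ltac:(lra)). rewrite Rinv_1, HG1 in L0'. specialize (L1' 2 ltac:(lra)).
    destruct (MVT_gen G 1 2 g) as [x [_ Hx]].
    + intros t. rewrite Rmin_left, Rmax_right by lra. intro Ht. apply HG. lra.
    + intros t. rewrite Rmin_left, Rmax_right by lra. intro Ht. apply continuity_pt_filterlim, HGc. lra.
    + specialize (Hgp x). lra.
  - apply (is_RInt_gen_primitive G); auto.
    apply (filterlim_ext_loc (fun t => - - G (/ / t))).
    { exists (mkposreal 1 Rlt_0_1). intros y _ Hy. rewrite Rinv_inv. ring. }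
    apply (filterlim_comp R R R (fun t => - G (/ / t)) Ropp _ (locally l0)). 2: apply (filterlim_opp (V := R_NormedModule) l0).
    apply (filterlim_comp R R R Rinv (fun s => - G (/ s)) _ (Rbar_locally p_infty)). 2: exact L0.
    apply filterlim_Rinv_0_right.
Qed.

Lemma is_gamma_rising x l n : 0 < x -> is_gamma x l -> is_gamma (x + INR n) (rising x n * l).
Proof.
  intros Hx H. induction n as [|n IH].
  - simpl. rewrite Rplus_0_r, Rmult_1_l. exact H.
  - rewrite S_INR. replace (x + (INR n + 1)) with (x + INR n + 1) by ring. simpl rising.
    replace (rising x n * (x + INR n) * l) with ((x + INR n) * (rising x n * l)) by ring.
    apply is_gamma_succ; auto. generalize (pos_INR n). lra.
Qed.

Lemma rising_1 n : rising 1 n = INR (fact n).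
Proof. induction n as [|n IH]. reflexivity. simpl rising. rewrite IH, fact_simpl, mult_INR, S_INR. ring. Qed.

Lemma rising_front x n : rising x (S n) = x * rising (x + 1) n.
Proof.
  induction n as [|n IH]. simpl. ring.
  change (rising x (S (S n))) with (rising x (S n) * (x + INR (S n))). rewrite IH, S_INR. simpl rising. ring.
Qed.

Lemma rGamma_pos x l : 0 < x -> is_gamma x l -> rGamma x = / l.
Proof.
  intros Hx H. unfold rGamma.
  assert (Hu : (up (- x) <= 0)%Z).
  { destruct (archimed (- x)) as [_ H1]. apply Z.lt_succ_r. apply lt_IZR. simpl. lra. }
  replace (Z.to_nat (up (- x))) with 0%nat by (symmetry; destruct (up (- x)); auto; lia).
  simpl. rewrite Rplus_0_r, (is_gamma_unique _ _ H). unfold Rdiv. ring.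
Qed.

Lemma Gamma_pos x l : 0 < x -> is_gamma x l -> Gamma x = l.
Proof. intros Hx H. unfold Gamma. rewrite (rGamma_pos x l) by auto. apply Rinv_inv. Qed.

Lemma Gamma_nat n : Gamma (INR n + 1) = INR (fact n).
Proof.
  apply Gamma_pos. generalize (pos_INR n); lra.
  rewrite Rplus_comm, <- rising_1, <- (Rmult_1_r (rising 1 n)). apply is_gamma_rising. lra. apply is_gamma_1.
Qed.

Lemma rising_half n : rising (1 / 2) n = INR (fact (2 * n)) / (4 ^ n * INR (fact n)).
Proof.
  induction n as [|n IH]. simpl. field.
  simpl rising. rewrite IH. replace (2 * S n)%nat with (S (S (2 * n))) by lia.
  rewrite (fact_simpl (S (2 * n))), (fact_simpl (2 * n)), (fact_simpl n), !mult_INR, !S_INR, mult_INR. simpl (INR 2).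
  assert (F := fact_pos n). assert (Hm := pos_INR n). assert (H4 : 4 ^ n <> 0) by (apply pow_nonzero; lra).
  simpl pow. field. repeat split; lra.
Qed.

(** Up to their signs the factors are the same, in reverse order. *)
Lemma rising_half_neg n : rising (1 / 2 - INR n) n = (-1) ^ n * rising (1 / 2) n.
Proof.
  induction n as [|n IH]. simpl; ring.
  rewrite rising_front, S_INR. replace (1 / 2 - (INR n + 1) + 1) with (1 / 2 - INR n) by ring.
  rewrite IH. simpl. field.
Qed.

(** Both factors are computed from [Gamma (1 / 2)], which cancels. *)
Lemma full_coef_even m :
  Gamma (INR (2 * m) / 2 + 3 / 2) * rGamma (1 / 2 - INR (2 * m) / 2)
   = (-1) ^ m * (1 / 2 + INR m) * (INR (fact (2 * m)) / (4 ^ m * INR (fact m))) ^ 2.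
Proof.
  destruct is_gamma_half as [l [Hl H]].
  replace (INR (2 * m) / 2) with (INR m) by (rewrite mult_INR; simpl; field).
  replace (INR m + 3 / 2) with (1 / 2 + INR (S m)) by (rewrite S_INR; field).
  rewrite (Gamma_pos (1 / 2 + INR (S m)) (rising (1 / 2) (S m) * l)).
  2: { generalize (pos_INR (S m)); lra. } 2: { apply is_gamma_rising; auto. lra. }
  unfold rGamma. replace (up (- (1 / 2 - INR m))) with (Z.of_nat m).
  2: { apply tech_up; rewrite <- INR_IZR_INZ; lra. }
  rewrite Nat2Z.id. replace (1 / 2 - INR m + INR m) with (1 / 2) by ring.
  rewrite (is_gamma_unique _ _ H), rising_half_neg. simpl rising. rewrite rising_half.
  assert (F := fact_pos m). assert (H4 : 4 ^ m <> 0) by (apply pow_nonzero; lra). field. repeat split; lra.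
Qed.

(** For [k = 2 m + 1] the argument [1 / 2 - k / 2] is the non-positive integer [- m]. *)
Lemma full_coef_odd m : rGamma (1 / 2 - INR (S (2 * m)) / 2) = 0.
Proof.
  replace (1 / 2 - INR (S (2 * m)) / 2) with (- INR m) by (rewrite S_INR, mult_INR; simpl; field).
  unfold rGamma. replace (up (- - INR m)) with (Z.of_nat (S m)).
  2: { apply tech_up; rewrite <- INR_IZR_INZ, S_INR; lra. }
  rewrite Nat2Z.id. simpl rising. replace (- INR m + INR m) with 0 by ring. unfold Rdiv. ring.
Qed.

(** * The two series *)

Lemma binom_neg_half_le_1 m : Rabs (binom_neg_half m) <= 1.
Proof.
  unfold binom_neg_half. assert (F := fact_pos m). assert (F2 := fact_pos (2 * m)).
  assert (H4 : 0 < 4 ^ m) by (apply pow_lt; lra).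
  unfold Rdiv. rewrite !Rabs_mult, pow_1_abs, Rmult_1_l, Rabs_inv, (Rabs_right (INR _)) by lra.
  assert (Hp : 0 < 4 ^ m * INR (fact m) ^ 2) by (apply Rmult_lt_0_compat; auto; nra).
  rewrite Rabs_right by lra.
  assert (H := binomial_term_le 1 1 m m ltac:(lra) ltac:(lra)). rewrite !pow1 in H.
  replace ((1 + 1) ^ (m + m)) with (4 ^ m) in H.
  2: { replace (m + m)%nat with (2 * m)%nat by lia. rewrite pow_mult. f_equal. ring. }
  replace (m + m)%nat with (2 * m)%nat in H by lia.
  apply Rmult_le_reg_r with (4 ^ m * INR (fact m) ^ 2); auto.
  rewrite Rmult_assoc, Rinv_l, Rmult_1_r, Rmult_1_l by lra.
  apply (Rmult_le_compat_r (INR (fact m) ^ 2)) in H; [|nra].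
  eapply Rle_trans; [|exact H]. right. field. lra.
Qed.

Definition even_coef (m : nat) : R := (2 * INR m + 1) * binom_neg_half m.

Lemma even_term_coef f q m : q <> 0 ->
  even_term f q m = (RtoC (even_coef m * / q ^ (2 * m)) * C_Derive_n f (2 * m) 0)%C.
Proof.
  intro Hq. unfold even_term.
  replace (2 * INR m + 2) with (INR (S (2 * m)) + 1) by (rewrite S_INR, mult_INR; simpl; ring).
  rewrite !Gamma_nat, fact_simpl, mult_INR, S_INR, mult_INR. simpl (INR 2).
  rewrite Rpow_mult_distr. rewrite (pow_mult 2 2 m). replace (2 ^ 2) with 4 by ring.
  match goal with |- (RtoC ?x * ?d * RtoC ?y)%C = _ =>
    transitivity (RtoC (x * y) * d)%C; [rewrite (RtoC_mult x y); ring|]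
  end.
  f_equal. f_equal. unfold even_coef, binom_neg_half. assert (F := fact_pos m). assert (H4 : 4 ^ m <> 0) by (apply pow_nonzero; lra).
  assert (q ^ (2 * m) <> 0) by now apply pow_nonzero. field. repeat split; auto; lra.
Qed.

Lemma full_term_even f q m : q <> 0 ->
  full_term f q (2 * m) = (RtoC (1 / 2) * even_term f q m)%C.
Proof.
  intro Hq. rewrite even_term_coef by auto. unfold full_term. rewrite full_coef_even, Gamma_nat.
  unfold Rdiv at 4. rewrite Rpow_mult_distr, pow_inv. rewrite (pow_mult 2 2 m). replace (2 ^ 2) with 4 by ring.
  match goal with |- (RtoC ?x * ?d * RtoC ?y)%C = (RtoC ?s * (RtoC ?w * ?d))%C =>
    transitivity (RtoC (x * y) * d)%C; [rewrite (RtoC_mult x y); ring|];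
    transitivity (RtoC (s * w) * d)%C; [|rewrite (RtoC_mult s w); ring]
  end.
  f_equal. f_equal. unfold even_coef, binom_neg_half.
  assert (F := fact_pos m). assert (F2 := fact_pos (2 * m)). assert (H4 : 4 ^ m <> 0) by (apply pow_nonzero; lra).
  assert (q ^ (2 * m) <> 0) by now apply pow_nonzero. field. repeat split; auto; lra.
Qed.

Lemma full_term_odd f q m : full_term f q (S (2 * m)) = RtoC 0.
Proof. unfold full_term. rewrite full_coef_odd. unfold Rdiv. rewrite Rmult_0_r, Rmult_0_l. ring. Qed.

Lemma is_series_even (a : nat -> R) (l : R) :
  (forall m, a (S (2 * m)) = 0) -> is_series (fun m => a (2 * m)%nat) l -> is_series a l.
Proof.
  intros H0 Hs. assert (H : is_pseries a 1 (l + 1 * 0)).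
  { apply is_pseries_odd_even.
    - apply is_pseries_R. eapply is_series_ext; [|exact Hs]. intro n. rewrite <- pow_mult, pow1. eqR; ring.
    - apply is_pseries_R. apply (is_series_ext (fun _ => 0 * 0)).
      { intro n. rewrite Nat.add_1_r, H0. eqR; ring. }
      apply (is_series_geom_err _ 0 0 0). lra.
      intro n. rewrite sum_n_const, !Rmult_0_r, Rminus_0_r, Rabs_R0, Rmult_0_l. lra. }
  apply is_pseries_R in H. replace (l + 1 * 0) with l in H by ring.
  eapply is_series_ext; [|exact H]. intro n. cbv beta; rewrite pow1. eqR; ring.
Qed.

Lemma cv_abs_unif_geom (a : R) (u : R -> nat -> C) :
  (forall q0, a < q0 -> exists K r, 0 <= r < 1 /\ forall q n, q0 <= q -> Cmod (u q n) <= K * r ^ n) ->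
  cv_abs_unif a u.
Proof.
  intro H. split.
  - intros q Hq. destruct (H q Hq) as [K [r [Hr Hb]]].
    apply (ex_series_geom_dom _ K r Hr). intro n. rewrite Rabs_right by (apply Rle_ge, Cmod_ge_0). apply Hb; lra.
  - intros q0 Hq0 eps Heps. destruct (H q0 Hq0) as [K [r [Hr Hb]]].
    destruct (is_lim_seq_0_small _ _ (lim_geom_0 (2 * K / (1 - r) * r) r Hr) Heps) as [N HN].
    exists N. intros n Hn q Hq. specialize (HN n Hn).
    replace (sum_n (u q) n - C_Series (u q))%C with (- (C_Series (u q) - sum_n (u q) n))%C by ring.
    rewrite Cmod_opp. eapply Rle_lt_trans. apply (C_Series_tail (u q) K r n Hr). intro k; auto.
    eapply Rle_lt_trans; [|exact HN]. eapply Rle_trans; [|apply Rle_abs]. right. simpl. ring.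
Qed.

Section Series.
Variables (f : R -> C) (M a : R).
Hypotheses (Ha : 0 < a) (Hf : forall k, Cmod (C_Derive_n f k 0) <= M * a ^ k).

Lemma series_M_ge0 : 0 <= M.
Proof. specialize (Hf 0%nat). generalize (Cmod_ge_0 (C_Derive_n f 0 0)). simpl in Hf. lra. Qed.

Lemma even_term_bound q m : 0 < q -> Cmod (even_term f q m) <= M * ((INR (2 * m) + 1) * (a / q) ^ (2 * m)).
Proof.
  intros Hq. rewrite even_term_coef by lra. rewrite Cmod_mult, Cmod_R.
  assert (Hp : 0 < q ^ (2 * m)) by now apply pow_lt. assert (Hm := pos_INR m). assert (Hc := binom_neg_half_le_1 m).
  assert (HM := series_M_ge0).
  unfold even_coef. rewrite !Rabs_mult, Rabs_inv, (Rabs_right (2 * _ + 1)), (Rabs_right (q ^ _)) by lra.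
  unfold Rdiv. rewrite Rpow_mult_distr, pow_inv, mult_INR. simpl (INR 2).
  apply Rle_trans with ((2 * INR m + 1) * / q ^ (2 * m) * (M * a ^ (2 * m))).
  2: { right. ring. }
  assert (Hi : 0 < / q ^ (2 * m)) by now apply Rinv_0_lt_compat.
  apply Rmult_le_compat; auto using Cmod_ge_0.
  - repeat apply Rmult_le_pos; auto using Rabs_pos; lra.
  - apply Rmult_le_compat_r. lra. rewrite <- (Rmult_1_r (2 * INR m + 1)) at 2. apply Rmult_le_compat_l; lra.
Qed.

Lemma full_term_bound q k : 0 < q -> Cmod (full_term f q k) <= M * ((INR k + 1) * (a / q) ^ k).
Proof.
  intros Hq. assert (HM := series_M_ge0).
  assert (Hnn : 0 <= M * ((INR k + 1) * (a / q) ^ k)).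
  { apply Rmult_le_pos; auto. apply Rmult_le_pos. generalize (pos_INR k); lra. apply pow_le.
    left. now apply Rdiv_lt_0_compat. }
  destruct (Nat.Even_or_Odd k) as [[m ->]|[m ->]].
  - rewrite full_term_even, Cmod_mult, Cmod_R, Rabs_right by lra.
    assert (H := even_term_bound q m Hq). lra.
  - rewrite Nat.add_1_r in *. rewrite full_term_odd, Cmod_0. exact Hnn.
Qed.

Lemma ratio_bound q0 : a < q0 -> 0 <= a / q0 < 1 /\ forall q n, q0 <= q -> (a / q) ^ n <= (a / q0) ^ n.
Proof.
  intro Hq0. split.
  - split. left; apply Rdiv_lt_0_compat; lra. apply Rmult_lt_reg_r with q0. lra. field_simplify; lra.
  - intros q n Hq. apply pow_incr. split. left; apply Rdiv_lt_0_compat; lra.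
    apply Rmult_le_compat_l. lra. apply Rinv_le_contravar; lra.
Qed.

Lemma full_term_geom q0 : a < q0 -> exists K r, 0 <= r < 1 /\
  forall q n, q0 <= q -> Cmod (full_term f q n) <= K * r ^ n.
Proof.
  intro Hq0. destruct (ratio_bound q0 Hq0) as [Hx Hxq]. assert (HM := series_M_ge0).
  destruct (linear_geom_le (a / q0) Hx) as [K [r [HK0 [Hr HK]]]].
  exists (M * K), r. split; auto. intros q n Hq. eapply Rle_trans. apply full_term_bound. lra.
  rewrite Rmult_assoc. apply Rmult_le_compat_l; auto. eapply Rle_trans; [|apply HK].
  apply Rmult_le_compat_l. generalize (pos_INR n); lra. auto.
Qed.

Lemma even_term_geom q0 : a < q0 -> exists K r, 0 <= r < 1 /\
  forall q n, q0 <= q -> Cmod (even_term f q n) <= K * r ^ n.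
Proof.
  intro Hq0. destruct (full_term_geom q0 Hq0) as [K [r [Hr H]]].
  exists (2 * K), (r ^ 2). split. nra. intros q n Hq. rewrite <- pow_mult.
  specialize (H q (2 * n)%nat Hq). rewrite full_term_even, Cmod_mult, Cmod_R, Rabs_right in H by lra. lra.
Qed.

Lemma C_Series_full q : a < q -> C_Series (full_term f q) = (RtoC (1 / 2) * C_Series (even_term f q))%C.
Proof.
  intro Hq. destruct (even_term_geom q Hq) as [K [r [Hr H]]].
  assert (Hq0 : q <> 0) by lra.
  assert (Hpr : forall pr : C -> R, (forall w, Rabs (pr w) <= Cmod w) ->
     (forall w, pr (RtoC (1 / 2) * w)%C = 1 / 2 * pr w) -> pr (RtoC 0) = 0 ->
     Series (fun k => pr (full_term f q k)) = 1 / 2 * Series (fun k => pr (even_term f q k))).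
  { intros pr Hp1 Hp2 Hp3. apply is_series_unique. apply is_series_even.
    - intro m. rewrite full_term_odd. exact Hp3.
    - apply (is_series_ext (fun m => 1 / 2 * pr (even_term f q m))).
      { intro m. rewrite full_term_even, Hp2; auto. }
      apply is_series_scal_R. apply Series_correct. apply (ex_series_geom_dom _ K r Hr).
      intro n. eapply Rle_trans. apply Hp1. apply H. lra. }
  unfold C_Series. rewrite (Hpr Re), (Hpr Im).
  - apply injective_projections; simpl; ring.
  - apply im_le_Cmod.
  - intros [w1 w2]. unfold Im; simpl. ring.
  - reflexivity.
  - apply re_le_Cmod.
  - intros [w1 w2]. unfold Re; simpl. ring.
  - reflexivity.
Qed.
End Series.

(** * The Hankel transform *)

Section RealHankel.
Variables (M a q : R) (v : R -> R) (d : nat -> R).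
Hypotheses (Ha : 0 < a < q) (Hd : exp_type M a d).
Hypothesis (Hv : forall x, 0 <= x -> is_pseries d x (v x)).
Hypothesis (Hdecay : is_lim (fun x => sqrt x * v x) p_infty 0).

(* The substitution x = t / q brings the frequency to 1 and the type to a / q. *)
Let c k := d k / q ^ k.

Lemma scaled_value t : 0 <= t -> PSeries c t = v (t / q).
Proof.
  intro Ht. assert (Htq : 0 <= t / q) by (apply Rmult_le_pos; auto; apply inv_ge0; lra).
  rewrite <- (is_pseries_unique _ _ _ (Hv _ Htq)). apply Series_ext. intro k. unfold c, Rdiv.
  rewrite Rpow_mult_distr, pow_inv. ring.
Qed.

Lemma scaled_exp_type : exp_type M (a / q) c.
Proof.
  intro k. unfold c. assert (Hp : 0 < q ^ k) by (apply pow_lt; lra). assert (F := fact_pos k).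
  unfold Rdiv at 1. rewrite Rabs_mult, Rabs_inv, (Rabs_right (q ^ k)) by lra.
  replace (M * (a / q) ^ k / INR (fact k)) with (M * a ^ k / INR (fact k) * / q ^ k).
  apply Rmult_le_compat_r. now apply inv_ge0. apply Hd.
  unfold Rdiv. rewrite Rpow_mult_distr, pow_inv. ring.
Qed.

Lemma scaled_decay : is_lim (fun t => sqrt t * PSeries c t) p_infty 0.
Proof.
  apply (is_lim_ext_loc (fun t => sqrt q * (sqrt (t / q) * v (t / q)))).
  - exists 0. intros t Ht. rewrite scaled_value by lra. rewrite <- Rmult_assoc, <- sqrt_mult_alt by lra.
    do 2 f_equal. field. lra.
  - replace (Finite 0) with (Rbar_mult (sqrt q) 0) by (simpl; now rewrite Rmult_0_r).
    apply is_lim_scal_l. apply (is_lim_comp (fun x => sqrt x * v x) (fun t => t / q) p_infty 0 p_infty Hdecay).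
    + apply (is_lim_ext (fun t => / q * t)). intro t; unfold Rdiv; ring.
      replace p_infty with (Rbar_mult (/ q) p_infty) at 2.
      apply is_lim_scal_l, is_lim_id. rewrite Rbar_mult_comm.
      apply is_Rbar_mult_unique, is_Rbar_mult_p_infty_pos. simpl. apply Rinv_0_lt_compat; lra.
    + exists 0. intros; discriminate.
Qed.

Lemma hankel_real : exists I : R -> R,
  (forall X, 0 < X -> is_RInt (fun x => x * J1 (q * x) * v x) 0 X (I X)) /\
  is_lim I p_infty (/ q ^ 2 * Series (fun m => even_coef m * / q ^ (2 * m) * (d (2 * m)%nat * INR (fact (2 * m))))).
Proof.
  set (h := fun x => x * J1 x * PSeries c x).
  assert (Hb : 0 < a / q < 1).
  { split. apply Rdiv_lt_0_compat; lra. apply Rmult_lt_reg_r with q. lra. field_simplify; lra. }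
  assert (Habel := hankel_abel_sum M (a / q) c Hb scaled_exp_type scaled_decay). fold h in Habel.
  exists (fun X => / q ^ 2 * RInt h 0 (q * X)). split.
  - intros X HX. assert (Hh : is_RInt h (q * 0 + 0) (q * X + 0) (RInt h 0 (q * X))).
    { rewrite Rmult_0_r, !Rplus_0_r. apply is_RInt_cont. intro x. exact (h_cont M (a / q) c Hb scaled_exp_type x). }
    apply (is_RInt_comp_lin (V := R_NormedModule) h q 0 0 X) in Hh.
    apply (is_RInt_scal (V := R_NormedModule) _ 0 X (/ q ^ 2)) in Hh.
    eapply is_RInt_ext; [|exact Hh]. intros x Hx. rewrite Rmin_left in Hx by lra.
    unfold scal; simpl; unfold mult; simpl. unfold h. rewrite Rplus_0_r, scaled_value by nra.
    replace (q * x / q) with x by (field; lra). eqR. field. lra.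
  - apply (is_lim_scal_l (fun X => RInt h 0 (q * X)) (/ q ^ 2) p_infty (Finite _)).
    replace (Series _) with (Re (C_Series (abel_term c 0))).
    + apply (is_lim_comp (fun T => RInt h 0 T) (fun X => q * X) p_infty _ p_infty Habel).
      * replace p_infty with (Rbar_mult q p_infty) at 2. apply is_lim_scal_l, is_lim_id.
        rewrite Rbar_mult_comm. apply is_Rbar_mult_unique, is_Rbar_mult_p_infty_pos. simpl. lra.
      * exists 0. intros; discriminate.
    + change (Series (fun k => Re (abel_term c 0 k)) = Series (fun m => even_coef m * / q ^ (2 * m) * (d (2 * m)%nat * INR (fact (2 * m))))).
      assert (Ht : forall k w, snd (moment_ext 0 (S k)) = RtoC w -> Re (abel_term c 0 k) = c k * INR (fact (S k)) * w).
      { intros k w Hw. unfold abel_term. rewrite Hw. unfold Re, Cmult, RtoC; cbn [fst snd]. ring. }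
      apply is_series_unique. apply is_series_even.
      * intro m. rewrite (Ht _ 0). ring. apply moment_ext_0.
      * assert (Hterm : forall m, even_coef m * / q ^ (2 * m) * (d (2 * m)%nat * INR (fact (2 * m)))
            = Re (abel_term c 0 (2 * m))).
        { intro m. rewrite (Ht _ (binom_neg_half m)) by apply moment_ext_0. unfold c, even_coef.
          rewrite fact_simpl, mult_INR, S_INR, mult_INR. simpl (INR 2). field. apply pow_nonzero; lra. }
        apply (is_series_ext _ _ _ Hterm). apply Series_correct.
        apply (ex_series_ext _ _ (fun m => eq_sym (Hterm m))).
        destruct (abel_term_bound M (a / q) c Hb scaled_exp_type) as [K [r [Hr H]]].
        apply (ex_series_geom_dom _ K (r ^ 2)). nra. intro n. eapply Rle_trans. apply re_le_Cmod.
        rewrite <- pow_mult. apply H. rewrite Cmod_0. lra.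
Qed.
End RealHankel.

Lemma is_series_proj (x : nat -> C) (l : C) :
  is_series (K := R_AbsRing) (V := C_R_NormedModule) x l ->
  is_series (fun k => Re (x k)) (Re l) /\ is_series (fun k => Im (x k)) (Im l).
Proof.
  intro H.
  assert (Hre : forall n, sum_n (fun k => Re (x k)) n = Re (sum_n (G := C_R_NormedModule) x n)).
  { induction n as [|n IH]. now rewrite !sum_O. rewrite !sum_Sn, IH. reflexivity. }
  assert (Him : forall n, sum_n (fun k => Im (x k)) n = Im (sum_n (G := C_R_NormedModule) x n)).
  { induction n as [|n IH]. now rewrite !sum_O. rewrite !sum_Sn, IH. reflexivity. }
  assert (Hl := proj1 (filterlim_locally _ _) H).
  split; apply filterlim_locally; intro eps; generalize (Hl eps); apply filter_imp; intros n [H1 H2].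
  - rewrite Hre. exact H1.
  - rewrite Him. exact H2.
Qed.

Lemma taylor_at_proj (f : R -> C) (x : R) : taylor_at f x ->
  is_pseries (fun k => Re (C_Derive_n f k 0) / INR (fact k)) x (Re (f x)) /\
  is_pseries (fun k => Im (C_Derive_n f k 0) / INR (fact k)) x (Im (f x)).
Proof.
  intro H. destruct (is_series_proj _ _ H) as [H1 H2].
  assert (Hs : forall k, ((-1) ^ k * (-1) ^ k = 1)).
  { intro k. rewrite <- Rpow_mult_distr. replace (-1 * -1) with 1 by ring. apply pow1. }
  assert (Hp : forall k, pow_n (K := R_AbsRing) (- x) k = (-1) ^ k * x ^ k).
  { intro k. rewrite pow_n_pow. rewrite <- Rpow_mult_distr. f_equal. ring. }
  split; apply is_pseries_R.
  - eapply is_series_ext; [|exact H1]. intro k. specialize (Hs k). assert (F := INR_fact_neq_0 k).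
    transitivity ((-1) ^ k * x ^ k * Re (g_deriv f k 0 / RtoC (INR (fact k)))%C).
    { rewrite <- (Hp k). reflexivity. }
    unfold g_deriv, Cdiv. rewrite <- RtoC_inv by auto.
    destruct (C_Derive_n f k 0) as [w1 w2]. unfold Re, Cmult, RtoC; cbn [fst snd].
    eqR. transitivity (((-1) ^ k * (-1) ^ k) * w1 / INR (fact k) * x ^ k). field; auto. rewrite Hs. field; auto.
  - eapply is_series_ext; [|exact H2]. intro k. specialize (Hs k). assert (F := INR_fact_neq_0 k).
    transitivity ((-1) ^ k * x ^ k * Im (g_deriv f k 0 / RtoC (INR (fact k)))%C).
    { rewrite <- (Hp k). reflexivity. }
    unfold g_deriv, Cdiv. rewrite <- RtoC_inv by auto.
    destruct (C_Derive_n f k 0) as [w1 w2]. unfold Im, Cmult, RtoC; cbn [fst snd].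
    eqR. transitivity (((-1) ^ k * (-1) ^ k) * w2 / INR (fact k) * x ^ k). field; auto. rewrite Hs. field; auto.
Qed.

Lemma is_hankel_of_parts (f : R -> C) (q lr li : R) (Ir Ii : R -> R) :
  (forall X, 0 < X -> is_RInt (fun x => x * J1 (q * x) * Re (f x)) 0 X (Ir X)) ->
  (forall X, 0 < X -> is_RInt (fun x => x * J1 (q * x) * Im (f x)) 0 X (Ii X)) ->
  is_lim Ir p_infty lr -> is_lim Ii p_infty li -> is_hankel 1 f q (lr, li).
Proof.
  intros Hr Hi Lr Li P [eps HP].
  assert (Er := proj1 (filterlim_locally Ir lr) Lr eps).
  assert (Ei := proj1 (filterlim_locally Ii li) Li eps).
  destruct Er as [X1 H1]. destruct Ei as [X2 H2].
  exists (fun s => s = 0) (fun X => Rabs X1 + Rabs X2 < X).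
  - reflexivity.
  - exists (Rabs X1 + Rabs X2). auto.
  - intros s X -> HX. simpl.
    assert (A1 := Rabs_pos X1). assert (A2 := Rabs_pos X2). assert (B1 := Rle_abs X1). assert (B2 := Rle_abs X2).
    exists (Ir X, Ii X). split.
    + apply is_RInt_fct_extend_pair.
      * eapply is_RInt_ext; [|apply (Hr X); lra]. intros x _. simpl. unfold Re. eqR. ring.
      * eapply is_RInt_ext; [|apply (Hi X); lra]. intros x _. simpl. unfold Im. eqR. ring.
    + apply HP. split; [apply H1 | apply H2]; lra.
Qed.

Theorem theorem2 (f : R -> C) (G : C -> C) (delta M a : R)
  (f_not_odd : ~ (forall x : R, f (- x) = Copp (f x)))
  (f_regular_0 : locally 0 (fun x => taylor_at f x))
  (f_taylor : forall x : R, 0 <= x -> taylor_at f x)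
  (f_decay : filterlim (fun x : R => (RtoC (sqrt x) * f x)%C)
               (Rbar_locally p_infty) (locally (RtoC 0)))
  (delta_bounds : 3 / 4 < delta < 1)
  (G_interp : forall k : nat, G (RtoC (INR k)) = g_deriv f k 0)
  (G_analytic : analytic_on (half_plane delta) G)
  (a_pos : 0 < a)
  (G_growth : forall s : C, half_plane delta s ->
     Cmod (G s) < M * Rpower a (Re s)) :
  (forall q : R, a < q ->
     is_hankel 1 f q (RtoC (1 / q ^ 2) * C_Series (even_term f q))%C /\
     is_hankel 1 f q (RtoC (2 / q ^ 2) * C_Series (full_term f q))%C) /\
  cv_abs_unif a (even_term f) /\
  cv_abs_unif a (full_term f).
Proof.
  assert (Hf : forall k, Cmod (C_Derive_n f k 0) <= M * a ^ k).
  { intro k. assert (H : half_plane delta (RtoC (INR k))).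
    { unfold half_plane. simpl. generalize (pos_INR k). lra. }
    apply G_growth in H. rewrite G_interp in H. unfold g_deriv in H.
    rewrite Cmod_mult, Cmod_R, pow_1_abs, Rmult_1_l in H. simpl Re in H. rewrite Rpower_pow in H by auto. lra. }
  assert (HE : forall pr : C -> R, (forall w, Rabs (pr w) <= Cmod w) ->
      exp_type M a (fun k => pr (C_Derive_n f k 0) / INR (fact k))).
  { intros pr Hpr k. assert (F := fact_pos k). unfold Rdiv. rewrite Rabs_mult, Rabs_inv, (Rabs_right (INR _)) by lra.
    apply Rmult_le_compat_r. now apply inv_ge0. eapply Rle_trans; [apply Hpr|apply Hf]. }
  assert (Hdec : is_lim (fun x => sqrt x * Re (f x)) p_infty 0 /\ is_lim (fun x => sqrt x * Im (f x)) p_infty 0).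
  { assert (Hl := proj1 (filterlim_locally _ _) f_decay).
    split; apply filterlim_locally; intro eps; generalize (Hl eps); apply filter_imp; intros x [H1 H2].
    - replace (sqrt x * Re (f x)) with (fst (RtoC (sqrt x) * f x)%C). exact H1. simpl. unfold Re. ring.
    - replace (sqrt x * Im (f x)) with (snd (RtoC (sqrt x) * f x)%C). exact H2. simpl. unfold Im. ring. }
  assert (Heven : forall q, a < q -> is_hankel 1 f q (RtoC (1 / q ^ 2) * C_Series (even_term f q))%C).
  { intros q Hq.
    assert (Hser : forall pr : C -> R, (forall (s : R) w, pr (RtoC s * w)%C = s * pr w) ->
       Series (fun m => even_coef m * / q ^ (2 * m) * (pr (C_Derive_n f (2 * m) 0) / INR (fact (2 * m)) * INR (fact (2 * m))))
       = Series (fun m => pr (even_term f q m))).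
    { intros pr Hpr. apply Series_ext. intro m. rewrite even_term_coef, Hpr by lra. field.
      split. apply pow_nonzero; lra. apply INR_fact_neq_0. }
    destruct (hankel_real M a q (fun x => Re (f x)) _ (conj a_pos Hq) (HE Re re_le_Cmod)
      (fun x Hx => proj1 (taylor_at_proj f x (f_taylor x Hx))) (proj1 Hdec)) as [Ir [Hr Lr]].
    destruct (hankel_real M a q (fun x => Im (f x)) _ (conj a_pos Hq) (HE Im im_le_Cmod)
      (fun x Hx => proj2 (taylor_at_proj f x (f_taylor x Hx))) (proj2 Hdec)) as [Ii [Hi Li]].
    rewrite (Hser Re) in Lr by (intros s [w1 w2]; unfold Re; simpl; ring).
    rewrite (Hser Im) in Li by (intros s [w1 w2]; unfold Im; simpl; ring).
    assert (H := is_hankel_of_parts f q _ _ Ir Ii Hr Hi Lr Li).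
    replace (RtoC (1 / q ^ 2) * C_Series (even_term f q))%C with
      (/ q ^ 2 * Series (fun m => Re (even_term f q m)), / q ^ 2 * Series (fun m => Im (even_term f q m))).
    exact H. unfold C_Series. apply injective_projections; simpl; field; lra. }
  split; [|split].
  - intros q Hq. split. now apply Heven.
    replace (RtoC (2 / q ^ 2) * C_Series (full_term f q))%C with (RtoC (1 / q ^ 2) * C_Series (even_term f q))%C.
    now apply Heven.
    rewrite (C_Series_full f M a a_pos Hf q Hq), Cmult_assoc, <- RtoC_mult. do 2 f_equal. field. lra.
  - apply cv_abs_unif_geom. intros q0 Hq0. now apply (even_term_geom f M a).
  - apply cv_abs_unif_geom. intros q0 Hq0. now apply (full_term_geom f M a).
Qed.
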